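(* For every $g \geq 4$, the linearization map $\Phi\colon \mathfrak{K}_g^s \rightarrow \operatorname{Sym}^2((\wedge^2 H)/\mathbb{Q})$, defined on generators by $\Phi([\![\kappa_1,\kappa_2]\!]_s) = \kappa_1 \cdot \kappa_2$, is an isomorphism of $\mathbb{Q}$-vector spaces.
   Context: $H = \mathbb{Q}^{2g}$, $H_{\mathbb{Z}} = \mathbb{Z}^{2g}\subset H$, and $\omega\colon H \times H \to \mathbb{Q}$ is the standard symplectic form. Using $\omega$ to identify $H$ with its dual, $\omega$ is regarded as the element $\omega = a_1\wedge b_1+\cdots+a_g\wedge b_g \in \wedge^2 H_{\mathbb{Z}}$, where $\{a_1,b_1,\ldots,a_g,b_g\}$ is any symplectic basis. $(\wedge^2 H)/\mathbb{Q}$ is the quotient of $\wedge^2 H$ by the $\mathbb{Q}$-span of $\omega$, and $(\wedge^2 H_{\mathbb{Z}})/\mathbb{Z}$ is the quotient of $\wedge^2 H_{\mathbb{Z}}$ by the $\mathbb{Z}$-span of $\omega$, a lattice in $(\wedge^2 H)/\mathbb{Q}$. For $x,y\in H$, $x\wedge y$ also denotes its image in $(\wedge^2 H)/\mathbb{Q}$. The symmetric contraction is the alternating bilinear map $\mathfrak{c}\colon ((\wedge^2 H)/\mathbb{Q})\times((\wedge^2 H)/\mathbb{Q})\to \operatorname{Sym}^2(H)$ given by $$\mathfrak{c}(x\wedge y,z\wedge w)=\omega(x,z)\,y\cdot w-\omega(x,w)\,y\cdot z-\omega(y,z)\,x\cdot w+\omega(y,w)\,x\cdot z\qquad (x,y,z,w\in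 H)$$ (this is well defined on the quotient). Elements $\kappa_1,\kappa_2\in(\wedge^2 H)/\mathbb{Q}$ are sym-orthogonal if $\mathfrak{c}(\kappa_1,\kappa_2)=0$. A symplectic pair is an element of $(\wedge^2 H_{\mathbb{Z}})/\mathbb{Z}$ of the form $a\wedge b$ with $a,b\in H_{\mathbb{Z}}$ and $\omega(a,b)=1$. $\mathfrak{K}_g^s$ is the $\mathbb{Q}$-vector space with the following presentation. Generators: a formal symbol $[\![\kappa_1,\kappa_2]\!]_s$ for all sym-orthogonal $\kappa_1,\kappa_2\in(\wedge^2 H)/\mathbb{Q}$ such that $\kappa_1$ or $\kappa_2$ (or both) is a symplectic pair. Relations: (1) for all generators, $[\![\kappa_2,\kappa_1]\!]_s=[\![\kappa_1,\kappa_2]\!]_s$; (2) for all symplectic pairs $a\wedge b$, all $\kappa_1,\kappa_2\in(\wedge^2 H)/\mathbb{Q}$ that are sym-orthogonal to $a\wedge b$, and all $\lambda_1,\lambda_2\in\mathbb{Q}$, $[\![a\wedge b,\lambda_1\kappa_1+\lambda_2\kappa_2]\!]_s=\lambda_1[\![a\wedge b,\kappa_1]\!]_s+\lambda_2[\![a\wedge b,\kappa_2]\!]_s$. The formula for $\Phi$ takes relations to relations, so it gives a well-defined linear map; $\kappa_1\cdot\kappa_2$ denotes the product in the symmetric square. *)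

(* Defs.v *)
(* Mathematical Components, with finitely supported functions ({malg F[X]})
   from multinomials serving as free modules, and classical logic from boolp. *)
From HB Require Import structures.
From mathcomp Require Import all_boot all_order all_algebra.
From mathcomp Require Import finmap monalg boolp ring.

Set Implicit Arguments.
Unset Strict Implicit.
Unset Printing Implicit Defensive.

Import GRing.Theory.
Local Open Scope ring_scope.
Local Open Scope quotient_scope.

Section Span.
Context {F : fieldType} {V : lmodType F}.
Implicit Type R : V -> Prop.

Definition span R : {pred V} := fun v =>
  `[< exists (n : nat) (c : 'I_n -> F) (r : 'I_n -> V),
        (forall i, R (r i)) /\ v = \sum_(i < n) c i *: r i >].

Lemma mem_span R v : R v -> v \in span R.
Proof.
move=> Rv; apply/asboolP; exists 1%N, (fun=> 1), (fun=> v).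
by split=> //; rewrite big_ord1 scale1r.
Qed.

Lemma span_submod_closed R : submod_closed (span R).
Proof.
split=> [|a u v /asboolP[n [c [r [Rr ->]]]] /asboolP[m [d [s [Rs ->]]]]].
  apply/asboolP; exists 0%N, (fun=> 0), (fun=> 0).
  by split=> [[]//|]; rewrite big_ord0.
apply/asboolP; exists (n + m)%N.
exists (fun i => match split i with inl j => a * c j | inr k => d k end).
exists (fun i => match split i with inl j => r j | inr k => s k end).
split=> [i|]; first by case: (split i).
rewrite big_split_ord /= scaler_sumr; congr (_ + _); apply: eq_bigr => i _.
  by rewrite (unsplitK (inl i)) scalerA.
by rewrite (unsplitK (inr i)).
Qed.

HB.instance Definition _ R :=
  GRing.isSubmodClosed.Build F V (span R)
    (GRing.submod_closed_semi (span_submod_closed R)).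

End Span.

Definition vquot (F : fieldType) (V : lmodType F) (R : V -> Prop) : Type :=
  Quotient.quot (span R).

HB.lock Definition vproj (F : fieldType) (V : lmodType F) (R : V -> Prop)
  (v : V) : vquot R := \pi_(Quotient.quot (span R)) v.
HB.lock Definition vrepr (F : fieldType) (V : lmodType F) (R : V -> Prop)
  (x : vquot R) : V := repr (x : Quotient.quot (span R)).

HB.lock Definition vquot_opp (F : fieldType) (V : lmodType F) (R : V -> Prop)
  (x : vquot R) : vquot R := vproj R (- vrepr x).
HB.lock Definition vquot_add (F : fieldType) (V : lmodType F) (R : V -> Prop)
  (x y : vquot R) : vquot R := vproj R (vrepr x + vrepr y).
HB.lock Definition vquot_scale (F : fieldType) (V : lmodType F)
  (R : V -> Prop) (a : F) (x : vquot R) : vquot R := vproj R (a *: vrepr x).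

HB.lock Definition vlift (F : fieldType) (V : lmodType F) (R : V -> Prop)
  (W : lmodType F) (f : {linear V -> W}) (f0 : forall v, R v -> f v = 0)
  (x : vquot R) : W := f (vrepr x).

Section VQuot.
Context {F : fieldType} {V : lmodType F} (R : V -> Prop).
Implicit Types (u v : V) (x y : vquot R).
Local Notation vproj := (vproj R).

Lemma vreprK : cancel (@vrepr F V R) vproj.
Proof. by move=> x; rewrite vproj.unlock vrepr.unlock; apply: reprK. Qed.

Lemma vproj_eq u v : vproj u = vproj v <-> u - v \in span R.
Proof.
by rewrite vproj.unlock (Quotient.idealrBE (span R)); split=> [/eqP|/eqP].
Qed.

Let repr_vproj v : vrepr (vproj v) - v \in span R.
Proof. by apply/vproj_eq; rewrite vreprK. Qed.

Lemma vquot_oppE v : vquot_opp (vproj v) = vproj (- v).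
Proof. by rewrite vquot_opp.unlock; apply/vproj_eq; rewrite -opprD rpredN. Qed.

Lemma vquot_addE u v : vquot_add (vproj u) (vproj v) = vproj (u + v).
Proof.
by rewrite vquot_add.unlock; apply/vproj_eq; rewrite opprD addrACA rpredD.
Qed.

Lemma vquot_scaleE a v : vquot_scale a (vproj v) = vproj (a *: v).
Proof.
by rewrite vquot_scale.unlock; apply/vproj_eq; rewrite -scalerBr rpredZ.
Qed.

Fact vquot_addA : associative (@vquot_add F V R).
Proof.
move=> x y z; rewrite -[x]vreprK -[y]vreprK -[z]vreprK.
by rewrite !vquot_addE addrA.
Qed.
Fact vquot_addC : commutative (@vquot_add F V R).
Proof.
by move=> x y; rewrite -[x]vreprK -[y]vreprK !vquot_addE addrC.
Qed.
Fact vquot_add0 : left_id (vproj 0) (@vquot_add F V R).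
Proof. by move=> x; rewrite -[x]vreprK vquot_addE add0r. Qed.
Fact vquot_addN : left_inverse (vproj 0) (@vquot_opp F V R) (@vquot_add F V R).
Proof. by move=> x; rewrite -[x]vreprK vquot_oppE vquot_addE addNr. Qed.

HB.instance Definition _ := Choice.copy (vquot R) (Quotient.quot (span R)).
HB.instance Definition _ := GRing.isZmodule.Build (vquot R)
  vquot_addA vquot_addC vquot_add0 vquot_addN.

Fact vproj_zmod : zmod_morphism vproj.
Proof. by move=> u v; rewrite -vquot_addE -vquot_oppE. Qed.
HB.instance Definition _ :=
  GRing.isZmodMorphism.Build V (vquot R) vproj vproj_zmod.

Fact vquot_scalerA a b x :
  vquot_scale a (vquot_scale b x) = vquot_scale (a * b) x.
Proof. by rewrite -[x]vreprK !vquot_scaleE scalerA. Qed.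
Fact vquot_scale1r : left_id 1 (@vquot_scale F V R).
Proof. by move=> x; rewrite -[x]vreprK vquot_scaleE scale1r. Qed.
Fact vquot_scalerDr : right_distributive (@vquot_scale F V R) +%R.
Proof.
move=> a x y; rewrite -[x]vreprK -[y]vreprK -raddfD !vquot_scaleE.
by rewrite scalerDr raddfD.
Qed.
Fact vquot_scalerDl x : {morph (@vquot_scale F V R)^~ x : a b / a + b}.
Proof.
by move=> a b; rewrite -[x]vreprK !vquot_scaleE scalerDl raddfD.
Qed.

HB.instance Definition _ := GRing.Zmodule_isLmodule.Build F (vquot R)
  vquot_scalerA vquot_scale1r vquot_scalerDr vquot_scalerDl.

Fact vproj_scalable : scalable vproj.
Proof. by move=> a v; apply: esym (vquot_scaleE a v). Qed.
HB.instance Definition _ :=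
  GRing.isScalable.Build F V (vquot R) *:%R vproj vproj_scalable.

Lemma vproj0 v : R v -> vproj v = 0.
Proof. by move=> Rv; rewrite -(raddf0 vproj) vproj_eq subr0 mem_span. Qed.

Section Lift.
Context {W : lmodType F} (f : {linear V -> W}).

Hypothesis f0 : forall v, R v -> f v = 0.

Lemma vliftE v : vlift f0 (vproj v) = f v.
Proof.
have /vproj_eq/asboolP[n [c [r [Rr e]]]] := vreprK (vproj v).
rewrite vlift.unlock; apply/eqP; rewrite -subr_eq0 -linearB e linear_sum big1// => i _.
by rewrite linearZ/= f0 // scaler0.
Qed.

Fact vlift_linear : linear (vlift f0).
Proof.
move=> a x y; rewrite -[x]vreprK -[y]vreprK -linearP !vliftE.
by rewrite linearP.
Qed.
HB.instance Definition _ :=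
  GRing.isLinear.Build F (vquot R) W *:%R (vlift f0) vlift_linear.
End Lift.

End VQuot.

HB.lock Definition fext (F : fieldType) (X : choiceType) (W : lmodType F)
  (f : X -> W) (m : {malg F[X]}) : W := \sum_(x <- msupp m) m@_x *: f x.

Section Free.
Context {F : fieldType} {X : choiceType} {W : lmodType F} (f : X -> W).
Local Notation fext := (fext f).

Lemma fextEw (m : {malg F[X]}) (d : {fset X}) : (msupp m `<=` d)%fset ->
  fext m = \sum_(x <- d) m@_x *: f x.
Proof.
move=> /fsubsetP md; rewrite fext.unlock; apply: big_fset_incl; first exact/fsubsetP.
by move=> x _ /mcoeff_outdom ->; rewrite scale0r.
Qed.

Fact fext_linear : linear fext.
Proof.
move=> a u v; pose d := (msupp u `|` msupp v)%fset.
have su : (msupp u `<=` d)%fset by apply: fsubsetUl.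
have sv : (msupp v `<=` d)%fset by apply: fsubsetUr.
have sw : (msupp (a *: u + v) `<=` d)%fset.
  apply: fsubset_trans (msuppD_le _ _) _.
  by rewrite fsubUset sv andbT (fsubset_trans (msuppZ_le _ _)).
rewrite (fextEw su) (fextEw sv) (fextEw sw) scaler_sumr -big_split /=.
by apply: eq_bigr => x _; rewrite mcoeffD mcoeffZ scalerDl scalerA.
Qed.
HB.instance Definition _ :=
  GRing.isLinear.Build F {malg F[X]} W *:%R fext fext_linear.

Lemma fextU x : fext << x >> = f x.
Proof.
by rewrite (fextEw msuppU_le) big_seq_fset1 mcoeffUU scale1r.
Qed.
End Free.

Inductive wedge2_rel (F : fieldType) (V : lmodType F) :
    {malg F[(V * V)%type]} -> Prop :=
| wedge2_alt (x : V) : wedge2_rel << (x, x) >>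
| wedge2_linl (a : F) (x x' y : V) : wedge2_rel
    (<< (a *: x + x', y) >> - (a *: << (x, y) >> + << (x', y) >>))
| wedge2_linr (a : F) (x y y' : V) : wedge2_rel
    (<< (x, a *: y + y') >> - (a *: << (x, y) >> + << (x, y') >>)).

Definition wedge2 (F : fieldType) (V : lmodType F) : Type :=
  vquot (@wedge2_rel F V).
HB.instance Definition _ (F : fieldType) (V : lmodType F) :=
  GRing.Lmodule.on (wedge2 V).

HB.lock Definition wedge (F : fieldType) (V : lmodType F) (x y : V) : wedge2 V :=
  vproj (@wedge2_rel F V) << (x, y) >>.

Section Wedge2.
Context {F : fieldType} {V : lmodType F}.
Implicit Types x y : V.

Definition alt_bilinear (W : lmodType F) (f : V -> V -> W) : Prop :=
  [/\ forall x, f x x = 0,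
      forall a x x' y, f (a *: x + x') y = a *: f x y + f x' y &
      forall a x y y', f x (a *: y + y') = a *: f x y + f x y'].

Lemma wedge2_rel0 (W : lmodType F) (f : V -> V -> W) : alt_bilinear f ->
  forall m, wedge2_rel m -> fext (fun p => f p.1 p.2) m = 0.
Proof.
case=> f0 fl fr _ [x|a x x' y|a x y y']; first by rewrite fextU.
  by rewrite linearB linearP /= !fextU /= fl subrr.
by rewrite linearB linearP /= !fextU /= fr subrr.
Qed.

Definition wedge2_lift (W : lmodType F) (f : V -> V -> W)
    (hf : alt_bilinear f) : {linear wedge2 V -> W} := vlift (wedge2_rel0 hf).

Lemma wedge2_liftE (W : lmodType F) (f : V -> V -> W) (hf : alt_bilinear f)
  x y : wedge2_lift hf (wedge x y) = f x y.
Proof. by rewrite wedge.unlock; apply: etrans (vliftE _ _) (fextU _ _). Qed.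

Lemma wedge2_ind (P : wedge2 V -> Prop) : P 0 ->
  (forall a x y v, P v -> P (a *: wedge x y + v)) -> forall v, P v.
Proof.
move=> P0 PD v; rewrite -[v]vreprK; set m := vrepr v.
rewrite (monalgE m); elim: (enum_fset (msupp m)) => [|[x y] r IH].
  by rewrite big_nil linear0.
rewrite big_cons.
have -> : << m@_(x, y) *g (x, y) >> = m@_(x, y) *: << (x, y) >>.
  by apply/malgP => k; rewrite mcoeffZ !mcoeffU mulr_natr.
by rewrite linearP; move: (PD m@_(x, y) x y _ IH); rewrite wedge.unlock.
Qed.
End Wedge2.

Inductive sym2_rel (F : fieldType) (V : lmodType F) :
    {malg F[(V * V)%type]} -> Prop :=
| sym2_comm (x y : V) : sym2_rel (<< (x, y) >> - << (y, x) >>)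
| sym2_linl (a : F) (x x' y : V) : sym2_rel
    (<< (a *: x + x', y) >> - (a *: << (x, y) >> + << (x', y) >>)).

Definition sym2 (F : fieldType) (V : lmodType F) : Type :=
  vquot (@sym2_rel F V).
HB.instance Definition _ (F : fieldType) (V : lmodType F) :=
  GRing.Lmodule.on (sym2 V).

HB.lock Definition smul (F : fieldType) (V : lmodType F) (x y : V) : sym2 V :=
  vproj (@sym2_rel F V) << (x, y) >>.

Section Sym2.
Context {F : fieldType} {V : lmodType F}.
Implicit Types x y : V.

Lemma smulC x y : smul x y = smul y x.
Proof.
by rewrite smul.unlock; apply/vproj_eq/mem_span/sym2_comm.
Qed.

Lemma smulPl a x x' y : smul (a *: x + x') y = a *: smul x y + smul x' y.
Proof.
by rewrite smul.unlock -linearP; apply/vproj_eq/mem_span/sym2_linl.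
Qed.

Lemma smulPr a x y y' : smul x (a *: y + y') = a *: smul x y + smul x y'.
Proof. by rewrite smulC smulPl ![smul _ x]smulC. Qed.

Fact smul_linear x : linear (smul x).
Proof. by move=> a y y'; apply: smulPr. Qed.
HB.instance Definition _ x :=
  GRing.isLinear.Build F V (sym2 V) *:%R (smul x) (smul_linear x).

Lemma smulBr x y y' : smul x (y - y') = smul x y - smul x y'.
Proof. exact: linearB. Qed.

Lemma smulZr a x y : smul x (a *: y) = a *: smul x y.
Proof. exact: linearZ. Qed.

Lemma smul0r x : smul x 0 = 0.
Proof. exact: linear0. Qed.

Lemma smulNr x y : smul x (- y) = - smul x y.
Proof. exact: linearN. Qed.

Lemma smul_sumr (I : Type) (r : seq I) (P : pred I) (f : I -> V) x :
  smul x (\sum_(i <- r | P i) f i) = \sum_(i <- r | P i) smul x (f i).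
Proof. exact: linear_sum. Qed.
End Sym2.

Local Notation "x ∧ y" := (wedge x y) (at level 40, no associativity).
Local Notation "x · y" := (smul x y) (at level 40, no associativity).

Section Symplectic.
Variable g : nat.

(* The first g coordinates are those along a_1, ..., a_g and the last g are
   those along b_1, ..., b_g. *)
Definition H : Type := 'rV[rat]_(g + g).
HB.instance Definition _ := GRing.Lmodule.on H.

Implicit Types x y z w : H.

Definition Ha (i : 'I_g) : H := delta_mx 0 (lshift g i).
Definition Hb (i : 'I_g) : H := delta_mx 0 (rshift g i).

Definition coordA x (i : 'I_g) : rat := (x : 'rV[rat]_(g + g)) 0 (lshift g i).
Definition coordB x (i : 'I_g) : rat := (x : 'rV[rat]_(g + g)) 0 (rshift g i).

Definition sform x y : rat :=
  \sum_(i < g) (coordA x i * coordB y i - coordB x i * coordA y i).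

Definition integral x : bool := (x : 'rV[rat]_(g + g)) \is a mxOver Num.int.

(* The element of wedge2 H corresponding to sform under the identification of
   H with its dual given by sform. *)
Definition omega : wedge2 H := \sum_(i < g) Ha i ∧ Hb i.

Definition wedge2Q : Type := vquot (fun v : wedge2 H => v = omega).
HB.instance Definition _ := GRing.Lmodule.on wedge2Q.

Definition projQ : {linear wedge2 H -> wedge2Q} := vproj (fun v => v = omega).

Lemma sformPl a x x' y : sform (a *: x + x') y = a * sform x y + sform x' y.
Proof.
rewrite /sform mulr_sumr -big_split; apply: eq_bigr => i _ /=.
by rewrite /coordA /coordB !mxE; ring.
Qed.

Lemma sformC x y : sform y x = - sform x y.
Proof. by rewrite /sform -sumrN; apply: eq_bigr => i _; ring. Qed.

Lemma sformPr a x y y' : sform x (a *: y + y') = a * sform x y + sform x y'.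
Proof.
by rewrite sformC sformPl opprD -mulrN -!(sformC _ x).
Qed.

Definition contr4 x y z w : sym2 H :=
  sform x z *: (y · w) - sform x w *: (y · z)
  - sform y z *: (x · w) + sform y w *: (x · z).

Let T x z w : H := sform x z *: w - sform x w *: z.

Lemma contr4E x y z w : contr4 x y z w = y · T x z w - x · T y z w.
Proof.
rewrite /T !smulBr !smulZr opprB addrA /contr4 -!addrA; congr (_ + (_ + _)).
exact: addrC.
Qed.

Lemma contr4C x y z w : contr4 z w x y = - contr4 x y z w.
Proof.
rewrite /contr4 (sformC x z) (sformC x w) (sformC y z) (sformC y w).
rewrite !scaleNr !opprD !opprK (smulC w y) (smulC w x) (smulC z y) (smulC z x).
by rewrite -!addrA; congr (_ + _); rewrite addrCA.
Qed.

Let T_alt x : alt_bilinear (T x).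
Proof.
split=> [z|a z z' w|a z w w']; first by rewrite /T subrr.
  rewrite /T sformPr scalerDl !scalerDr scalerN !scalerA (mulrC _ a).
  by rewrite opprD addrACA.
rewrite /T sformPr scalerDl !scalerDr scalerN !scalerA (mulrC _ a).
by rewrite opprD addrACA.
Qed.

Lemma contr4_altr x y : alt_bilinear (contr4 x y).
Proof.
have [Tx0 Txl Txr] := T_alt x; have [Ty0 Tyl Tyr] := T_alt y.
split=> [z|a z z' w|a z w w']; rewrite !contr4E.
- by rewrite Tx0 Ty0 !smul0r subrr.
- by rewrite Txl Tyl !smulPr scalerBr opprD addrACA.
- by rewrite Txr Tyr !smulPr scalerBr opprD addrACA.
Qed.

Lemma contr4_altl z w : alt_bilinear (fun x y => contr4 x y z w).
Proof.
have [e0 el er] := contr4_altr z w.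
split=> [x|a x x' y|a x y y']; rewrite !(contr4C z w).
- by rewrite e0 oppr0.
- by rewrite el opprD scalerN.
- by rewrite er opprD scalerN.
Qed.

Lemma sum_T x : \sum_(i < g) T x (Ha i) (Hb i) = - x.
Proof.
have AA i j : coordA (Ha i) j = (j == i)%:R.
  by rewrite /coordA mxE eqxx (inj_eq (@lshift_inj _ _)).
have AB i j : coordB (Ha i) j = 0.
  by rewrite /coordB mxE eqxx eq_rlshift.
have BA i j : coordA (Hb i) j = 0.
  by rewrite /coordA mxE eqxx eq_lrshift.
have BB i j : coordB (Hb i) j = (j == i)%:R.
  by rewrite /coordB mxE eqxx (inj_eq (@rshift_inj _ _)).
have sa i : sform x (Ha i) = - coordB x i.
  rewrite /sform (bigD1 i) //= AA AB eqxx mulr0 mulr1 sub0r big1 ?addr0// => j.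
  by rewrite AA AB => /negPf ->; rewrite !mulr0 subr0.
have sb i : sform x (Hb i) = coordA x i.
  rewrite /sform (bigD1 i) //= BA BB eqxx mulr0 mulr1 subr0 big1 ?addr0// => j.
  by rewrite BA BB => /negPf ->; rewrite !mulr0 subr0.
rewrite {2}(row_sum_delta (x : 'rV[rat]_(g + g))) big_split_ord /= opprD addrC.
rewrite -!sumrN -big_split; apply: eq_bigr => i _ /=.
by rewrite /T sa sb scaleNr.
Qed.

Definition contr_r x y : {linear wedge2 H -> sym2 H} :=
  wedge2_lift (contr4_altr x y).

Lemma contr_rE x y z w : contr_r x y (z ∧ w) = contr4 x y z w.
Proof. exact: wedge2_liftE. Qed.

Lemma contr_r_omega x y (v : wedge2 H) : v = omega -> contr_r x y v = 0.
Proof.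
move=> ->; rewrite linear_sum /=.
rewrite (eq_bigr _ (fun i _ => etrans (contr_rE x y _ _) (contr4E x y _ _))).
by rewrite sumrB -!smul_sumr !sum_T !smulNr smulC subrr.
Qed.

Definition contr_rW x y : {linear wedge2Q -> sym2 H} := vlift (@contr_r_omega x y).

Lemma contr_rWE x y z w : contr_rW x y (projQ (z ∧ w)) = contr4 x y z w.
Proof. exact: etrans (vliftE _ _) (wedge2_liftE _ _ _). Qed.

Lemma wedge2Q_ind (P : wedge2Q -> Prop) : P 0 ->
  (forall a x y k, P k -> P (a *: projQ (x ∧ y) + k)) -> forall k, P k.
Proof.
move=> P0 PD k.
suff Pproj v : P (projQ v) by rewrite -[k]vreprK; apply: Pproj.
apply: (wedge2_ind (P := fun v => P (projQ v))) v => [|a x y v Pv].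
  by rewrite linear0.
by rewrite linearP; apply: PD.
Qed.

Let scaleAC (U : lmodType rat) (a b : rat) (u u' v v' : U) :
  b *: (a *: u + u') + (a *: v + v') = a *: (b *: u + v) + (b *: u' + v').
Proof. by rewrite !scalerDr !scalerA (mulrC b) addrACA. Qed.

Lemma contr_rW_alt (k : wedge2Q) : alt_bilinear (fun x y => contr_rW x y k).
Proof.
have E a x y z w j : contr_rW x y (a *: projQ (z ∧ w) + j)
    = a *: contr4 x y z w + contr_rW x y j.
  by rewrite linearP; congr (_ *: _ + _); apply: contr_rWE.
split=> [x|a x x' y|a x y y']; elim/wedge2Q_ind: k => [|b z w k IH].
- exact: linear0.
- rewrite E IH addr0; have [e _ _] := contr4_altl z w.
  by rewrite e scaler0.
- by rewrite !linear0 addr0.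
- rewrite !E IH; have [_ e _] := contr4_altl z w.
  by rewrite e; apply: scaleAC.
- by rewrite !linear0 addr0.
- rewrite !E IH; have [_ _ e] := contr4_altl z w.
  by rewrite e; apply: scaleAC.
Qed.

Definition contr_l (k : wedge2Q) : {linear wedge2 H -> sym2 H} :=
  wedge2_lift (contr_rW_alt k).

Lemma contr_lE k x y : contr_l k (x ∧ y) = contr_rW x y k.
Proof. exact: wedge2_liftE. Qed.

Lemma contr_l_omega (k : wedge2Q) (v : wedge2 H) : v = omega -> contr_l k v = 0.
Proof.
move=> ->; elim/wedge2Q_ind: k => [|a x y k IH]; rewrite linear_sum.
  by rewrite big1 // => i _; apply: etrans (contr_lE _ _ _) (linear0 _).
move: IH; rewrite linear_sum => IH.
have -> : \sum_(i < g) contr_l (a *: projQ (x ∧ y) + k) (Ha i ∧ Hb i)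
  = a *: (- contr_r x y omega) + \sum_(i < g) contr_l k (Ha i ∧ Hb i).
  rewrite [contr_r x y omega](linear_sum (contr_r x y)) -sumrN scaler_sumr.
  rewrite -big_split; apply: eq_bigr => i _.
  rewrite !contr_lE linearP contr_rE -contr4C; congr (_ *: _ + _).
  exact: contr_rWE.
by rewrite contr_r_omega // oppr0 scaler0 add0r.
Qed.

(* The symmetric contraction; it is characterized by contrE, contrPl and
   contrPr. *)
Definition contr (k1 k2 : wedge2Q) : sym2 H := vlift (@contr_l_omega k2) k1.

Lemma contrE x y z w : contr (projQ (x ∧ y)) (projQ (z ∧ w)) = contr4 x y z w.
Proof.
exact: etrans (vliftE _ _) (etrans (contr_lE _ _ _) (contr_rWE _ _ _ _)).
Qed.

Lemma contrPl a k1 k1' k2 :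
  contr (a *: k1 + k1') k2 = a *: contr k1 k2 + contr k1' k2.
Proof. exact: linearP. Qed.

Lemma contrPr a k1 k2 k2' :
  contr k1 (a *: k2 + k2') = a *: contr k1 k2 + contr k1 k2'.
Proof.
have c0 k : contr 0 k = 0 by exact: linear0.
elim/wedge2Q_ind: k1 => [|b x y k IH]; first by rewrite !c0 scaler0 addr0.
have E j : contr (projQ (x ∧ y)) j = contr_rW x y j.
  exact: etrans (vliftE _ _) (contr_lE _ _ _).
by rewrite !contrPl IH !E linearP; apply: scaleAC.
Qed.

Lemma contr0r k : contr k 0 = 0.
Proof. by have := contrPr (- 1) k 0 0; rewrite !scaleN1r !addNr. Qed.

Lemma contrC k1 k2 : contr k2 k1 = - contr k1 k2.
Proof.
have c0l k : contr 0 k = 0 by exact: linear0.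
elim/wedge2Q_ind: k1 => [|a x y k1 IH1]; first by rewrite c0l contr0r oppr0.
rewrite contrPl contrPr IH1 opprD -scalerN; congr (_ *: _ + _).
elim/wedge2Q_ind: k2 {IH1} => [|b z w k2 IH2]; first by rewrite c0l contr0r oppr0.
by rewrite contrPl contrPr IH2 opprD -scalerN !contrE contr4C.
Qed.

Definition sym_orthogonal (k1 k2 : wedge2Q) : Prop := contr k1 k2 = 0.

(* The lattice (wedge^2 H_Z) / Z is identified with its image in wedge2Q, to
   which projQ (a ∧ b) belongs for all integral a and b. *)
Definition symplectic_pair (k : wedge2Q) : Prop :=
  exists a b : H,
    [/\ integral a, integral b, sform a b = 1 & k = projQ (a ∧ b)].

Definition is_gen (k1 k2 : wedge2Q) : Prop :=
  sym_orthogonal k1 k2 /\ (symplectic_pair k1 \/ symplectic_pair k2).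

Definition Kgen : Type := {p : wedge2Q * wedge2Q | `[< is_gen p.1 p.2 >]}.
HB.instance Definition _ := Choice.on Kgen.

Definition gen (k1 k2 : wedge2Q) (h : is_gen k1 k2) : {malg rat[Kgen]} :=
  << exist _ (k1, k2) (asboolT h) : Kgen >>.

(* In each relation the membership proofs of the generators involved are
   universally quantified; is_genC and is_gen_lin show that these proofs exist
   in all the required cases. *)
Inductive K_rel : {malg rat[Kgen]} -> Prop :=
| K_rel_sym k1 k2 (h : is_gen k1 k2) (h' : is_gen k2 k1) :
    K_rel (gen h' - gen h)
| K_rel_lin s k1 k2 (l1 l2 : rat) (h1 : is_gen s k1) (h2 : is_gen s k2)
    (h : is_gen s (l1 *: k1 + l2 *: k2)) :
    symplectic_pair s ->
    K_rel (gen h - (l1 *: gen h1 + l2 *: gen h2)).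

Lemma is_genC k1 k2 : is_gen k1 k2 -> is_gen k2 k1.
Proof.
move=> [o s]; split; last by case: s; [right | left].
by rewrite /sym_orthogonal contrC o oppr0.
Qed.

Lemma is_gen_pair s k : symplectic_pair s -> sym_orthogonal s k -> is_gen s k.
Proof. by move=> ps o; split=> //; left. Qed.

Lemma is_gen_lin s k1 k2 l1 l2 : symplectic_pair s ->
  sym_orthogonal s k1 -> sym_orthogonal s k2 ->
  is_gen s (l1 *: k1 + l2 *: k2).
Proof.
move=> ps o1 o2; apply: is_gen_pair => //.
rewrite /sym_orthogonal contrPr o1 scaler0 add0r -[_ *: k2]addr0.
by rewrite contrPr o2 contr0r scaler0 addr0.
Qed.

Definition Ks : Type := vquot K_rel.
HB.instance Definition _ := GRing.Lmodule.on Ks.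

Definition Kbr (k1 k2 : wedge2Q) (h : is_gen k1 k2) : Ks := vproj K_rel (gen h).

Lemma K_rel0 m :
  K_rel m -> fext (fun p : Kgen => (val p).1 · (val p).2) m = 0.
Proof.
case=> [k1 k2 h h'|s k1 k2 l1 l2 h1 h2 h _].
  by rewrite linearB /= !fextU /= smulC subrr.
rewrite linearB linearD !linearZ /= !fextU /= smulPr.
by rewrite smulZr subrr.
Qed.

Definition linearization : {linear Ks -> sym2 wedge2Q} := vlift K_rel0.

Lemma linearizationE k1 k2 (h : is_gen k1 k2) :
  linearization (Kbr h) = k1 · k2.
Proof. exact: etrans (vliftE _ _) (fextU _ _). Qed.

End Symplectic.

(* Main.v *)
Require Import Defs.
From mathcomp Require Import all_boot all_order all_algebra.
From mathcomp Require Import finmap monalg boolp ring lra zify.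

(* Let F(a, b; z, w) = [[a /\ b, z /\ w]] for a symplectic pair (a, b) and z, w
   orthogonal to it. The main step is that F is the restriction of a quadrilinear
   form B with the symmetries of Sym^2(wedge^2 H).
   - For z, w fixed and spanning a saturated isotropic plane, F(a, b; z, w) is the
     value at (a, b) of an alternating form E(z, w) on the orthogonal of z, w: it is
     forced by the relations involving (z, z* + w), (w, w* + z) and a third plane.
     Moreover E(z, w)(x, y) = E(x, y)(z, w).
   - B is built on the standard basis in stages, first on the orthogonal quadruples,
     then on those with one contraction, then on those with two.
   - F - B kills the explicit elements collected in the record [base]. This property
     of a symplectic basis is inherited by the bases obtained from it by the
     elementary moves x |-> x + x' and (x, y') |-> (x + y, y' - x'), so by Euclid's
     algorithm it holds for a basis containing any given a, and F - B = 0.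
   Correcting B by multiples of sform so that it kills omega gives a left inverse
   of the linearization. It is onto because a form with the symmetries of
   Sym^2(wedge^2 H) that kills omega and all s.k with s a symplectic pair
   orthogonal to k is zero. *)

(** The relations make F linear in (z, w) for a fixed symplectic pair (a, b), but not in (a, b), and
    only integral pairs are available. The remedy is to write z /\ w as a combination of symplectic
    bivectors, such as z /\ (zs + w) - z /\ zs, and to let the symmetry relation carry the linearity
    to the other side. Such an expression is valid only on pairs orthogonal to the auxiliary vector
    zs; the labour lies in comparing the expressions for different auxiliary vectors. The bound g >=
    4 is used mostly for vanishing: a quantity attached to two or three planes is antisymmetric in
    them and does not depend on one of them, so a further plane makes it equal to its own negative,
    and 2 is invertible. Similar comparisons explain why [base] asks for one sign or order only, so
    that the freely chosen coefficients of B can achieve it on the standard basis. To show that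
    [base] survives the moves, it is first strengthened to [inV] for all vectors of the basis; a
    moved basis then has few new vectors to examine. *)

Set Implicit Arguments.
Unset Strict Implicit.
Unset Printing Implicit Defensive.

Import Order.TTheory GRing.Theory Num.Theory.
Local Open Scope ring_scope.

(* A reflexive decision procedure for linear identities in a module. *)
Inductive mexp : Type :=
| MVar of nat | MZero | MAdd of mexp & mexp | MOpp of mexp
| MScale of rat & mexp.

Fixpoint mcoef (e : mexp) (i : nat) : rat :=
  match e with
  | MVar j => if i == j then 1 else 0
  | MZero => 0
  | MAdd e1 e2 => mcoef e1 i + mcoef e2 i
  | MOpp e1 => - mcoef e1 i
  | MScale c e1 => c * mcoef e1 i
  end.

Section MEval.
Variable M : lmodType rat.

Fixpoint meval (s : seq M) (e : mexp) : M :=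
  match e with
  | MVar j => nth 0 s j
  | MZero => 0
  | MAdd e1 e2 => meval s e1 + meval s e2
  | MOpp e1 => - meval s e1
  | MScale c e1 => c *: meval s e1
  end.

Lemma mevalE s e : meval s e = \sum_(i < size s) mcoef e i *: nth 0 s i.
Proof.
elim: e => [j||e1 IH1 e2 IH2|e1 IH1|c e1 IH1] /=.
- have [lt|ge] := ltnP j (size s).
    rewrite (bigD1 (Ordinal lt)) //= eqxx scale1r big1 ?addr0 // => i ne.
    by rewrite (negPf (_ : val i != j)) ?scale0r //; apply: contraNneq ne => e; apply/eqP/val_inj.
  rewrite nth_default // big1 // => i _; have lt := leq_trans (ltn_ord i) ge.
  by rewrite ltn_eqF ?scale0r.
- by rewrite big1 // => i _; rewrite scale0r.
- by rewrite IH1 IH2 -big_split; apply: eq_bigr => i _; rewrite scalerDl.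
- by rewrite IH1 -sumrN; apply: eq_bigr => i _; rewrite scaleNr.
- by rewrite IH1 scaler_sumr; apply: eq_bigr => i _; rewrite scalerA.
Qed.

(** Equality of coefficients as an iterated conjunction, so that unfolding it leaves one [ring] goal
    for each atom. *)
Fixpoint mall (n : nat) (e1 e2 : mexp) : Prop :=
  if n is n'.+1 then mcoef e1 n' = mcoef e2 n' /\ mall n' e1 e2 else True.

Lemma mallP s e1 e2 : mall (size s) e1 e2 -> meval s e1 = meval s e2.
Proof.
move=> h; rewrite !mevalE; apply: eq_bigr => -[i lt] _ /=; congr (_ *: _).
elim: (size s) lt h => //= n IH; rewrite ltnS leq_eqVlt => /predU1P[->|lt] [] //.
by move=> _; apply: IH.
Qed.
End MEval.

Ltac minsert x l :=
  lazymatch l with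
  | nil => constr:(cons x nil)
  | cons x _ => l
  | cons ?y ?l' => let l'' := minsert x l' in constr:(cons y l'')
  end.
Ltac matoms t l :=
  lazymatch t with
  | (?a + ?b)%R => let l' := matoms a l in matoms b l'
  | (- ?a)%R => matoms a l
  | (?c *: ?a)%R => matoms a l
  | 0%R => l
  | ?x => minsert x l
  end.
Ltac mindex x l :=
  lazymatch l with
  | cons x _ => constr:(O)
  | cons _ ?l' => let n := mindex x l' in constr:(S n)
  end.
Ltac mreify t l :=
  lazymatch t with
  | (?a + ?b)%R => let a' := mreify a l in let b' := mreify b l in
      constr:(MAdd a' b')
  | (- ?a)%R => let a' := mreify a l in constr:(MOpp a')
  | (?c *: ?a)%R => let a' := mreify a l in constr:(MScale c a')
  | 0%R => constr:(MZero)
  | ?x => let n := mindex x l in constr:(MVar n)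
  end.
Ltac lmod :=
  lazymatch goal with |- @eq ?T ?a ?b =>
    let l := matoms a (@nil T) in let l := matoms b l in
    let e1 := mreify a l in let e2 := mreify b l in
    apply: (@mallP _ l e1 e2); cbn [mall mcoef size eqtype.eq_op]; rewrite /=;
    repeat split; try reflexivity; ring
  end.

(** * Symplectic bases and elementary moves *)

Section Form.
Variable g : nat.
Implicit Types x y z w u v : H g.

Lemma sformDl x y z : sform (x + y) z = sform x z + sform y z.
Proof. by rewrite -[x in LHS]scale1r sformPl mul1r. Qed.

Lemma sformDr x y z : sform z (x + y) = sform z x + sform z y.
Proof. by rewrite -[x in LHS]scale1r sformPr mul1r. Qed.

Lemma sformxx x : sform x x = 0.
Proof. by have := sformC x x; lra. Qed.

Lemma sform0l x : sform 0 x = 0.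
Proof. by have := sformDl 0 0 x; rewrite addr0; lra. Qed.

Lemma sform0r x : sform x 0 = 0.
Proof. by rewrite sformC sform0l oppr0. Qed.

Lemma sformZl a x y : sform (a *: x) y = a * sform x y.
Proof. by rewrite -[a *: x]addr0 sformPl sform0l addr0. Qed.

Lemma sformZr a x y : sform x (a *: y) = a * sform x y.
Proof. by rewrite -[a *: y]addr0 sformPr sform0r addr0. Qed.

Lemma sformNl x y : sform (- x) y = - sform x y.
Proof. by rewrite -scaleN1r sformZl mulN1r. Qed.

Lemma sformNr x y : sform x (- y) = - sform x y.
Proof. by rewrite -scaleN1r sformZr mulN1r. Qed.

Lemma sform_suml (I : Type) (r : seq I) (f : I -> H g) y :
  sform (\sum_(i <- r) f i) y = \sum_(i <- r) sform (f i) y.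
Proof.
elim: r => [|i r IH]; first by rewrite !big_nil sform0l.
by rewrite !big_cons sformDl IH.
Qed.

Definition sformE := (sformDl, sformDr, sformNl, sformNr, sformZl, sformZr,
  sformxx, sform0l, sform0r).

Lemma integralD x y : integral x -> integral y -> integral (x + y).
Proof.
move=> /mxOverP ix /mxOverP iy; apply/mxOverP => i j.
by rewrite mxE rpredD.
Qed.

Lemma integralN x : integral x -> integral (- x).
Proof. by move=> /mxOverP ix; apply/mxOverP => i j; rewrite mxE rpredN. Qed.

Lemma integralZ a x : a \is a Num.int -> integral x -> integral (a *: x).
Proof.
by move=> ia /mxOverP ix; apply/mxOverP => i j; rewrite mxE rpredM.
Qed.

Lemma sform_int x y : integral x -> integral y -> sform x y \is a Num.int.
Proof.
move=> /mxOverP ix /mxOverP iy; rewrite /sform rpred_sum // => i _.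
by rewrite rpredB // rpredM /coordA /coordB.
Qed.

Lemma coordAa (i j : 'I_g) : coordA (Ha i) j = (j == i)%:R.
Proof. by rewrite /coordA mxE eqxx (inj_eq (@lshift_inj _ _)). Qed.
Lemma coordBa (i j : 'I_g) : coordB (Ha i) j = 0.
Proof. by rewrite /coordB mxE eqxx eq_rlshift. Qed.
Lemma coordAb (i j : 'I_g) : coordA (Hb i) j = 0.
Proof. by rewrite /coordA mxE eqxx eq_lrshift. Qed.
Lemma coordBb (i j : 'I_g) : coordB (Hb i) j = (j == i)%:R.
Proof. by rewrite /coordB mxE eqxx (inj_eq (@rshift_inj _ _)). Qed.

Lemma sform_a x (i : 'I_g) : sform x (Ha i) = - coordB x i.
Proof.
rewrite /sform (bigD1 i) //= coordAa coordBa eqxx mulr0 mulr1 sub0r.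
rewrite big1 ?addr0 // => j /negPf nij.
by rewrite coordAa coordBa nij !mulr0 subr0.
Qed.

Lemma sform_b x (i : 'I_g) : sform x (Hb i) = coordA x i.
Proof.
rewrite /sform (bigD1 i) //= coordAb coordBb eqxx mulr0 mulr1 subr0.
rewrite big1 ?addr0 // => j /negPf nij.
by rewrite coordAb coordBb nij !mulr0 subr0.
Qed.

(** Spanning is stated as nondegeneracy, which isometries transport at once and from which
    [symp_expand] recovers the coordinates. *)
Record symp (p : 'I_g -> H g * H g) : Prop := Symp {
  symp_int1 : forall i, integral (p i).1;
  symp_int2 : forall i, integral (p i).2;
  symp_12 : forall i, sform (p i).1 (p i).2 = 1;
  symp_ne11 : forall i j, i != j -> sform (p i).1 (p j).1 = 0;
  symp_ne12 : forall i j, i != j -> sform (p i).1 (p j).2 = 0;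
  symp_ne22 : forall i j, i != j -> sform (p i).2 (p j).2 = 0;
  symp_nondeg : forall v, (forall i, sform v (p i).1 = 0) ->
    (forall i, sform v (p i).2 = 0) -> v = 0 }.

(* The pair (x, x') is (a, b) or its image under a rotation by a multiple of
   90 degrees, where (a, b) = p i. *)
Definition hp (p : 'I_g -> H g * H g) i x x' : Prop :=
  [\/ x = (p i).1 /\ x' = (p i).2, x = (p i).2 /\ x' = - (p i).1,
      x = - (p i).1 /\ x' = - (p i).2 | x = - (p i).2 /\ x' = (p i).1].

Section Basis.
Variable p : 'I_g -> H g * H g.
Hypothesis sp : symp p.

Lemma hp0 i : hp p i (p i).1 (p i).2.
Proof. by constructor 1. Qed.

Lemma hp_rot i x x' : hp p i x x' -> hp p i x' (- x).
Proof.
case=> [] [-> ->]; rewrite ?opprK.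
- by constructor 2.
- by constructor 3.
- by constructor 4.
- by constructor 1.
Qed.

Lemma hp_neg i x x' : hp p i x x' -> hp p i (- x) (- x').
Proof. by move=> /hp_rot/hp_rot. Qed.

Lemma hp_rotV i x x' : hp p i x x' -> hp p i (- x') x.
Proof. by move=> /hp_rot/hp_neg; rewrite opprK. Qed.

Lemma hp_int i x x' : hp p i x x' -> integral x /\ integral x'.
Proof.
have [i1 i2] := (symp_int1 sp i, symp_int2 sp i).
by case=> [] [-> ->]; split=> //; apply: integralN.
Qed.

Lemma hp_sform i x x' : hp p i x x' -> sform x x' = 1.
Proof.
have e := symp_12 sp i; have e' := sformC (p i).1 (p i).2.
by case=> [] [-> ->]; rewrite ?sformE ?e' ?e ?opprK.
Qed.

Lemma hp_diff i j x x' y y' : hp p i x x' -> hp p j y y' -> i != j ->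
  [/\ sform x y = 0, sform x y' = 0, sform x' y = 0 & sform x' y' = 0].
Proof.
move=> hx hy nij; have nji : j != i by rewrite eq_sym.
have e11 := symp_ne11 sp nij; have e12 := symp_ne12 sp nij.
have e22 := symp_ne22 sp nij.
have e21 : sform (p i).2 (p j).1 = 0 by rewrite sformC (symp_ne12 sp nji) oppr0.
by case: hx => [] [-> ->]; case: hy => [] [-> ->];
  rewrite ?sformE ?(e11, e12, e22, e21) ?oppr0.
Qed.

Lemma hp_line i q q' x x' : hp p i q q' -> hp p i x x' -> sform x q = 0 ->
  x = q \/ x = - q.
Proof.
move=> hq; have := hp_sform hq.
by case: hq => [] [-> ->] e h; case: h => [] [-> _]; rewrite ?sformE ?opprK;
  move=> e'; try (by [left|right]); exfalso; move: e e' (sformC (p i).1 (p i).2);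
  rewrite ?sformE => *; lra.
Qed.

(** Up to sign [sform u x'] is the coordinate of u along x. A vector orthogonal to q has no q'
    component, so an x that occurs in u is q up to sign. *)
Lemma hp_coef i q q' x x' u : hp p i q q' -> hp p i x x' -> sform u q = 0 ->
  sform u x' != 0 -> sform x q = 0.
Proof.
move=> hq hx uq ux'; have ex := hp_sform hx; have eq' := hp_sform hq.
move: uq ux'; move: (sformC (p i).1 (p i).2).
case: hq ex eq' => [] [-> ->]; case: hx => [] [-> ->]; rewrite ?sformE ?opprK ?oppr_eq0;
by move=> ? ? ? uq /eqP ux'; try lra; exfalso; apply: ux'; lra.
Qed.

Lemma symp_expand v :
  v = \sum_i (sform v (p i).2 *: (p i).1 - sform v (p i).1 *: (p i).2).
Proof.
apply/eqP; rewrite -subr_eq0; apply/eqP; apply: (symp_nondeg sp) => j.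
  rewrite sformDl sformNl sform_suml (bigD1 j) //= big1 => [|i nij].
    rewrite !sformE (sformC (p j).1 (p j).2) (symp_12 sp); ring.
  rewrite !sformE (symp_ne11 sp nij) [sform (p i).2 _]sformC.
  by rewrite (symp_ne12 sp) 1?eq_sym //; ring.
rewrite sformDl sformNl sform_suml (bigD1 j) //= big1 => [|i nij].
  by rewrite !sformE (symp_12 sp); ring.
by rewrite !sformE (symp_ne22 sp nij) (symp_ne12 sp nij); ring.
Qed.

(** Only the basis vectors that occur in v are checked. With [hp_coef] and [hp_line] this keeps the
    check inside the orthogonality conditions satisfied by v. *)
Lemma hp_expand0 (M : lmodType rat) (f : H g -> M) v : linear f ->
  (forall i x x', hp p i x x' -> sform v x' != 0 -> f x = 0) -> f v = 0.
Proof.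
move=> lf f0.
have f00 : f 0 = 0.
  have := lf 1 0 0; rewrite scaler0 addr0 scale1r => e.
  by apply: (addrI (f 0)); rewrite addr0; apply: esym.
have fD x y : f (x + y) = f x + f y by rewrite -[x in LHS]scale1r lf scale1r.
have fZ a x : f (a *: x) = a *: f x by rewrite -[a *: x]addr0 lf f00 addr0.
rewrite (symp_expand v) (big_morph f fD f00) big1 // => i _.
rewrite -scaleNr fD !fZ.
have -> : sform v (p i).2 *: f (p i).1 = 0.
  have [->|nz] := eqVneq (sform v (p i).2) 0; first by rewrite scale0r.
  by rewrite (f0 _ _ _ (hp0 i) nz) scaler0.
have [->|nz] := eqVneq (sform v (p i).1) 0.
  by rewrite oppr0 scale0r addr0.
by rewrite (f0 _ _ _ (hp_rot (hp0 i))) ?scaler0 ?addr0 // sformNr oppr_eq0.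
Qed.

End Basis.

Definition stdp (i : 'I_g) : H g * H g := (Ha i, Hb i).

Lemma stdp_symp : symp stdp.
Proof.
have ia (i : 'I_(g + g)) : integral (delta_mx 0 i : H g).
  by apply/mxOverP => k l; rewrite mxE rpred_nat.
split=> //=.
- by move=> i; apply: ia.
- by move=> i; apply: ia.
- by move=> i; rewrite sform_b coordAa eqxx.
- by move=> i j nij; rewrite sform_a coordBa oppr0.
- by move=> i j nij; rewrite sform_b coordAa eq_sym (negPf nij).
- by move=> i j nij; rewrite sform_b coordAb.
move=> v va vb; apply/rowP => k; rewrite mxE.
case: (split_ordP k) => j ->.
  by have := vb j; rewrite sform_b.
by have := va j; rewrite sform_a => /eqP; rewrite oppr_eq0 => /eqP.
Qed.

End Form.

(* Evaluates sform on linear combinations of vectors whose mutual products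
   are hypotheses. *)
Ltac sfc := rewrite ?sformE;
  repeat match goal with
  | E : sform ?x ?y = _ |- context [sform ?x ?y] => rewrite E
  | E : sform ?x ?y = _ |- context [sform ?y ?x] => rewrite (sformC x y) E
  end; try ring.

Ltac intg := repeat lazymatch goal with
  | |- is_true (integral (_ + _)) => apply: integralD
  | |- is_true (integral (- _)) => apply: integralN
  | |- is_true (integral (_ *: _)) => apply: integralZ
  | |- is_true (integral _) => assumption
  | |- is_true (sform _ _ \is a _) => apply: sform_int
  | |- is_true (in_mem (- _) _) => rewrite rpredN
  | |- is_true (in_mem (_ + _) _) => apply: rpredD
  | |- is_true (in_mem _ _) => assumption
  end.

(** * Elementary moves of symplectic bases as transvections *)

Section Moves.
Variable g : nat.
Implicit Types (x y z w u v : H g) (p : 'I_g -> H g * H g).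

Definition um x y := [/\ integral x, integral y & sform x y = 1].

(** [eich x v] is the Eichler transvection, an isometry when x and v are orthogonal; [trv x] is the
    symplectic transvection along x. *)
Definition eich x v u : H g := u + sform u x *: v + sform u v *: x.
Definition trv x u : H g := u + sform u x *: x.
Definition mv (f : H g -> H g) p k : H g * H g := (f (p k).1, f (p k).2).

Lemma mv_symp (f f' : H g -> H g) p : cancel f' f ->
  (forall u v, sform (f u) (f v) = sform u v) -> f 0 = 0 ->
  (forall u, integral u -> integral (f u)) -> symp p -> symp (mv f p).
Proof.
move=> fK ff f0 fi sp; split=> /= [i|i|i|i j|i j|i j|v]; rewrite ?ff.
- exact/fi/(symp_int1 sp).
- exact/fi/(symp_int2 sp).
- exact: symp_12.
- exact: symp_ne11.
- exact: symp_ne12.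
- exact: symp_ne22.
rewrite -[v]fK => h1 h2; rewrite (symp_nondeg sp (v := f' v)) // => i.
  by have := h1 i; rewrite ff.
by have := h2 i; rewrite ff.
Qed.

Lemma mv_hp (f : H g -> H g) p i x x' : {morph f : u / - u} ->
  hp p i x x' -> hp (mv f p) i (f x) (f x').
Proof.
move=> fN; case=> [] [-> ->]; rewrite ?fN /=.
- by constructor 1.
- by constructor 2.
- by constructor 3.
- by constructor 4.
Qed.

Lemma eichN x v : {morph eich x v : u / - u}.
Proof. by move=> u; rewrite /eich !sformE !scaleNr !opprD. Qed.

Lemma trvN x : {morph trv x : u / - u}.
Proof. by move=> u; rewrite /trv !sformE !scaleNr !opprD. Qed.

Lemma eich_form x v u w : sform x v = 0 ->
  sform (eich x v u) (eich x v w) = sform u w.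
Proof.
move=> xv; rewrite /eich !sformE (sformC w x) (sformC w v) (sformC x v) xv.
rewrite (sformC x w) (sformC v w); ring.
Qed.

Lemma trv_form x u w : sform (trv x u) (trv x w) = sform u w.
Proof. by rewrite /trv !sformE (sformC w x) (sformC x w); ring. Qed.

Lemma eichK x v : sform x v = 0 -> cancel (eich x (- v)) (eich x v).
Proof.
move=> xv u; have vx : sform v x = 0 by rewrite sformC xv oppr0.
rewrite /eich !sformE xv vx !(mulr0, oppr0, addr0) !scaleNr !scalerN.
by rewrite [X in X + _]addrAC !subrK.
Qed.

Lemma trvK x : cancel (fun u => u - sform u x *: x) (trv x).
Proof.
by move=> u; rewrite /trv !sformE mulr0 oppr0 addr0 subrK.
Qed.

Lemma eich_int x v u : integral x -> integral v -> integral u ->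
  integral (eich x v u).
Proof. by move=> *; rewrite /eich; intg. Qed.

Lemma trv_int x u : integral x -> integral u -> integral (trv x u).
Proof. by move=> *; rewrite /trv; intg. Qed.

Lemma eich_symp p x v : integral x -> integral v -> sform x v = 0 ->
  symp p -> symp (mv (eich x v) p).
Proof.
move=> ix iv xv; apply: (mv_symp (f' := eich x (- v))).
- exact: eichK.
- by move=> *; apply: eich_form.
- by rewrite /eich !sform0l !scale0r !addr0.
- by move=> u; apply: eich_int.
Qed.

Lemma trv_symp p x : integral x -> symp p -> symp (mv (trv x) p).
Proof.
move=> ix; apply: (mv_symp (f' := fun u => u - sform u x *: x)).
- exact: trvK.
- exact: trv_form.
- by rewrite /trv !sform0l !scale0r !addr0.
- by move=> u; apply: trv_int.
Qed.

Lemma eich_id x v u : sform u x = 0 -> sform u v = 0 -> eich x v u = u.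
Proof. by rewrite /eich => -> ->; rewrite !scale0r !addr0. Qed.

Lemma trv_id x u : sform u x = 0 -> trv x u = u.
Proof. by rewrite /trv => ->; rewrite !scale0r !addr0. Qed.

(* The elementary moves: [move1] is x |-> x + x' and [move2] is x |-> x + y,
   y' |-> y' - x'. *)
Definition move1 p x' := mv (trv x') p.
Definition move2 p x' y := mv (eich x' y) p.

Lemma move1_symp p i x x' : symp p -> hp p i x x' -> symp (move1 p x').
Proof. by move=> sp h; apply: trv_symp => //; case: (hp_int sp h). Qed.

Lemma move1_hp p i x x' : symp p -> hp p i x x' ->
  hp (move1 p x') i (x + x') x'.
Proof.
move=> sp h; have := mv_hp (trvN x') h.
by rewrite /trv sformxx (hp_sform sp h) scale1r scale0r addr0.
Qed.

Lemma move1_other p i x x' k : symp p -> hp p i x x' -> k != i ->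
  move1 p x' k = p k.
Proof.
move=> sp h nk; have [_ e1 _ e2] := hp_diff sp (hp0 p k) h nk.
by rewrite /move1 /mv !trv_id //; case: (p k).
Qed.

Lemma hp_eq p p' i x x' : p i = p' i -> hp p i x x' -> hp p' i x x'.
Proof. by rewrite /hp => ->. Qed.

Lemma move2_symp p i j x x' y y' : symp p -> hp p i x x' -> hp p j y y' ->
  i != j -> symp (move2 p x' y).
Proof.
move=> sp h h' nij; have [_ ix] := hp_int sp h; have [iy _] := hp_int sp h'.
by have [_ _ e _] := hp_diff sp h h' nij; apply: eich_symp.
Qed.

Lemma move2_hp1 p i j x x' y y' : symp p -> hp p i x x' -> hp p j y y' ->
  i != j -> hp (move2 p x' y) i (x + y) x'.
Proof.
move=> sp h h' nij; have := mv_hp (eichN x' y) h.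
have [e1 e2 e3 e4] := hp_diff sp h h' nij.
by rewrite /eich sformxx (hp_sform sp h) e1 e3 scale1r !scale0r !addr0.
Qed.

Lemma move2_hp2 p i j x x' y y' : symp p -> hp p i x x' -> hp p j y y' ->
  i != j -> hp (move2 p x' y) j y (y' - x').
Proof.
move=> sp h h' nij; have := mv_hp (eichN x' y) h'.
have [e1 e2 e3 e4] := hp_diff sp h h' nij.
rewrite /eich sformxx (sformC y y') (hp_sform sp h') (sformC x' y) e3.
by rewrite (sformC x' y') e4 !oppr0 scaleN1r !scale0r !addr0.
Qed.

Lemma move2_other p i j x x' y y' k : symp p -> hp p i x x' -> hp p j y y' ->
  k != i -> k != j -> move2 p x' y k = p k.
Proof.
move=> sp h h' ni nj; have [_ e1 _ e2] := hp_diff sp (hp0 p k) h ni.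
have [e3 _ e4 _] := hp_diff sp (hp0 p k) h' nj.
by rewrite /move2 /mv !eich_id //; case: (p k).
Qed.

End Moves.

(** * Euclid's algorithm on symplectic bases *)

Definition nrm (q : rat) : nat := `|numq q|%N.

Lemma nrmE (m : int) : nrm m%:~R = `|m|%N.
Proof. by rewrite /nrm numq_int. Qed.

Lemma nrmN q : nrm (- q) = nrm q.
Proof. by rewrite /nrm numqN abszN. Qed.

Lemma nrm0 q : (nrm q == 0%N) = (q == 0).
Proof. by rewrite /nrm absz_eq0 numq_eq0. Qed.

Section Euclid.
Variable g : nat.
Implicit Types (x y z w u v : H g) (p : 'I_g -> H g * H g).
Variables (J : pred 'I_g) (P : ('I_g -> H g * H g) -> Prop).
Hypothesis Pmove1 : forall p i x x', symp p -> P p -> J i -> hp p i x x' ->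
  P (move1 p x').
Hypothesis Pmove2 : forall p i j x x' y y', symp p -> P p -> J i -> J j ->
  i != j -> hp p i x x' -> hp p j y y' -> P (move2 p x' y).
Variables (a b : H g).
Hypothesis uab : um a b.

Let n2 p k : nat := (nrm (sform a (p k).1) + nrm (sform a (p k).2))%N.
Let mu p : nat := (\sum_k n2 p k)%N.

Let n2_hp p k x x' : hp p k x x' -> n2 p k = (nrm (sform a x) + nrm (sform a x'))%N.
Proof. by case=> [] [-> ->]; rewrite /n2 ?sformE ?nrmN // addnC. Qed.

Let mu1 p p' i : (forall k, k != i -> p' k = p k) -> (n2 p' i < n2 p i)%N ->
  (mu p' < mu p)%N.
Proof.
move=> e lt; rewrite /mu (bigD1 i) //= [in leqRHS](bigD1 i) //=.
rewrite -addSn leq_add //.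
by apply: leq_sum => k nk; rewrite /n2 e.
Qed.

Let mu2 p p' i j : i != j -> (forall k, k != i -> k != j -> p' k = p k) ->
  (n2 p' i + n2 p' j < n2 p i + n2 p j)%N -> (mu p' < mu p)%N.
Proof.
move=> nij e lt; rewrite /mu (bigD1 i) //= (bigD1 j) 1?eq_sym //=.
rewrite [in leqRHS](bigD1 i) //= [in leqRHS](bigD1 j) 1?eq_sym //=.
rewrite (addnA (n2 p' i)) (addnA (n2 p i)).
rewrite -addSn leq_add //.
by apply: leq_sum => k /andP[nk nk']; rewrite /n2 e.
Qed.

(** The inverse shear is a product of forward ones: quarter turns do not change the basis as far as
    [hp] is concerned, and modulo them x |-> x - x' takes two applications of [move1]. *)
Let inv1 p i x x' : symp p -> P p -> J i -> hp p i x x' -> exists p',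
  [/\ symp p', P p', hp p' i (x - x') x' & forall k, k != i -> p' k = p k].
Proof.
move=> sp Pp Ji h; have h1 := hp_rotV h.
have s1 := move1_symp sp h1; have k1 := move1_hp sp h1.
have k2 : hp (move1 p x) i x (- (- x' + x)) by apply: hp_rot.
exists (move1 (move1 p x) (- (- x' + x))); split.
- exact: move1_symp k2.
- by apply: Pmove1 (k2) => //; apply: Pmove1 (h1).
- have := move1_hp s1 k2; rewrite opprD opprK addrCA subrr addr0 => h2.
  by have := hp_rotV h2; rewrite opprB.
- move=> k nk; rewrite (move1_other s1 k2) //; exact: move1_other sp h1 nk.
Qed.

(** After a quarter turn the component of a in the plane is C x + D x' with C = [sform a x'] and D =
    [- sform a x] both positive. *)
Let orient p i : sform a (p i).1 != 0 -> sform a (p i).2 != 0 ->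
  exists x x', [/\ hp p i x x', 0 < sform a x' & 0 < - sform a x].
Proof.
set A := sform a (p i).1; set B := sform a (p i).2 => A0 B0.
have h := hp0 p i; have h1 := hp_rot h; have h2 := hp_rot h1; have h3 := hp_rot h2.
have [lA|lA] : 0 < A \/ A < 0 by apply/orP; rewrite orbC -neq_lt.
  have [lB|lB] : 0 < B \/ B < 0 by apply/orP; rewrite orbC -neq_lt.
    exists (- (p i).2), (p i).1; split=> //; first by rewrite -[X in hp _ _ _ X]opprK.
    by rewrite sformE opprK.
  exists (- (p i).1), (- (p i).2); split=> //; rewrite !sformE ?opprK //.
  by rewrite oppr_gt0.
have [lB|lB] : 0 < B \/ B < 0 by apply/orP; rewrite orbC -neq_lt.
  by exists (p i).1, (p i).2; split=> //; rewrite oppr_gt0.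
by exists (p i).2, (- (p i).1); split=> //; rewrite ?sformE oppr_gt0.
Qed.

Let orient0 p i : (sform a (p i).1 == 0) || (sform a (p i).2 == 0) ->
  exists x x', [/\ hp p i x x', 0 <= sform a x' & sform a x = 0].
Proof.
have h := hp0 p i; have h1 := hp_rot h; have h2 := hp_rot h1; have h3 := hp_rot h2.
case/orP=> /eqP e0.
  have [l|l] := lerP 0 (sform a (p i).2); first by exists (p i).1, (p i).2.
  exists (- (p i).1), (- (p i).2); split=> //; rewrite sformE ?e0 ?oppr0 //.
  by rewrite oppr_ge0 ltW.
have [l|l] := lerP 0 (sform a (p i).1).
  by exists (- (p i).2), (p i).1; split; rewrite ?sformE ?e0 ?oppr0 // -[X in hp _ _ _ X]opprK.
by exists (p i).2, (- (p i).1); split; rewrite // sformE oppr_ge0 ltW.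
Qed.

(** The measure is the sum of the absolute values of the coordinates of a. [move1] and its inverse
    empty one coordinate of each plane, [move2] then empties whole planes, until a is a multiple of
    one basis vector. P is carried along, and J lists the planes that may be touched. *)
Lemma euclid p : symp p -> P p ->
  (forall k, ~~ J k -> sform a (p k).1 = 0 /\ sform a (p k).2 = 0) ->
  exists p' i a', [/\ symp p', P p', J i, hp p' i a a' &
    forall k, ~~ J k -> p' k = p k].
Proof.
move: {2}(mu p).+1 (ltnSn (mu p)) => n; elim: n p => // n IH p lt sp Pp pJ.
have [ia ib eab] := uab.
have step p' : symp p' -> P p' -> (forall k, ~~ J k -> p' k = p k) ->
    (mu p' < mu p)%N -> exists p' i a', [/\ symp p', P p', J i, hp p' i a a' &
    forall k, ~~ J k -> p' k = p k].
  move=> sp' Pp' e lt'; have [|k Jk|q [i [a' [sq Pq Ji hq eq]]]] := IH p' _ sp' Pp'.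
  - exact: leq_trans lt' _.
  - by rewrite e //; apply: pJ.
  by exists q, i, a'; split=> // k Jk; rewrite eq // e.
have aint x : integral x -> exists m : int, sform a x = m%:~R.
  by move=> ix; apply/intrP; apply: sform_int.
have [/existsP[i /and3P[Ji A0 B0]]|] :=
    boolP [exists i, [&& J i, sform a (p i).1 != 0 & sform a (p i).2 != 0]].
  have [x [x' [h lC lD]]] := orient A0 B0.
  have [ix ix'] := hp_int sp h.
  have [m em] := aint _ ix; have [m' em'] := aint _ ix'.
  have neJ k : ~~ J k -> k != i by apply: contraNneq => ->.
  move: lC lD; rewrite em em' -mulrNz !ltr0z => lC lD.
  (* With a = C x + D x' in this plane, the move replaces (C, D) by (C, D - C); in the other case
     the inverse move, applied after a quarter turn, yields D and C - D. *)
  have [le|gt] := lerP m' (- m).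
    apply: (step (move1 p x')).
    - exact: move1_symp h.
    - exact: Pmove1 h.
    - by move=> k /neJ; apply: move1_other h.
    apply: (mu1 (i := i)) => [k nk|]; first by rewrite (move1_other sp h nk).
    rewrite (n2_hp (move1_hp sp h)) (n2_hp h) sformDr em em' -intrD !nrmE; lia.
  have [p' [sp' Pp' h' e']] := inv1 sp Pp Ji (hp_rot h).
  apply: (step p') => //; first by move=> k /neJ; apply: e'.
  apply: (mu1 (i := i)) => [k nk|]; first by rewrite e'.
  rewrite (n2_hp h') (n2_hp h) opprK sformDr sformNr nrmN em em' -intrD !nrmE; lia.
rewrite negb_exists => /forallP noboth.
have or0 i : exists x x', [/\ hp p i x x', 0 <= sform a x' & sform a x = 0].
  apply: orient0; have [Ji|nJ] := boolP (J i); last by case: (pJ i nJ) => -> _; rewrite eqxx.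
  by have := noboth i; rewrite Ji /= negb_and !negbK.
have red i j x x' y y' : J i -> J j -> i != j -> hp p i x x' -> hp p j y y' ->
    sform a x = 0 -> sform a y = 0 -> 0 < sform a x' -> sform a x' <= sform a y' ->
    exists p' i a', [/\ symp p', P p', J i, hp p' i a a' &
    forall k, ~~ J k -> p' k = p k].
  move=> Ji Jj nij hx hy e1 e2 l1 l2.
  have [ix ix'] := hp_int sp hx; have [iy iy'] := hp_int sp hy.
  have [m em] := aint _ ix'; have [m' em'] := aint _ iy'.
  apply: (step (move2 p x' y)).
  - exact: move2_symp hx hy nij.
  - exact: Pmove2 hx hy.
  - move=> k Jk; apply: move2_other hx hy _ _ => //; by apply: contraNneq Jk => ->.
  apply: (mu2 nij) => [k ki kj|]; first exact: move2_other hx hy ki kj.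
  rewrite (n2_hp (move2_hp1 sp hx hy nij)) (n2_hp (move2_hp2 sp hx hy nij)).
  rewrite (n2_hp hx) (n2_hp hy) !sformE e1 e2 em em'.
  move: l1 l2; rewrite em em' -mulrNz -!intrD addr0 (nrmE 0) !nrmE ltr0z ler_int; lia.
have [/existsP[i /existsP[j /and5P[Ji Jj nij ni nj]]]|] := boolP [exists i, exists j,
    [&& J i, J j, i != j, n2 p i != 0%N & n2 p j != 0%N]].
  have [x [x' [hx lx ex]]] := or0 i; have [y [y' [hy ly ey]]] := or0 j.
  move: ni nj; rewrite (n2_hp hx) (n2_hp hy) ex ey !addn_eq0 !nrm0 eqxx /= => nx ny.
  have [le|gt] := lerP (sform a x') (sform a y').
    by apply: (red i j x x' y y'); rewrite // lt_def nx.
  by apply: (red j i y y' x x') (ltW gt) => //; rewrite 1?eq_sym // lt_def ny.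
rewrite negb_exists => /forallP one.
have [i ni] : exists i, n2 p i != 0%N.
  apply/existsP; apply: contraT; rewrite negb_exists => /forallP all0.
  have a0 : a = 0.
    apply: (symp_nondeg sp) => i; have := all0 i; rewrite negbK addn_eq0 !nrm0;
    by case/andP=> /eqP ? /eqP ?.
  by move: eab; rewrite a0 sform0l.
have z2 k : k != i -> sform a (p k).1 = 0 /\ sform a (p k).2 = 0.
  move=> nk; have [Jk|] := boolP (J k); last exact: pJ.
  have Ji : J i.
    apply: contraT => /pJ [e1 e2]; move: ni.
    by rewrite addn_eq0 !nrm0 e1 e2 eqxx.
  have := one i; rewrite negb_exists => /forallP/(_ k).
  rewrite Ji Jk eq_sym nk ni /= negbK addn_eq0 !nrm0.
  by case/andP=> /eqP ? /eqP ?.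
have Ji : J i.
  by apply: contraT => /pJ [e1 e2]; move: ni; rewrite addn_eq0 !nrm0 e1 e2 eqxx.
have [x [x' [hx lx ex]]] := or0 i.
have [ix ix'] := hp_int sp hx.
have ea : a = sform a x' *: x.
  have [h1 h2] : sform a (p i).1 = sform a x' * sform x (p i).1 /\
      sform a (p i).2 = sform a x' * sform x (p i).2.
    have := hp_sform sp hx; have e := symp_12 sp i; have e' := sformC (p i).1 (p i).2.
    case: hx ex => [] [-> ->]; rewrite !sformE ?e' ?e => ex _; split=> //; lra.
  apply/eqP; rewrite -subr_eq0; apply/eqP; apply: (symp_nondeg sp) => k;
    rewrite sformDl sformNl sformZl; have [->|nk] := eqVneq k i.
  - by rewrite h1 subrr.
  - have [e1 _] := z2 k nk; rewrite eq_sym in nk.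
    by have [e2 _ _ _] := hp_diff sp hx (hp0 p k) nk; rewrite e1 e2 mulr0 subrr.
  - by rewrite h2 subrr.
  - have [_ e1] := z2 k nk; rewrite eq_sym in nk.
    by have [_ e2 _ _] := hp_diff sp hx (hp0 p k) nk; rewrite e1 e2 mulr0 subrr.
have [m em] := aint _ ix'.
have /intrP[m' em'] := sform_int ix ib.
(* The factor divides [sform a b], which is 1, and its sign was fixed by [orient0]. *)
have m1 : sform a x' = 1.
  have e : m * m' = 1.
    by apply: (@intr_inj rat); rewrite intrM -em -em' -sformZl -ea.
  move/(congr1 absz)/eqP: e; rewrite abszM muln_eq1 => /andP[/eqP e _].
  by move: lx; rewrite em ler0z => l; have -> : m = 1 by lia.
by exists p, i, x'; split=> //; rewrite ea m1 scale1r.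
Qed.

End Euclid.

(** Every use of the bound on g goes through this lemma. The given planes may coincide, so it also
    supplies third planes. *)
Lemma fourth_ord (g : nat) (hg : (4 <= g)%N) (i j k : 'I_g) :
  exists l, [/\ l != i, l != j & l != k].
Proof.
have : (0 < #|~: [set i; j; k]|)%N.
  have := cardsC [set i; j; k]; rewrite card_ord.
  have := cards2 i j; have := cardsU1 k [set i; j].
  by rewrite (setUC [set k]) => -> ->; case: (i != j); case: (k \notin _) => /=; lia.
case/card_gt0P => l; rewrite !inE !negb_or -andbA => /and3P[] *.
by exists l.
Qed.

(** * Extending symplectic pairs to bases *)

Section Extend.
Variable g : nat.
Implicit Types (x y z w u v : H g) (p : 'I_g -> H g * H g).

Let trvc (c : rat) x u : H g := u + (c * sform u x) *: x.

Let trvc_symp p c x : c \is a Num.int -> integral x -> symp p ->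
  symp (mv (trvc c x) p).
Proof.
move=> ic ix; apply: (mv_symp (f' := trvc (- c) x)).
- by move=> u; rewrite /trvc !sformE !mulr0 addr0 mulNr scaleNr subrK.
- by move=> u v; rewrite /trvc !sformE (sformC v x) (sformC x v); ring.
- by rewrite /trvc sform0l mulr0 scale0r addr0.
- by move=> u iu; rewrite /trvc; intg; rewrite rpredM // sform_int.
Qed.

(** Euclid's algorithm with a trivial property puts w into a basis with some partner w'. The Eichler
    transvection along w and w' - ws fixes w and sends w' to ws up to a multiple of w, which [trvc]
    removes. Planes outside J are orthogonal to w and ws, hence fixed. *)
Lemma symp_extend (J : pred 'I_g) p w ws : symp p -> um w ws ->
  (forall k, ~~ J k -> sform w (p k).1 = 0 /\ sform w (p k).2 = 0) ->
  (forall k, ~~ J k -> sform ws (p k).1 = 0 /\ sform ws (p k).2 = 0) ->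
  exists p' j, [/\ symp p', J j, hp p' j w ws & forall k, ~~ J k -> p' k = p k].
Proof.
move=> sp uw w0 ws0; have [iw iws ews] := uw.
have [q [j [w' [sq _ Jj hq eq]]]] := @euclid g J (fun _ => True)
  (fun _ _ _ _ _ _ _ _ => I) (fun _ _ _ _ _ _ _ _ _ _ _ _ _ _ => I)
  w ws uw p sp I w0.
have [_ iw'] := hp_int sq hq; have ew' := hp_sform sq hq.
pose v := w' - ws; pose c := sform w' ws.
have iv : integral v by rewrite /v; intg.
have wv : sform w v = 0 by rewrite /v !sformE ew' ews; ring.
have s1 := eich_symp iw iv wv sq.
have h1 := mv_hp (eichN w v) hq.
have e1 : eich w v w = w by rewrite eich_id ?sformxx.
have e2 : eich w v w' = ws - c *: w.
  rewrite /eich (sformC w w') ew' {2}/v !sformE sub0r -/c scaleN1r /v opprB.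
  by rewrite addrCA subrr addr0 scaleNr.
rewrite e1 e2 in h1.
have ic : - c \is a Num.int by rewrite rpredN sform_int.
have s2 := trvc_symp ic iw s1.
have trN : {morph trvc (- c) w : u / - u}.
  by move=> u; rewrite /trvc !sformE mulrN scaleNr opprD.
have h2 := mv_hp trN h1.
have e3 : trvc (- c) w w = w by rewrite /trvc sformxx mulr0 scale0r addr0.
have e4 : trvc (- c) w (ws - c *: w) = ws.
  rewrite /trvc !sformE (sformC w ws) ews mulr0 subr0 mulrNN mulr1.
  by rewrite subrK.
rewrite e3 e4 in h2.
exists (mv (trvc (- c) w) (mv (eich w v) q)), j; split=> // k Jk.
have [a1 a2] := w0 k Jk; have [b1 b2] := ws0 k Jk; rewrite -(eq k Jk) in a1 a2 b1 b2.
have njk : j != k by apply: contraNneq Jk => <-.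
have [_ _ c1 c2] := hp_diff sq hq (hp0 q k) njk.
rewrite -(eq k Jk) /mv /=.
have -> : eich w v (q k).1 = (q k).1.
  by rewrite eich_id // sformC ?a1 ?oppr0 // /v sformDl sformNl c1 b1 subrr oppr0.
have -> : eich w v (q k).2 = (q k).2.
  by rewrite eich_id // sformC ?a2 ?oppr0 // /v sformDl sformNl c2 b2 subrr oppr0.
by rewrite /trvc [sform (q k).1 w]sformC [sform (q k).2 w]sformC a1 a2 oppr0 !mulr0
  !scale0r !addr0; case: (q k).
Qed.

Lemma um_basis a b : um a b -> exists p (i : 'I_g), symp p /\ hp p i a b.
Proof.
move=> uab; have [//|//|p [j [sp _ h _]]] := symp_extend (J := predT) (stdp_symp g) uab.
by exists p, j.
Qed.

Lemma um_basis2 z zs w ws : um z zs -> um w ws ->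
  sform w z = 0 -> sform w zs = 0 -> sform ws z = 0 -> sform ws zs = 0 ->
  exists p (i j : 'I_g), [/\ symp p, i != j, hp p i z zs & hp p j w ws].
Proof.
move=> uz uw e1 e2 e3 e4; have [q [i [sq hq]]] := um_basis uz.
have z0 u : sform u z = 0 -> sform u zs = 0 -> forall k, ~~ (k != i) ->
    sform u (q k).1 = 0 /\ sform u (q k).2 = 0.
  move=> u1 u2 k; rewrite negbK => /eqP ->.
  by case: hq u1 u2 => [] [-> ->]; rewrite ?sformE => u1 u2; split=> //; lra.
have [||p [j [sp nij h eq]]] := symp_extend (J := fun k => k != i) sq uw.
- exact: z0.
- exact: z0.
exists p, i, j; rewrite eq_sym; split=> //; apply: (hp_eq _ hq).
by rewrite eq // negbK.
Qed.

End Extend.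

(** * Calculus of alternating maps *)

Section Alt.
Variables (g : nat) (M : lmodType rat) (L : H g -> H g -> M).
Hypothesis hL : alt_bilinear L.
Implicit Types x y z : H g.

Lemma altxx x : L x x = 0. Proof. by case: hL. Qed.

Lemma alt_linl y : linear (L^~ y). Proof. by move=> a x x'; case: hL => _ ->. Qed.
Lemma alt_linr x : linear (L x). Proof. by move=> a y y'; case: hL => _ _ ->. Qed.

Lemma altDl x y z : L (x + y) z = L x z + L y z.
Proof. by case: hL => _ e _; rewrite -[x in LHS]scale1r e scale1r. Qed.
Lemma altDr x y z : L z (x + y) = L z x + L z y.
Proof. by case: hL => _ _ e; rewrite -[x in LHS]scale1r e scale1r. Qed.
Lemma alt0l x : L 0 x = 0.
Proof. by apply: (addrI (L 0 x)); rewrite -altDl !addr0. Qed.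
Lemma alt0r x : L x 0 = 0.
Proof. by apply: (addrI (L x 0)); rewrite -altDr !addr0. Qed.
Lemma altZl a x y : L (a *: x) y = a *: L x y.
Proof. by case: hL => _ e _; rewrite -[a *: x]addr0 e alt0l addr0. Qed.
Lemma altZr a x y : L x (a *: y) = a *: L x y.
Proof. by case: hL => _ _ e; rewrite -[a *: y]addr0 e alt0r addr0. Qed.
Lemma altNl x y : L (- x) y = - L x y.
Proof. by rewrite -[- x]scaleN1r altZl scaleN1r. Qed.
Lemma altNr x y : L x (- y) = - L x y.
Proof. by rewrite -[- y]scaleN1r altZr scaleN1r. Qed.
Lemma altBl x y z : L (x - y) z = L x z - L y z.
Proof. by rewrite altDl altNl. Qed.
Lemma altBr x y z : L z (x - y) = L z x - L z y.
Proof. by rewrite altDr altNr. Qed.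
Lemma altC x y : L x y = - L y x.
Proof.
apply/eqP; rewrite -addr_eq0; apply/eqP; have := altxx (x + y).
by rewrite altDl !altDr !altxx add0r addr0.
Qed.
Definition altE := (altDl, altDr, altNl, altNr, altZl, altZr, altxx, alt0l, alt0r).
End Alt.

Section AltOps.
Variables (g : nat) (M : lmodType rat).
Implicit Types L : H g -> H g -> M.

Lemma alt_sub L L' : alt_bilinear L -> alt_bilinear L' ->
  alt_bilinear (fun x y => L x y - L' x y).
Proof.
move=> h h'; split=> [x|a x x' y|a x y y']; first by rewrite !altxx ?subrr.
  rewrite !(altDl h, altDl h', altZl h, altZl h') scalerBr opprD addrACA //.
by rewrite !(altDr h, altDr h', altZr h, altZr h') scalerBr opprD addrACA.
Qed.

Lemma alt_add L L' : alt_bilinear L -> alt_bilinear L' ->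
  alt_bilinear (fun x y => L x y + L' x y).
Proof.
move=> h h'; split=> [x|a x x' y|a x y y']; first by rewrite !altxx ?addr0.
  by rewrite !(altDl h, altDl h', altZl h, altZl h') scalerDr addrACA.
by rewrite !(altDr h, altDr h', altZr h, altZr h') scalerDr addrACA.
Qed.

Lemma alt_opp L : alt_bilinear L -> alt_bilinear (fun x y => - L x y).
Proof.
move=> h; split=> [x|a x x' y|a x y y']; first by rewrite altxx ?oppr0.
  by rewrite (altDl h) (altZl h) opprD scalerN.
by rewrite (altDr h) (altZr h) opprD scalerN.
Qed.

Lemma alt_comp L (f : H g -> H g) : alt_bilinear L -> linear f ->
  alt_bilinear (fun x y => L (f x) (f y)).
Proof.
move=> h lf; split=> [x|a x x' y|a x y y']; first by rewrite altxx.
  by rewrite lf (altDl h) (altZl h).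
by rewrite lf (altDr h) (altZr h).
Qed.

Lemma alt_cross (f : H g -> rat) (h : H g -> M) :
  (forall a x y, f (a *: x + y) = a * f x + f y) -> linear h ->
  alt_bilinear (fun x y => f x *: h y - f y *: h x).
Proof.
move=> lf lh; split=> [x|a x x' y|a x y y']; first by rewrite subrr.
  rewrite lf lh scalerDl !scalerDr scalerN !scalerA (mulrC _ a) -!scalerA.
  by rewrite opprD addrACA !scalerA.
rewrite lf lh scalerDl !scalerDr scalerN !scalerA (mulrC _ a) -!scalerA.
by rewrite opprD addrACA !scalerA.
Qed.
End AltOps.

(** * Forms on orthogonal pairs *)

Section PForm.
Variables (g : nat) (hg : (4 <= g)%N) (M : lmodType rat).
Implicit Types (x y z w u v a b c d : H g) (p : 'I_g -> H g * H g).
Implicit Types (L : H g -> H g -> M).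

Definition perp a b z w :=
  [/\ sform a z = 0, sform a w = 0, sform b z = 0 & sform b w = 0].

Lemma perpC a b z w : perp a b z w -> perp z w a b.
Proof.
case=> e1 e2 e3 e4; rewrite /perp (sformC a z) (sformC b z) (sformC a w) (sformC b w).
by rewrite e1 e2 e3 e4 oppr0.
Qed.

(* z, w span a saturated isotropic plane; zs and ws need not be orthogonal. *)
Definition iso z w zs ws := [/\ um z zs, um w ws, sform z w = 0,
  sform z ws = 0 & sform w zs = 0].

Lemma iso_basis z w zs ws : iso z w zs ws ->
  exists p (i j : 'I_g) zs' ws', [/\ symp p, i != j, hp p i z zs' & hp p j w ws'].
Proof.
case=> uz uw e1 e2 e3; have [iz izs ez] := uz; have [iw iws ew] := uw.
pose ws' := ws + sform zs ws *: z.
have uw' : um w ws'.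
  by split=> //; [rewrite /ws'; intg | rewrite /ws'; sfc].
have [p [i [j [sp nij h1 h2]]]] : exists p (i j : 'I_g),
    [/\ symp p, i != j, hp p i z zs & hp p j w ws'].
  apply: um_basis2 => //.
  - by rewrite sformC e1 oppr0.
  - by rewrite /ws'; sfc.
  - by rewrite /ws' !sformE ez (sformC zs ws); ring.
by exists p, i, j, zs, ws'.
Qed.

Lemma isoC z w zs ws : iso z w zs ws -> iso w z ws zs.
Proof. by case=> uz uw e1 e2 e3; split=> //; rewrite sformC e1 oppr0. Qed.

Lemma um_rot x y : um x y -> um y (- x).
Proof.
case=> ix iy e; split=> //; first exact: integralN.
by rewrite sformNr sformC e opprK.
Qed.

Section Span0.
Variables (L : H g -> H g -> M) (z w : H g).
Hypothesis hL : alt_bilinear L.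
Hypothesis L0 : forall a b, um a b -> perp a b z w -> L a b = 0.

Let basis2 p : symp p ->
  (forall i j x x' y y', hp p i x x' -> hp p j y y' -> sform x z = 0 ->
    sform x w = 0 -> sform y z = 0 -> sform y w = 0 -> L x y = 0) ->
  (forall i x x' u, hp p i x x' -> sform u z = 0 -> sform u w = 0 ->
     sform u x' != 0 -> sform x z = 0 /\ sform x w = 0) ->
  forall u v, perp u v z w -> L u v = 0.
Proof.
move=> sp Lb coef u v [uz uw vz vw].
apply: (@hp_expand0 _ _ sp _ (L^~ v) u (alt_linl hL _)) => i x x' hx nx.
have [xz xw] := coef _ _ _ _ hx uz uw nx.
apply: (@hp_expand0 _ _ sp _ (L x) v (alt_linr hL _)) => j y y' hy ny.
have [yz yw] := coef _ _ _ _ hy vz vw ny.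
exact: Lb hx hy xz xw yz yw.
Qed.

Let plane p i x x' y y' : symp p -> hp p i x x' -> hp p i y y' ->
  (forall a b, hp p i a b -> L a b = 0) -> L x y = 0.
Proof.
move=> sp h1 h2 Lp; have e := Lp _ _ (hp0 p i); have e' := altC hL (p i).1 (p i).2.
have e2 : L (p i).2 (p i).1 = 0 by rewrite (altC hL) e oppr0.
by case: h1 => [] [-> _]; case: h2 => [] [-> _];
  rewrite ?(altNl hL) ?(altNr hL) ?e ?e2 ?(altxx hL) ?oppr0.
Qed.

(** The vectors x and x' + y form again a symplectic pair orthogonal to z and w. *)
Let cross x x' y : um x x' -> integral y -> sform x y = 0 ->
  perp x x' z w -> sform y z = 0 -> sform y w = 0 -> L x y = 0.
Proof.
move=> ux iy xy [e1 e2 e3 e4] yz yw; have [ix ix' e] := ux.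
have : L x (x' + y) = 0.
  by apply: L0; [split=> //; [intg | sfc] | split; sfc].
by rewrite (altDr hL) L0 ?add0r.
Qed.

Lemma span0_um : um z w -> forall u v, perp u v z w -> L u v = 0.
Proof.
move=> /um_basis [p [k [sp hk]]]; have ezw := hp_sform sp hk.
have off i x x' : hp p i x x' -> i != k ->
    [/\ sform x z = 0, sform x w = 0, sform x' z = 0 & sform x' w = 0].
  by move=> h nik; have [] := hp_diff sp h hk nik.
have in_k x x' u : hp p k x x' -> sform u z = 0 -> sform u w = 0 -> sform u x' = 0.
  by case: hk => [] [-> ->] h; case: h => [] [_ ->]; rewrite ?sformE;
    move=> e e'; lra.
have umh i x x' : hp p i x x' -> um x x'.
  by move=> h; have [? ?] := hp_int sp h; split=> //; apply: hp_sform h.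
apply: (basis2 sp) => [i j x x' y y' hx hy xz xw yz yw|i x x' u hx uz uw nx]; last first.
  have [eik|nik] := eqVneq i k; last by have [] := off _ _ _ hx nik.
  by rewrite eik in hx; rewrite (in_k _ _ _ hx) ?eqxx in nx.
have nik : i != k.
  apply/eqP => eik; rewrite eik in hx; have := hp_sform sp hx.
  by rewrite (in_k _ _ _ hx) // => /eqP; rewrite eq_sym oner_eq0.
have [e1 e2 e3 e4] := off _ _ _ hx nik.
have [eij|nij] := eqVneq i j.
  rewrite -eij in hy; apply: (plane sp hx hy) => a b hab; apply: L0 (umh _ _ _ hab) _.
  by have [] := off _ _ _ hab nik.
apply: (cross (umh _ _ _ hx)) => //; first by case: (hp_int sp hy).
by have [] := hp_diff sp hx hy nij.
Qed.

Lemma span0_iso zs ws : iso z w zs ws -> forall u v, perp u v z w -> L u v = 0.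
Proof.
move=> /iso_basis [p [k [l [zs' [ws' [sp nkl hk hl]]]]]].
have [ezw ezw' ez'w ez'w'] := hp_diff sp hk hl nkl.
have ez := hp_sform sp hk; have ew := hp_sform sp hl.
have off i x x' : hp p i x x' -> i != k -> i != l -> perp x x' z w.
  move=> h nik nil; have [? _ ? _] := hp_diff sp h hk nik.
  by have [? _ ? _] := hp_diff sp h hl nil.
have umh i x x' : hp p i x x' -> um x x'.
  by move=> h; have [? ?] := hp_int sp h; split=> //; apply: hp_sform h.
have in_k := hp_line sp; have in_k0 := hp_coef sp.
apply: (basis2 sp) => [i j x x' y y' hx hy xz xw yz yw|i x x' u hx uz uw nx]; last first.
  have [eik|nik] := eqVneq i k.
    rewrite eik in hx; split; first exact: in_k0 hk hx uz nx.
    by have [-> _ _ _] := hp_diff sp hx hl nkl.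
  have [eil|nil] := eqVneq i l; last by have [] := off _ _ _ hx nik nil.
  rewrite eil in hx nik; split; last exact: in_k0 hl hx uw nx.
  by have [-> _ _ _] := hp_diff sp hx hk nik.
(* Neither z nor w belongs to a symplectic pair orthogonal to both, so [L z w] is reached through
   the pair (r + z, r' + w) for a further plane r, r'. *)
have Lzw : L z w = 0.
  have [m [mk ml _]] := fourth_ord hg k l l.
  have hm := hp0 p m; set r := (p m).1 in hm *; set r' := (p m).2 in hm *.
  have um0 := umh _ _ _ hm; have [ir ir' er] := um0.
  have [iz _ _] := umh _ _ _ hk; have [iw _ _] := umh _ _ _ hl.
  have pm := off _ _ _ hm mk ml; have [e1 e2 e3 e4] := pm.
  have f1 : L r r' = 0 by apply: L0.
  have f2 : L r w = 0 by apply: (cross um0) => //; sfc.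
  have f3 : L r' z = 0 by apply: (cross (um_rot um0)) => //; [split; sfc | sfc].
  have : L (r + z) (r' + w) = 0.
    by apply: L0; [split; [intg | intg | sfc] | split; sfc].
  rewrite (altDl hL) !(altDr hL) f1 f2 add0r add0r.
  by rewrite [L z r'](altC hL) f3 oppr0 add0r.
have ydual : integral y /\ integral x.
  by have [? _] := hp_int sp hx; have [? _] := hp_int sp hy.
case: ydual => iy ix.
have [eij|nij] := eqVneq i j.
  rewrite -eij in hy; have [eik|nik] := eqVneq i k.
    rewrite eik in hx hy.
    have [->|->] := in_k _ _ _ _ _ hk hx xz; have [->|->] := in_k _ _ _ _ _ hk hy yz;
    by rewrite ?(altNl hL) ?(altNr hL) (altxx hL) ?oppr0.
  have [eil|nil] := eqVneq i l.
    rewrite eil in hx hy.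
    have [->|->] := in_k _ _ _ _ _ hl hx xw; have [->|->] := in_k _ _ _ _ _ hl hy yw;
    by rewrite ?(altNl hL) ?(altNr hL) (altxx hL) ?oppr0.
  apply: (plane sp hx hy) => a b hab; apply: L0 (umh _ _ _ hab) _.
  exact: off hab nik nil.
have [xy _ _ _] := hp_diff sp hx hy nij.
have [/andP[nik nil]|nx] := boolP ((i != k) && (i != l)).
  by apply: (cross (umh _ _ _ hx)) => //; apply: off hx nik nil.
have [/andP[njk njl]|ny] := boolP ((j != k) && (j != l)).
  rewrite (altC hL); apply/eqP; rewrite oppr_eq0; apply/eqP.
  by apply: (cross (umh _ _ _ hy)) => //; [rewrite sformC xy oppr0 | apply: off hy njk njl].
have zw2 a b a' b' : hp p k a a' -> hp p l b b' -> sform a z = 0 -> sform b w = 0 -> L a b = 0.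
  move=> ha hb az bw.
  have [->|->] := in_k _ _ _ _ _ hk ha az; have [->|->] := in_k _ _ _ _ _ hl hb bw;
  by rewrite ?(altNl hL) ?(altNr hL) Lzw ?oppr0.
move: nx ny; rewrite !negb_and !negbK.
case/orP=> /eqP ei; case/orP=> /eqP ej; rewrite ei in hx nij; rewrite ej in hy nij.
- by rewrite eqxx in nij.
- exact: zw2 hx hy xz yw.
- by rewrite (altC hL) (zw2 _ _ _ _ hy hx yz xw) oppr0.
- by rewrite eqxx in nij.
Qed.

End Span0.

Variable F : H g -> H g -> H g -> H g -> M.

(* The axioms satisfied by F a b z w = [[a /\ b, z /\ w]]; the values of F
   matter only when (a, b) is a symplectic pair orthogonal to z and w. *)
Definition pform := (forall a b, um a b -> alt_bilinear (F a b)) /\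
  (forall a b c d, um a b -> um c d -> perp a b c d -> F a b c d = F c d a b).

Definition cl z w L := alt_bilinear L /\
  forall a b, um a b -> perp a b z w -> F a b z w = L a b.

Definition tame z w := exists L, cl z w L.

(* Reads F a b z w as an alternating form in a, b, for fixed tame z, w; the
   value is a junk 0 when z, w is not tame. *)
Definition E z w : H g -> H g -> M :=
  if pselect (tame z w) is left h then projT1 (cid h) else fun _ _ => 0.

Lemma E_cl z w : tame z w -> cl z w (E z w).
Proof.
by move=> t; rewrite /E; case: pselect => // h; exact: projT2 (cid h).
Qed.

Lemma E_alt z w : tame z w -> alt_bilinear (E z w).
Proof. by case/E_cl. Qed.

Lemma EF z w a b : tame z w -> um a b -> perp a b z w -> F a b z w = E z w a b.
Proof. by case/E_cl => _; apply. Qed.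

Hypothesis pF : pform.

Lemma F_alt a b : um a b -> alt_bilinear (F a b). Proof. by case: pF => + _; apply. Qed.
Lemma F_sym a b c d : um a b -> um c d -> perp a b c d -> F a b c d = F c d a b.
Proof. by case: pF => _; apply. Qed.

Lemma cl_um a b : um a b -> cl a b (F a b).
Proof.
move=> u; split; first exact: F_alt.
by move=> c d u' pe; apply: F_sym.
Qed.

Lemma tame_um a b : um a b -> tame a b.
Proof. by move=> /cl_um; exists (F a b). Qed.

(** By symmetry of F both forms represent the same function of the symplectic pairs orthogonal to a
    and b, and [span0_um] says that those pairs determine the form there. *)
Lemma E_um a b z w : um a b -> perp z w a b -> E a b z w = F a b z w.
Proof.
move=> u; have t := tame_um u; have hE := E_cl t; have hF := cl_um u.
move=> pe; apply/eqP; rewrite -subr_eq0; apply/eqP.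
apply: (span0_um (L := fun x y => E a b x y - F a b x y) _ _ u pe).
  by apply: alt_sub; [case: hE | case: hF].
by move=> c d u' pe'; rewrite -(proj2 hE) // -(proj2 hF) // subrr.
Qed.

End PForm.

(** * Existence of E(z, w) for isotropic planes *)

Section Tame.
Variables (g : nat) (hg : (4 <= g)%N) (M : lmodType rat).
Variable F : H g -> H g -> H g -> H g -> M.
Hypothesis pF : pform F.
Implicit Types (x y z w u v a b c d : H g) (p : 'I_g -> H g * H g).
Implicit Types (L : H g -> H g -> M).
Local Notation E := (E F).
Local Notation tame := (tame F).
Local Notation cl := (cl F).

Let um_addr x xs y : um x xs -> integral y -> sform x y = 0 -> um x (xs + y).
Proof. by case=> ix ixs e iy xy; split=> //; [intg | sfc]. Qed.

(* Expanding F (x, xs + y; z, zs + w) in two ways. *)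
Lemma F_expand x xs y z zs w : um x xs -> um z zs -> integral y -> integral w ->
  sform x y = 0 -> sform z w = 0 -> perp x xs z zs -> sform x w = 0 ->
  sform xs w = 0 -> sform y z = 0 -> sform y zs = 0 -> sform y w = 0 ->
  F z (zs + w) x y - F z zs x y = F x (xs + y) z w - F x xs z w.
Proof.
move=> ux uz iy iw xy zw [e1 e2 e3 e4] e5 e6 e7 e8 e9.
have ux' := um_addr ux iy xy; have uz' := um_addr uz iw zw.
have b1 : perp x xs z zs by [].
have b2 : perp x (xs + y) z zs by split; sfc.
have b3 : perp x xs z (zs + w) by split; sfc.
have b4 : perp x (xs + y) z (zs + w) by split; sfc.
have h1 := F_sym pF ux uz b1; have h2 := F_sym pF ux' uz b2.
have h3 := F_sym pF ux uz' b3; have h4 := F_sym pF ux' uz' b4.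
have k1 : F z (zs + w) x y = F z (zs + w) x (xs + y) - F z (zs + w) x xs.
  by rewrite (altDr (F_alt pF uz')) addrAC subrr add0r.
have k2 : F z zs x y = F z zs x (xs + y) - F z zs x xs.
  by rewrite (altDr (F_alt pF uz)) addrAC subrr add0r.
have k3 : F x (xs + y) z w = F x (xs + y) z (zs + w) - F x (xs + y) z zs.
  by rewrite (altDr (F_alt pF ux')) addrAC subrr add0r.
have k4 : F x xs z w = F x xs z (zs + w) - F x xs z zs.
  by rewrite (altDr (F_alt pF ux)) addrAC subrr add0r.
rewrite k1 k2 k3 k4 h1 h2 h3 h4 !opprB.
by rewrite addrACA [RHS]addrACA; congr (_ + _); rewrite addrC.
Qed.

(** Writing w = (zs + w) - zs on one side and y = (xs + y) - xs on the other turns both sides into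
    differences of values of F at symplectic pairs, which [F_expand] compares. *)
Lemma symE x xs y z zs w : tame x y -> tame z w -> um x xs -> um z zs ->
  integral y -> integral w -> sform x y = 0 -> sform z w = 0 ->
  perp x xs z zs -> sform x w = 0 -> sform xs w = 0 ->
  sform y z = 0 -> sform y zs = 0 -> sform y w = 0 -> E x y z w = E z w x y.
Proof.
move=> txy tzw ux uz iy iw xy zw pe e5 e6 e7 e8 e9.
have [e1 e2 e3 e4] := pe.
have k1 : E x y z w = E x y z (zs + w) - E x y z zs.
  by rewrite (altDr (E_alt txy)) addrAC subrr add0r.
have k2 : E z w x y = E z w x (xs + y) - E z w x xs.
  by rewrite (altDr (E_alt tzw)) addrAC subrr add0r.
have ux' := um_addr ux iy xy; have uz' := um_addr uz iw zw.
rewrite k1 k2 -!EF //; first exact: F_expand.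
all: by split; sfc.
Qed.

Section TameIso.
Variables (p : 'I_g -> H g * H g) (i j : 'I_g) (z zs w ws : H g).
Hypotheses (sp : symp p) (nij : i != j) (hz : hp p i z zs) (hw : hp p j w ws).

Let uz : um z zs.
Proof. by have [? ?] := hp_int sp hz; split=> //; apply: hp_sform hz. Qed.
Let uw : um w ws.
Proof. by have [? ?] := hp_int sp hw; split=> //; apply: hp_sform hw. Qed.

Let zw : sform z w = 0. Proof. by case: (hp_diff sp hz hw nij). Qed.
Let zws : sform z ws = 0. Proof. by case: (hp_diff sp hz hw nij). Qed.
Let zsw : sform zs w = 0. Proof. by case: (hp_diff sp hz hw nij). Qed.
Let zsws : sform zs ws = 0. Proof. by case: (hp_diff sp hz hw nij). Qed.
Let zzs : sform z zs = 1. Proof. by case: uz. Qed.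
Let wws : sform w ws = 1. Proof. by case: uw. Qed.
Let iz : integral z. Proof. by case: uz. Qed.
Let izs : integral zs. Proof. by case: uz. Qed.
Let iw : integral w. Proof. by case: uw. Qed.
Let iws : integral ws. Proof. by case: uw. Qed.

Let uzw : um z (zs + w). Proof. by split; [intg|intg|sfc]. Qed.
Let uwz : um w (ws + z). Proof. by split; [intg|intg|sfc]. Qed.

(** Three expressions of z /\ w by symplectic bivectors: [l1] changes the partner of z, [l2] that of
    w, and [lk] expands (z + r) /\ (w + r') for a third plane r, r'. Each represents F only on pairs
    orthogonal to the auxiliary vectors. *)
Let l1 u v := F z (zs + w) u v - F z zs u v.
Let l2 u v := F w ws u v - F w (ws + z) u v.

Let l1_alt : alt_bilinear l1. Proof. by apply: alt_sub; apply: F_alt. Qed.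
Let l2_alt : alt_bilinear l2. Proof. by apply: alt_sub; apply: F_alt. Qed.

Let l1E a b : um a b -> perp a b z w -> sform a zs = 0 -> sform b zs = 0 ->
  F a b z w = l1 a b.
Proof.
move=> u [az aw bz bw] azs bzs; have h := F_alt pF u.
rewrite /l1 -(F_sym pF u uzw) -?(F_sym pF u uz) ?(altDr h) 1?addrAC ?subrr ?add0r //;
  by split; sfc.
Qed.

Let l2E a b : um a b -> perp a b z w -> sform a ws = 0 -> sform b ws = 0 ->
  F a b z w = l2 a b.
Proof.
move=> u [az aw bz bw] azs bzs; have h := F_alt pF u.
rewrite /l2 -(F_sym pF u uwz) -?(F_sym pF u uw) ?(altDr h).
- by rewrite opprD addrA subrr add0r -(altC h).
- by split; sfc.
- by split; sfc.
Qed.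

Let lk k u v := F (z + (p k).1) (w + (p k).2) u v - F (z + (p k).1) (p k).2 u v
  - (F (p k).1 (w + (p k).2) u v - F (p k).1 (p k).2 u v).

Section Lk.
Variable k : 'I_g.
Hypotheses (ki : k != i) (kj : k != j).
Let r := (p k).1.
Let r' := (p k).2.
Let hk : hp p k r r'. Proof. exact: hp0. Qed.
Let ur : um r r'.
Proof. by have [? ?] := hp_int sp hk; split=> //; apply: hp_sform hk. Qed.
Let rr' : sform r r' = 1. Proof. by case: ur. Qed.
Let ir : integral r. Proof. by case: ur. Qed.
Let ir' : integral r'. Proof. by case: ur. Qed.
Let rz : sform r z = 0. Proof. by case: (hp_diff sp hk hz ki). Qed.
Let rw : sform r w = 0. Proof. by case: (hp_diff sp hk hw kj). Qed.
Let r'z : sform r' z = 0. Proof. by case: (hp_diff sp hk hz ki). Qed.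
Let r'w : sform r' w = 0. Proof. by case: (hp_diff sp hk hw kj). Qed.

Let u1 : um (z + r) (w + r').
Proof. by split; [intg|intg|sfc]. Qed.
Let u2 : um (z + r) r'.
Proof. by split; [intg|intg|sfc]. Qed.
Let u3 : um r (w + r').
Proof. by split; [intg|intg|sfc]. Qed.

Lemma lk_alt : alt_bilinear (lk k).
Proof. by apply: alt_sub; apply: alt_sub; apply: F_alt. Qed.

Lemma lkE a b : um a b -> perp a b z w -> perp a b r r' -> F a b z w = lk k a b.
Proof.
move=> u [az aw bz bw] [ar ar' br br']; have h := F_alt pF u.
rewrite /lk -(F_sym pF u u1); last by split; sfc.
rewrite -(F_sym pF u u2); last by split; sfc.
rewrite -(F_sym pF u u3); last by split; sfc.
rewrite -(F_sym pF u ur); last by split; sfc.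
by rewrite !(altDl h) !(altDr h); lmod.
Qed.
End Lk.


(** The four terms of [lk k z w] are values of F(-; z, w) at symplectic pairs orthogonal to the
    plane k', so [lkE] turns them into values of [lk k'], which add up to [lk k' z w]. *)
Let lk_zw k k' : k != i -> k != j -> k' != i -> k' != j -> lk k z w = lk k' z w.
Proof.
move=> ki kj k'i k'j; have [->//|nkk] := eqVneq k k'.
set r := (p k).1; set r' := (p k).2; set s := (p k').1; set s' := (p k').2.
have hk : hp p k r r' := hp0 p k; have hk' : hp p k' s s' := hp0 p k'.
have [rz _ r'z _] := hp_diff sp hk hz ki; have [rw _ r'w _] := hp_diff sp hk hw kj.
have [sz _ s'z _] := hp_diff sp hk' hz k'i; have [sw _ s'w _] := hp_diff sp hk' hw k'j.
have [rs rs' r's r's'] := hp_diff sp hk hk' nkk.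
have [ir ir'] := hp_int sp hk; have [js js'] := hp_int sp hk'.
have rr' := hp_sform sp hk; have ss' := hp_sform sp hk'.
have u1 : um (z + r) (w + r') by split; [intg|intg|sfc].
have u2 : um (z + r) r' by split; [intg|intg|sfc].
have u3 : um r (w + r') by split; [intg|intg|sfc].
have u4 : um r r' by split; [intg|intg|sfc].
have v1 : um (z + s) (w + s') by split; [intg|intg|sfc].
have v2 : um (z + s) s' by split; [intg|intg|sfc].
have v3 : um s (w + s') by split; [intg|intg|sfc].
have v4 : um s s' by split; [intg|intg|sfc].
have ex a b : um a b -> perp a b z w -> perp a b s s' ->
    F a b z w = lk k' a b by move=> *; apply: lkE.
have ex' a b : um a b -> perp a b z w -> perp a b r r' ->
    F a b z w = lk k a b by move=> *; apply: lkE.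
have D : alt_bilinear (lk k) by apply: lk_alt.
have D' : alt_bilinear (lk k') by apply: lk_alt.
rewrite {1}/lk -/r -/r' (ex _ _ u1) ?(ex _ _ u2) ?(ex _ _ u3) ?(ex _ _ u4);
  try by split; sfc.
by rewrite !(altE D'); lmod.
Qed.

Let third : exists k : 'I_g, k != i /\ k != j.
Proof. by have [k [? ? _]] := fourth_ord hg i j j; exists k. Qed.
Let k0 := projT1 (cid third).
Let k0i : k0 != i. Proof. by case: (projT2 (cid third)). Qed.
Let k0j : k0 != j. Proof. by case: (projT2 (cid third)). Qed.

Let pr u : H g := u - (sform u zs *: z - sform u z *: zs)
  - (sform u ws *: w - sform u w *: ws).

(* The form sought is l2 away from w, l1 on w paired with the complement of
   both planes, and the value on (z, w) is read off a third plane. *)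
Let Lt u v : M := l2 (pr u + sform u zs *: z) (pr v + sform v zs *: z)
  + (sform u ws *: l1 w (pr v) - sform v ws *: l1 w (pr u))
  + (sform u zs * sform v ws - sform u ws * sform v zs) *: lk k0 z w.

Let pr_lin : linear pr.
Proof.
move=> a x y; rewrite /pr !sformE !scalerDl !scalerBr !scalerA.
by lmod.
Qed.

Let Lt_alt : alt_bilinear Lt.
Proof.
apply: alt_add; first apply: alt_add.
- apply: (alt_comp (f := fun u => pr u + sform u zs *: z)) => //.
  by move=> a x y; rewrite pr_lin !sformE scalerDl; lmod.
- apply: alt_cross; first by move=> a x y; rewrite !sformE.
  by move=> a x y; rewrite pr_lin (alt_linr l1_alt).
have h : alt_bilinear (fun u v => sform u zs *: (sform v ws *: lk k0 z w)
    - sform v zs *: (sform u ws *: lk k0 z w)).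
  apply: alt_cross; first by move=> a x y; rewrite !sformE.
  by move=> a x y; rewrite !sformE scalerDl -scalerA.
have -> : (fun u v => (sform u zs * sform v ws - sform u ws * sform v zs) *: lk k0 z w)
  = (fun u v => sform u zs *: (sform v ws *: lk k0 z w)
    - sform v zs *: (sform u ws *: lk k0 z w)) => //.
by apply/funext => u; apply/funext => v; lmod.
Qed.

Let pr_id u : sform u z = 0 -> sform u w = 0 -> sform u zs = 0 ->
  sform u ws = 0 -> pr u = u.
Proof. by move=> e1 e2 e3 e4; rewrite /pr e1 e2 e3 e4 !scale0r !subr0. Qed.

Let pr_z : pr z = 0.
Proof. by rewrite /pr !sformxx zzs zw zws !scale0r scale1r !subr0 subrr. Qed.
Let pr_w : pr w = 0.
Proof.
rewrite /pr !sformxx wws (sformC z w) zw (sformC zs w) zsw oppr0 !scale0r.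
by rewrite scale1r !subr0 subrr.
Qed.

Let LtE2 u v : sform u z = 0 -> sform u w = 0 -> sform u ws = 0 ->
  sform v z = 0 -> sform v w = 0 -> sform v ws = 0 -> Lt u v = l2 u v.
Proof.
have id x : sform x z = 0 -> sform x w = 0 -> sform x ws = 0 ->
    pr x + sform x zs *: z = x.
  by move=> e1 e2 e3; rewrite /pr e1 e2 e3 !scale0r !subr0 subrK.
move=> a1 a2 a3 b1 b2 b3; rewrite /Lt !id // a3 b3 !scale0r subrr addr0.
by rewrite mulr0 mul0r subrr scale0r addr0.
Qed.

Let umhp k x x' : hp p k x x' -> um x x'.
Proof. by move=> h; have [? ?] := hp_int sp h; split=> //; apply: hp_sform h. Qed.

Section Arbitrary.
Variable f : H g.
Hypotheses (fi : integral f) (zf : sform z f = 1).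

Let uf : um z f. Proof. by split. Qed.
Let ufw : um z (f + w). Proof. by split; [intg|intg|sfc]. Qed.

(** The analogue of [l1] for an arbitrary partner f of z; f will be taken orthogonal to the
    symplectic pair under consideration. *)
Let lf u v := F z (f + w) u v - F z f u v.
Let lf_alt : alt_bilinear lf. Proof. by apply: alt_sub; apply: F_alt. Qed.

Let lfE x y : um x y -> perp x y z w -> sform x f = 0 -> sform y f = 0 ->
  F x y z w = lf x y.
Proof.
move=> u [xz xw yz yw] xf yf; have h := F_alt pF u.
have e1 : F x y z (f + w) = F z (f + w) x y.
  by apply: F_sym => //; split=> //; rewrite sformDr ?xf ?yf ?xw ?yw addr0.
have e2 : F x y z f = F z f x y by apply: F_sym.
by rewrite /lf -e1 -e2 (altDr h); lmod.
Qed.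

(** Projection along z onto the orthogonal of f. *)
Let th u : H g := u + sform f u *: z.
Let th_lin : linear th.
Proof. by move=> k x y; rewrite /th !sformE; lmod. Qed.
Let thN u : th (- u) = - th u.
Proof. by rewrite /th !sformE; lmod. Qed.
Let th_z : th z = 0.
Proof. by rewrite /th (sformC z f) zf scaleN1r subrr. Qed.

Let D u v := lf u v - Lt u v.
Let D_alt : alt_bilinear D. Proof. exact: alt_sub. Qed.

Let D_um x y : um x y -> perp x y z w -> sform x f = 0 -> sform y f = 0 ->
  sform x ws = 0 -> sform y ws = 0 -> D x y = 0.
Proof.
move=> u [xz xw yz yw] xf yf xws yws.
by rewrite /D -lfE // LtE2 // -l2E // subrr.
Qed.

Let D_cross X X' Y : um X X' -> integral Y -> sform X Y = 0 ->
  perp X X' z w -> sform X f = 0 -> sform X' f = 0 -> sform X ws = 0 ->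
  sform X' ws = 0 -> sform Y z = 0 -> sform Y w = 0 -> sform Y f = 0 ->
  sform Y ws = 0 -> D X Y = 0.
Proof.
move=> u iY XY [e1 e2 e3 e4] e5 e6 e7 e8 e9 f1 f2 f3; have [? ? ?] := u.
have e : D X (X' + Y) = 0.
  by apply: D_um; [split; [intg|intg|sfc]|split; sfc|sfc|sfc|sfc|sfc].
by move: e; rewrite (altDr D_alt) D_um ?add0r.
Qed.

Let D_planes k l x x' y y' : k != i -> k != j -> l != i -> l != j ->
  hp p k x x' -> hp p l y y' -> D (th x) (th y) = 0.
Proof.
move=> ki kj li lj hx hy.
have th_um m r r' : m != i -> m != j -> hp p m r r' -> um (th r) (th r') /\
    [/\ perp (th r) (th r') z w, sform (th r) f = 0, sform (th r') f = 0,
      sform (th r) ws = 0 & sform (th r') ws = 0].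
  move=> mi mj h; have [rz _ r'z _] := hp_diff sp h hz mi.
  have [rw rws r'w r'ws] := hp_diff sp h hw mj.
  have [ir ir' rr'] := umhp h.
  split; first by split; rewrite /th; [intg|intg|sfc].
  by split; first split; rewrite /th !sformE ?(sformC f r) ?(sformC f r'); sfc.
have [[ix ix' xx'] [[xz xw x'z x'w] xf x'f xws x'ws]] := th_um _ _ _ ki kj hx.
have [[iy iy' yy'] [[yz yw y'z y'w] yf y'f yws y'ws]] := th_um _ _ _ li lj hy.
have Dxx' : D (th x) (th x') = 0 by apply: D_um.
have [ekl|nkl] := eqVneq k l.
  have [[? ? ?] [[? ? ? ?] ? ? ? ?]] := th_um _ _ _ ki kj (hp0 p k).
  have e1 : D (th (p k).1) (th (p k).2) = 0 by apply: D_um.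
  have e2 : D (th (p k).2) (th (p k).1) = 0 by rewrite (altC D_alt) e1 oppr0.
  rewrite -ekl in hy; case: (hx) => [] [-> _]; case: (hy) => [] [-> _];
  by rewrite ?thN ?(altNl D_alt) ?(altNr D_alt) ?(altxx D_alt) ?e1 ?e2 ?oppr0.
have [exy exy' ex'y ex'y'] := hp_diff sp hx hy nkl.
have xy : sform (th x) (th y) = 0.
  have [rz _ r'z _] := hp_diff sp hx hz ki.
  have [sz _ s'z _] := hp_diff sp hy hz li.
  by rewrite /th !sformE exy rz (sformC y z) sz; ring.
by apply: (D_cross (X' := th x')).
Qed.

(** The comparison passes through [lk m] for a fourth plane m. The pair (th r, th r' + th w) is
    orthogonal to z, w, f and to plane m, so [lf] and [lk m] both give F there, while [lk m - Lt]
    vanishes on each term of the expansion. *)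
Let D_w k r r' : k != i -> k != j -> hp p k r r' -> D (th w) (th r) = 0.
Proof.
move=> ki kj hr; have [m [mi mj mk]] := fourth_ord hg i j k.
have km : k != m by rewrite eq_sym.
have [rz rzs r'z r'zs] := hp_diff sp hr hz ki.
have [rw rws r'w r'ws] := hp_diff sp hr hw kj.
have [ir ir' rr'] := umhp hr.
have hm := hp0 p m; set s := (p m).1 in hm *; set s' := (p m).2 in hm *.
have [sz _ s'z _] := hp_diff sp hm hz mi; have [sw _ s'w _] := hp_diff sp hm hw mj.
have [rs rs' r's r's'] := hp_diff sp hr hm km.
have lka : alt_bilinear (lk m) := lk_alt mi mj.
pose D2 u v := lk m u v - Lt u v.
have D2a : alt_bilinear D2 by apply: alt_sub.
have lkm x y : um x y -> perp x y z w -> perp x y s s' -> F x y z w = lk m x y.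
  exact: lkE.
have D2rr : D2 r r' = 0.
  rewrite /D2 -lkm //; try by split; sfc.
  by rewrite LtE2 // -l2E ?subrr.
have urz : um r (r' + z) by split; [intg|intg|sfc].
have ur'z : um r' (- r + z) by split; [intg|intg|rewrite !sformE (sformC r r') rr'; sfc].
have urw : um r (r' + w) by split; [intg|intg|sfc].
have D2rz : D2 r z = 0.
  have : D2 r (r' + z) = 0.
    rewrite /D2 -lkm //; try by split; sfc.
    by rewrite LtE2 -?l2E ?subrr //; first [by sfc | by split; sfc].
  by rewrite (altDr D2a) D2rr add0r.
have D2r'z : D2 r' z = 0.
  have : D2 r' (- r + z) = 0.
    rewrite /D2 -lkm //; try by split; sfc.
    by rewrite LtE2 -?l2E ?subrr //; first [by sfc | by split; sfc].
  by rewrite (altDr D2a) (altNr D2a) [D2 r' r](altC D2a) D2rr !oppr0 add0r.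
have wzs : sform w zs = 0 by sfc.
have D2rw : D2 r w = 0.
  have : D2 r (r' + w) = 0.
    rewrite /D2 -lkm //; try by split; sfc.
    rewrite (l1E urw); [|by split; sfc|by sfc|by sfc].
    rewrite (altDr Lt_alt) LtE2 // -l2E //.
    rewrite (l1E (And3 ir ir' rr')) //.
    have -> : Lt r w = l1 r w.
      rewrite /Lt pr_w (pr_id rz rw rzs rws) rws wws wzs rzs !scale0r !addr0.
      by rewrite (alt0r l2_alt) (altC l1_alt r w); lmod.
    by rewrite (altDr l1_alt) subrr.
  by rewrite (altDr D2a) D2rr add0r.
have D2zw : D2 z w = 0.
  rewrite /D2 /Lt pr_w pr_z zzs wws zws wzs (lk_zw mi mj k0i k0j).
  by rewrite !scale0r !addr0 (alt0r l2_alt) (alt0r l1_alt); lmod.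
have uX : um (th r) (th r' + th w) by rewrite /th; split; [intg|intg|sfc].
have pX : perp (th r) (th r' + th w) z w by rewrite /th; split; sfc.
have pS : perp (th r) (th r' + th w) s s' by rewrite /th; split; sfc.
have D2th : D2 (th r) (th r' + th w) = 0.
  rewrite /th !(altE D2a) D2rr D2rz D2rw D2zw.
  by rewrite (altC D2a z r') D2r'z; lmod.
have D0 : D (th r) (th r' + th w) = 0.
  rewrite /D -lfE //.
  - by rewrite (lkm _ _ uX pX pS).
  - by rewrite /th !sformE (sformC f r); sfc.
  - by rewrite /th !sformE (sformC f r') (sformC f w); sfc.
have Drr : D (th r) (th r') = 0 := D_planes ki kj ki kj hr (hp_rot hr).
by rewrite (altC D_alt); move: D0; rewrite (altDr D_alt) Drr add0r => ->; rewrite oppr0.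
Qed.

Lemma tame_arb a b : um a b -> perp a b z w -> sform a f = 0 -> sform b f = 0 ->
  F a b z w = Lt a b.
Proof.
move=> u pe af bf; rewrite lfE //; apply/eqP; rewrite -subr_eq0; apply/eqP.
have [az aw bz bw] := pe.
have the c : sform c f = 0 -> th c = c.
  by move=> e; rewrite /th sformC e oppr0 scale0r addr0.
rewrite -[RHS]/(0 : M) -[LHS]/(D a b) -(the a af) -(the b bf).
have key (G : H g -> M) c : linear G -> (forall k x x', k != i -> k != j ->
    hp p k x x' -> G (th x) = 0) -> G (th w) = 0 -> sform c z = 0 ->
    sform c w = 0 -> G (th c) = 0.
  move=> lG Gk Gw cz cw; have G0 : G 0 = 0.
    have := lG 1 0 0; rewrite scaler0 addr0 scale1r => e.
    by apply: (addrI (G 0)); rewrite addr0; apply: esym.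
  have GN x : G (- x) = - G x.
    by have := lG (-1) x 0; rewrite !scaleN1r !addr0 G0 addr0.
  apply: (@hp_expand0 _ _ sp _ (fun x => G (th x))) => [|k x x' hx nx].
    by move=> e x y; rewrite th_lin lG.
  have [eki|ki] := eqVneq k i.
    rewrite eki in hx; have := hp_line sp hz hx (hp_coef sp hz hx cz nx).
    by case=> ->; rewrite ?thN th_z ?oppr0.
  have [ekj|kj] := eqVneq k j; last exact: Gk hx.
  rewrite ekj in hx; have := hp_line sp hw hx (hp_coef sp hw hx cw nx).
  by case=> ->; rewrite ?thN ?GN Gw ?oppr0.
apply: (key (fun x => D x (th b))) => //; first exact: alt_linl.
- move=> k x x' ki kj hx; apply: (key (D (th x))) => //; first exact: alt_linr.
    by move=> l y y' li lj hy; apply: (D_planes ki kj li lj hx hy).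
  by rewrite (altC D_alt) (D_w ki kj hx) oppr0.
- apply: (key (D (th w))) => //; first exact: alt_linr.
  exact: (altxx D_alt).
Qed.

End Arbitrary.


Lemma tame_hp : tame z w.
Proof.
exists Lt; split=> // a b u pe; have [az aw bz bw] := pe; have [ia ib ab] := u.
(* The partner zs minus its component in the plane of a, b: still a partner of z, and orthogonal to
   a and b. *)
apply: (@tame_arb (zs - sform zs b *: a + sform zs a *: b)) => //.
- by intg.
- by sfc.
- by rewrite !sformE ab (sformC zs a); ring.
- by rewrite !sformE (sformC a b) ab (sformC zs b); ring.
Qed.

End TameIso.

Lemma tame_iso z w zs ws : iso z w zs ws -> tame z w.
Proof.
case/iso_basis=> [p [i [j [zs' [ws' [sp nij hz hw]]]]]].
exact: tame_hp sp nij hz hw.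
Qed.

End Tame.

(** * Vanishing of a form killing the generators of one basis *)

Ltac side := lazymatch goal with
  | |- um _ _ => split; [intg|intg|sfc]
  | |- perp _ _ _ _ => split; sfc
  | |- iso _ _ _ _ => split; [split; [intg|intg|sfc]|split; [intg|intg|sfc]|sfc|sfc|sfc]
  | |- is_true (integral _) => intg
  | |- sform _ _ = _ => sfc
  end.
Ltac hp1 sp h := have [? ?] := hp_int sp h; have ? := hp_sform sp h.
Ltac hp2 sp h h' n := have [? ? ? ?] := hp_diff sp h h' n.
Ltac frame2 sp hx hy n := hp1 sp hx; hp1 sp hy; hp2 sp hx hy n.

Section Calc.
Variables (g : nat) (hg : (4 <= g)%N) (M : lmodType rat).
Variable F : H g -> H g -> H g -> H g -> M.
Hypothesis pF : pform F.
Implicit Types (x y z w u v a b c d r s t : H g) (p : 'I_g -> H g * H g).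
Implicit Types (L : H g -> H g -> M).
Local Notation E := (E F).
Local Notation tame := (tame F).
Local Notation cl := (cl F).

(** These are the pairs for which [tame_ty] provides E. *)
Definition ty z w := [\/ um z w, um w z | exists zs ws, iso z w zs ws].

Lemma span0 L z w u v : alt_bilinear L -> ty z w ->
  (forall a b, um a b -> perp a b z w -> L a b = 0) -> perp u v z w -> L u v = 0.
Proof.
move=> hL [uz|uz|[zs [ws hi]]] L0 pe.
- exact: (span0_um hL L0 uz pe).
- apply: (span0_um hL (z := w) (w := z)) => //.
    by move=> a b uab [? ? ? ?]; apply: L0.
  by case: pe => *; split.
- exact: (span0_iso hg hL L0 hi pe).
Qed.

Lemma cl_opp z w L : cl z w L -> cl w z (fun u v => - L u v).
Proof.
case=> hL e; split; first exact: alt_opp.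
move=> a b u [? ? ? ?]; rewrite -e //; first by rewrite (altC (F_alt pF u)).
Qed.

Lemma tame_ty z w : ty z w -> tame z w.
Proof.
case=> [u|u|[zs [ws hi]]]; first exact: tame_um.
- by have h := cl_opp (cl_um pF u); eexists; exact: h.
- exact: (tame_iso hg pF hi).
Qed.

Lemma E_uniq z w L u v : ty z w -> cl z w L -> perp u v z w -> E z w u v = L u v.
Proof.
move=> tz [hL eL] pe; have tm := tame_ty tz.
apply/eqP; rewrite -subr_eq0; apply/eqP.
apply: (span0 (L := fun u v => E z w u v - L u v) _ tz) pe.
  by apply: alt_sub => //; apply: E_alt.
by move=> a b u' pe; rewrite -EF // eL // subrr.
Qed.

(* E only depends on the bivector z ^ w. *)
Lemma E_biv k z w z2 w2 u v : ty z w ->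
  (forall a, sform a z = 0 -> sform a w = 0 -> sform a z2 = 0 /\ sform a w2 = 0) ->
  (forall a, sform a z2 = 0 -> sform a w2 = 0 -> sform a z = 0 /\ sform a w = 0) ->
  (forall L, alt_bilinear L -> L z2 w2 = k *: L z w) ->
  perp u v z w -> E z2 w2 u v = k *: E z w u v.
Proof.
move=> tz p12 p21 biv pe; have tm := tame_ty tz.
have ha : alt_bilinear (fun u v => k *: E z w u v).
  have h := E_alt tm; split=> [x|q x x' y|q x y y'].
  - by rewrite (altxx h) scaler0.
  - by rewrite (altDl h) (altZl h) scalerDr !scalerA mulrC.
  - by rewrite (altDr h) (altZr h) scalerDr !scalerA mulrC.
have t2 : tame z2 w2.
  exists (fun u v => k *: E z w u v); split=> // a b u' [a1 a2 b1 b2].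
  have [? ?] := p21 a a1 a2; have [? ?] := p21 b b1 b2.
  by rewrite (biv _ (F_alt pF u')) EF.
apply/eqP; rewrite -subr_eq0; apply/eqP.
apply: (span0 (L := fun u v => E z2 w2 u v - k *: E z w u v) _ tz) pe.
  by apply: alt_sub => //; apply: E_alt.
move=> a b u' [a1 a2 b1 b2].
have [? ?] := p12 a a1 a2; have [? ?] := p12 b b1 b2.
by rewrite -!EF // (biv _ (F_alt pF u')) subrr.
Qed.

Lemma EC z w u v : ty z w -> perp u v z w -> E w z u v = - E z w u v.
Proof.
move=> tz pe; rewrite -scaleN1r; apply: (E_biv tz _ _ _ pe) => //.
by move=> L hL; rewrite scaleN1r (altC hL).
Qed.

Lemma ENl z w u v : ty z w -> perp u v z w -> E (- z) w u v = - E z w u v.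
Proof.
move=> tz pe; rewrite -scaleN1r; apply: (E_biv tz _ _ _ pe).
- by move=> a ? ?; split; sfc.
- by move=> a + ?; rewrite sformNr => h; split=> //; lra.
- by move=> L hL; rewrite scaleN1r (altNl hL).
Qed.

Lemma ENr z w u v : ty z w -> perp u v z w -> E z (- w) u v = - E z w u v.
Proof.
move=> tz pe; rewrite -scaleN1r; apply: (E_biv tz _ _ _ pe).
- by move=> a ? ?; split; sfc.
- by move=> a ?; rewrite sformNr => h; split=> //; lra.
- by move=> L hL; rewrite scaleN1r (altNr hL).
Qed.

(** The bivectors a /\ b and b /\ (- a) agree. This is not part of [pform], but it follows because E
    depends on the bivector only. *)
Lemma F_rot a b u v : um a b -> perp u v a b -> F b (- a) u v = F a b u v.
Proof.
move=> uab pe; have ur := um_rot uab; have [p1 p2 p3 p4] := pe.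
have pe' : perp u v b (- a) by side.
have tab : ty a b by constructor 1.
rewrite -(E_um pF uab pe) -(E_um pF ur pe') -[RHS]scale1r.
apply: (E_biv tab _ _ _ pe).
- by move=> c ? ?; split; sfc.
- by move=> c ?; rewrite sformNr => h; split=> //; lra.
- by move=> L hL; rewrite scale1r (altNr hL) -(altC hL).
Qed.

Definition null z w := forall u v, perp u v z w -> E z w u v = 0.
(** Euclid's algorithm puts any a into a basis satisfying [base], so F vanishes once [inV] holds for
    the vectors of such bases. *)
Definition inV x := forall v, um x v -> forall z w, perp z w x v -> F x v z w = 0.

Lemma inV_drop z w x x0 r : tame z w -> inV x -> um x x0 -> perp x x0 z w ->
  integral r -> sform r z = 0 -> sform r w = 0 -> E z w x r = 0.
Proof.
move=> tz Vx ux pe ir rz rw; have [xz xw x0z x0w] := pe; have [ix ix0 e] := ux.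
have h := E_alt tz; pose k := sform x r.
have E0 v : um x v -> sform v z = 0 -> sform v w = 0 -> E z w x v = 0.
  move=> u vz vw; have pv : perp x v z w by split.
  by rewrite -EF // Vx //; apply: perpC.
have ik : k \is a Num.int by apply: sform_int.
have ek : sform x r = k by [].
have : E z w x (x0 + (r - k *: x0)) = 0.
  by apply: E0; [split; [intg|intg|sfc]|sfc|sfc].
rewrite (altDr h) E0 // add0r => e0.
have -> : r = (r - k *: x0) + k *: x0 by rewrite subrK.
by rewrite (altDr h) e0 (altZr h) E0 // scaler0 addr0.
Qed.

Lemma inV_dropF a b x x0 r : um a b -> inV x -> um x x0 -> perp x x0 a b ->
  integral r -> sform r a = 0 -> sform r b = 0 -> F a b x r = 0.
Proof.
move=> u Vx ux pe ir ra rb; have [? ? _ _] := pe.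
have pr : perp x r a b by split.
rewrite -(E_um pF u pr); exact: (inV_drop (tame_um pF u) Vx ux pe).
Qed.

(** The element (t /\ (c + t')).((c' + t) /\ w), where the products of c with c' and of t' with t
    cancel. Likewise [sig] is the square of (x + y) /\ (x' - y'), isotropic by the same
    cancellation. *)
Definition D0 c c' t t' w := F t (c + t') (c' + t) w.
Definition sig x x' y y' := E (x + y) (x' - y') (x + y) (x' - y').

Definition DD p i t t' w := forall j c c', j != i -> hp p j c c' ->
  sform c w = 0 -> D0 c c' t t' w = 0 \/ D0 (- c) (- c') t t' w = 0.

(* F vanishes as soon as it kills the generators listed here, which involve
   the vectors of a single symplectic basis. In base_D, base_N and base_Q one
   sign, or one order, is enough: the other follows from the relations. *)
Record base p : Prop := Base {
  base_iso : forall i j x x' y y', i != j -> hp p i x x' -> hp p j y y' -> null x y;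
  base_um : forall i u v, perp u v (p i).1 (p i).2 -> F (p i).1 (p i).2 u v = 0;
  base_D : forall i l t t' w w', i != l -> hp p i t t' -> hp p l w w' ->
    DD p i t t' w \/ DD p l w w' t;
  base_N : forall i j t t' c c', i != j -> hp p i t t' -> hp p j c c' ->
    E t (c + c') t (c + c') = 0 \/ E t (c - c') t (c - c') = 0;
  base_Q : forall i j x x' y y', i != j -> hp p i x x' -> hp p j y y' ->
    sig x x' y y' = 0 \/ sig x x' (- y) (- y') = 0 }.

Lemma lmod_half (m : M) : m + m = 0 -> m = 0.
Proof.
move=> e; have -> : m = 2^-1 *: (m + m) by rewrite scalerDr -scalerDl; lmod.
by rewrite e scaler0.
Qed.

Section Base.
Variable p : 'I_g -> H g * H g.
Hypotheses (sp : symp p) (bp : base p).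

Lemma base_um' i x x' u v : hp p i x x' -> perp u v x x' -> F x x' u v = 0.
Proof.
move=> hx pe; have [ia ib] := (symp_int1 sp i, symp_int2 sp i).
have uab : um (p i).1 (p i).2 by split=> //; apply: symp_12.
have pe0 : perp u v (p i).1 (p i).2.
  by case: hx pe => [] [-> ->] []; rewrite /perp ?sformE => *; split; lra.
have e1 := base_um bp pe0; have e2 := F_rot uab pe0; rewrite e1 in e2.
have [p1 p2 p3 p4] := pe0.
have u2 := um_rot uab; have u3 := um_rot u2; have u4 := um_rot u3.
have q2 : perp u v (p i).2 (- (p i).1) by side.
have q3 : perp u v (- (p i).1) (- (p i).2) by side.
have e3 := F_rot u2 q2; rewrite e2 in e3.
have e4 := F_rot u3 q3; rewrite e3 opprK in e4.
by case: hx => [] [-> ->].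
Qed.

Lemma hp_um i x x' : hp p i x x' -> um x x'.
Proof. by move=> h; have [? ?] := hp_int sp h; split=> //; apply: hp_sform h. Qed.

End Base.

Lemma ty_um x x0 y y0 : um x x0 -> um y y0 -> sform x y = 0 -> sform x y0 = 0 ->
  ty x y.
Proof.
move=> [? ? ex] [? ? ey] xy xy0; pose k := sform y x0.
have ek : sform y x0 = k by []; have ik : k \is a Num.int by apply: sform_int.
by constructor 3; exists (x0 - k *: y0), y0; side.
Qed.

Lemma ty_opp z w : ty z w -> ty (- z) w.
Proof.
case=> [[? ? e]|[? ? e]|[zs [ws [[? ? ez] [? ? ew] e1 e2 e3]]]].
- by constructor 2; side.
- by constructor 1; side.
- by constructor 3; exists (- zs), ws; side.
Qed.

(** [symE] with a partner supplied for each of the four vectors; tameness is then automatic. *)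
Lemma sym4 x x0 y y0 z z0 w w0 : um x x0 -> um y y0 -> um z z0 -> um w w0 ->
  sform x y = 0 -> sform x y0 = 0 -> sform z w = 0 -> sform z w0 = 0 ->
  perp x x0 z z0 -> sform x w = 0 -> sform x0 w = 0 -> sform y z = 0 ->
  sform y z0 = 0 -> sform y w = 0 -> E x y z w = E z w x y.
Proof.
move=> ux uy uz uw e1 e2 e3 e4 pe e5 e6 e7 e8 e9; have [? ? _] := uy; have [? ? _] := uw.
by apply: (symE pF _ _ ux uz) => //; apply: tame_ty; apply: ty_um; eassumption.
Qed.

Lemma symF x y z w : um x y -> ty z w -> perp x y z w -> E x y z w = E z w x y.
Proof.
move=> u tz pe; rewrite (E_um pF u); last exact: perpC.
by rewrite EF //; apply: tame_ty.
Qed.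

Lemma null_um z w x y : null x y -> ty x y -> um z w \/ um w z ->
  perp x y z w -> E z w x y = 0.
Proof.
move=> n t u pe; have pe' := perpC pe; case: u => u.
  by rewrite (symF u t pe') n.
have tz : ty w z by constructor 1.
have pw : perp w z x y by case: pe' => *; split.
have px : perp x y w z by apply: perpC.
by rewrite (EC tz px) (symF u t pw) n ?oppr0.
Qed.

End Calc.

(** * Generators with one contraction *)

Section Centres.
Variables (g : nat) (hg : (4 <= g)%N) (M : lmodType rat).
Variable F : H g -> H g -> H g -> H g -> M.
Hypothesis pF : pform F.
Implicit Types (x y z w u v a b c d r s t : H g).
Local Notation E := (E F).
Local Notation D0 := (D0 F).
Variable p : 'I_g -> H g * H g.
Hypotheses (sp : symp p) (bp : base F p).

Lemma hp_ortho i x x' w : hp p i x x' -> sform x w = 0 -> forall l w',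
  hp p l w w' -> i != l \/ w = x \/ w = - x.
Proof.
move=> hx xw l w' hw; have [eil|] := eqVneq i l; last by left.
rewrite -eil in hw; right; apply: (hp_line sp hx hw).
by rewrite sformC xw oppr0.
Qed.

Lemma base_null i j x x' y y' : i != j -> hp p i x x' -> hp p j y y' ->
  null F x y.
Proof. exact: (base_iso bp). Qed.

Section Pair.
Variables (i l : 'I_g) (t t' w w' : H g).
Hypotheses (nil : i != l) (ht : hp p i t t') (hw : hp p l w w').

(** The two sides differ by [E (c' + t) w t r], which after exchanging the factors is a value of the
    null pair (t, r). *)
Lemma centre_add j k c c' r r' : j != i -> k != i -> j != k ->
  hp p j c c' -> hp p k r r' -> sform c w = 0 -> sform r w = 0 ->
  ty (c' + t) w /\ F t (c + r + t') (c' + t) w = D0 c c' t t' w.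
Proof.
move=> ji ki jk hc hr cw rw; frame2 sp ht hc (introN eqP (fun e => elimN eqP ji (esym e))).
frame2 sp hr ht ki; hp2 sp hc hr jk; hp1 sp hw; hp2 sp ht hw nil.
have ntr u v : perp u v t r -> E t r u v = 0.
  by apply: (base_null _ ht hr); rewrite eq_sym.
have ttr : ty t r by apply: (ty_um (x0 := t') (y0 := r')); side.
suff [tc R] : ty (c' + t) w /\ E (c' + t) w t r = 0.
  split=> //; have tm := tame_ty hg pF tc.
  have u1 : um t (c + r + t') by side.
  have u2 : um t (c + t') by side.
  rewrite /D0 (EF tm u1); last by side.
  rewrite (EF tm u2); last by side.
  by rewrite !(altDr (E_alt tm)) R; lmod.
have [jl|[e|e]] := hp_ortho hc cw hw.
- hp2 sp hc hw jl.
  have tc : ty (c' + t) w by apply: (ty_um (x0 := - c) (y0 := w')); side.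
  split=> //; rewrite -(sym4 hg pF (x := t) (x0 := t' + c) (y0 := r') (z0 := - c) (w0 := w'));
    by [apply: ntr; side | side].
- subst w; have u : um c (c' + t) by side.
  split; first by constructor 2.
  by apply: (null_um hg pF ntr ttr); [right | side].
- subst w; have u : um (c' + t) (- c) by side.
  split; first by constructor 1.
  by apply: (null_um hg pF ntr ttr); [left | side].
Qed.

Lemma centre_ty j k c c' r r' : j != k -> hp p j c c' -> hp p k r r' ->
  sform c w = 0 -> sform r w = 0 -> ty (c' - r') w.
Proof.
move=> jk hc hr cw rw; frame2 sp hc hr jk; hp1 sp hw.
have [jl|[e|e]] := hp_ortho hc cw hw; last first.
- by subst w; constructor 1; side.
- by subst w; constructor 2; side.
hp2 sp hc hw jl.
have [kl|[e|e]] := hp_ortho hr rw hw; last first.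
- by subst w; constructor 2; side.
- by subst w; constructor 1; side.
by hp2 sp hr hw kl; apply: (ty_um (x0 := - c) (y0 := w')); side.
Qed.

(** By [centre_add] both [D0] terms can be taken at the common symplectic pair (t, c + r + t'),
    where F is linear. *)
Lemma centre_diff j k c c' r r' : j != i -> k != i -> j != k ->
  hp p j c c' -> hp p k r r' -> sform c w = 0 -> sform r w = 0 ->
  E (c' - r') w t (c + r) = D0 c c' t t' w - D0 r r' t t' w.
Proof.
move=> ji ki jk hc hr cw rw.
have tc := centre_ty jk hc hr cw rw.
have [_ e1] := centre_add ji ki jk hc hr cw rw.
have kj : k != j by rewrite eq_sym.
have [_ e2] := centre_add ki ji kj hr hc rw cw.
frame2 sp hr ht ki; hp1 sp hc; hp2 sp hc hr jk; hp2 sp hc ht ji; hp1 sp hw; hp2 sp ht hw nil.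
have tm := tame_ty hg pF tc.
have u : um t (c + r + t') by side.
have e3 : F t (c + r + t') (c' - r') w = E (c' - r') w t (c + r + t').
  by rewrite (EF tm u) //; side.
have e4 : E (c' - r') w t t' = 0.
  have u' : um t t' by side.
  have pe : perp (c' - r') w t t' by side.
  rewrite -(EF tm u'); last exact: perpC.
  by apply: (base_um' hg pF sp bp ht).
rewrite -e1 -e2 (addrC r c) -[RHS]/(_ - _).
have h := F_alt pF u.
have -> : F t (c + r + t') (c' + t) w - F t (c + r + t') (r' + t) w
  = F t (c + r + t') (c' - r') w by rewrite !(altE h); lmod.
by rewrite e3 !(altDr (E_alt tm)) e4 addr0.
Qed.

(** The left side of [centre_diff] does not change when c and r both change sign. With X, Y the
    values for c, -c and U, V those for r, -r, this gives X - U = Y - V and X - V = Y - U, hence 2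
    (X - Y) = 0. *)
Lemma centre_sign j c c' : j != i -> hp p j c c' -> sform c w = 0 ->
  D0 c c' t t' w = D0 (- c) (- c') t t' w.
Proof.
move=> ji hc cw; have [k [ki kj kl]] := fourth_ord hg i j l.
have jk : j != k by rewrite eq_sym.
have hr := hp0 p k; set r := (p k).1 in hr *; set r' := (p k).2 in hr *.
have [rw _ _ _] := hp_diff sp hr hw kl.
have hc2 := hp_neg hc; have hr2 := hp_neg hr.
have cw2 : sform (- c) w = 0 by sfc.
have rw2 : sform (- r) w = 0 by sfc.
have e1 := centre_diff ji ki jk hc hr cw rw.
have e2 := centre_diff ji ki jk hc2 hr2 cw2 rw2.
have e3 := centre_diff ji ki jk hc hr2 cw rw2.
have e4 := centre_diff ji ki jk hc2 hr cw2 rw.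
have sg s s' : hp p k s s' -> sform s w = 0 ->
    E (- c' - - s') w t (- c + - s) = E (c' - s') w t (c + s).
  move=> hs sw; have tc := centre_ty jk hc hs cw sw.
  frame2 sp hc hs jk; hp2 sp hs ht ki; hp2 sp hc ht ji; hp2 sp ht hw nil.
  have h := E_alt (tame_ty hg pF tc).
  have -> : - c' - - s' = - (c' - s') by lmod.
  rewrite (ENl hg pF tc); first by rewrite !(altE h); lmod.
  by side.
have s1 := sg _ _ hr rw; have s2 := sg _ _ hr2 rw2.
rewrite !opprK in e3 e4 s2.
rewrite e1 e2 in s1; rewrite e3 e4 in s2.
set X := D0 c _ _ _ _ in s1 s2 *; set Y := D0 (- c) _ _ _ _ in s1 s2 *.
set U := D0 r _ _ _ _ in s1 s2; set V := D0 (- r) _ _ _ _ in s1 s2.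
apply/eqP; rewrite -subr_eq0; apply/eqP; apply: lmod_half.
have -> : X - Y + (X - Y) = (X - U - (Y - V)) + (X - V - (Y - U)) by lmod.
by rewrite s1 s2 !subrr addr0.
Qed.

Lemma centre0_dir j c c' : DD F p i t t' w -> j != i -> hp p j c c' ->
  sform c w = 0 -> D0 c c' t t' w = 0.
Proof.
move=> dd ji hc cw; have e := centre_sign ji hc cw.
by case: (dd j c c' ji hc cw); rewrite /D0 -/(D0 _ _ _ _ _) // -e.
Qed.

End Pair.

(** For c = w the element is symmetric under exchanging (t, t') with (w, w'), so either alternative
    of [base_D] will do. *)
Lemma centre0_same i l t t' w w' : i != l -> hp p i t t' -> hp p l w w' ->
  D0 w w' t t' w = 0.
Proof.
move=> nil ht hw; have nli : l != i by rewrite eq_sym.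
case: (base_D bp nil ht hw) => dd.
  by apply: (centre0_dir nil ht hw dd nli hw); apply: sformxx.
have e := centre0_dir nli hw ht dd nil ht (sformxx t).
frame2 sp ht hw nil; rewrite /D0 in e *.
have u1 : um t (w + t') by side.
have u2 : um w (t + w') by side.
rewrite (altC (F_alt pF u1)) (addrC w') -(F_sym pF u2 u1); last by side.
by rewrite (altC (F_alt pF u2)) opprK (addrC w t') e.
Qed.

Lemma centre0 i l j t t' w w' c c' : i != l -> hp p i t t' -> hp p l w w' ->
  j != i -> hp p j c c' -> sform c w = 0 -> D0 c c' t t' w = 0.
Proof.
move=> nil ht hw ji hc cw; have nli : l != i by rewrite eq_sym.
have [jl|[e|e]] := hp_ortho hc cw hw; last first.
- rewrite (centre_sign nil ht hw ji hc cw); subst w.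
  have [el|nlj] := eqVneq l j; last first.
    by exfalso; have [_ + _ _] := hp_diff sp hw hc nlj; rewrite sformNl (hp_sform sp hc); lra.
  subst l; have hc2 := hp_neg hc.
  exact: (centre0_same nil ht hc2).
- subst w; have [el|nlj] := eqVneq l j; last first.
    by exfalso; have [_ + _ _] := hp_diff sp hw hc nlj; rewrite (hp_sform sp hc); lra.
  subst l; exact: (centre0_same nil ht hc).
case: (base_D bp nil ht hw) => dd.
  exact: (centre0_dir nil ht hw dd ji hc cw).
have hc2 := hp_rot hc; have ij : i != j by rewrite eq_sym.
frame2 sp ht hc ij; frame2 sp ht hw nil; hp2 sp hw hc (introN eqP (fun e => elimN eqP jl (esym e))).
have ct : sform c' t = 0 by sfc.
(* Here [base_D] holds for the exchanged roles. Centred at (w, w') and applied to the planes of t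
   and of c, [centre_diff] equates the wanted value with a difference of two known zeros. *)
have e := centre_diff nli hw ht nil jl ij ht hc2 (sformxx t) ct.
rewrite (centre0_dir nli hw ht dd nil ht (sformxx t)) in e.
rewrite (centre0_dir nli hw ht dd jl hc2 ct) subrr opprK in e.
have u1 : um t (t' + c) by side.
have t1 : ty t (t' + c) by constructor 1.
have pe : perp w (t + c') t (t' + c) by side.
move: e; rewrite (EC hg pF t1 pe) (E_um pF u1 pe) /D0 (addrC c) (addrC c').
by rewrite (altC (F_alt pF u1)) opprK.
Qed.

Lemma centre_diff0 i l j k t t' w w' c c' r r' : i != l -> hp p i t t' ->
  hp p l w w' -> j != i -> k != i -> j != k -> hp p j c c' -> hp p k r r' ->
  sform c w = 0 -> sform r w = 0 -> E (c' - r') w t (c + r) = 0.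
Proof.
move=> nil ht hw ji ki jk hc hr cw rw.
rewrite (centre_diff nil ht hw ji ki jk hc hr cw rw).
by rewrite (centre0 nil ht hw ji hc cw) (centre0 nil ht hw ki hr rw) subrr.
Qed.

End Centres.

(** * Products of two bivectors with a common vector *)

Section Quad.
Variables (g : nat) (hg : (4 <= g)%N) (M : lmodType rat).
Variable F : H g -> H g -> H g -> H g -> M.
Hypothesis pF : pform F.
Implicit Types (x y z w u v a b c d r s t : H g).
Local Notation E := (E F).
Variable p : 'I_g -> H g * H g.
Hypothesis sp : symp p.

(* Both sides are obtained by pairing with v = c + c' + r. *)
Lemma quad_split j k a a0 b b0 c c' r r' : j != k -> hp p j c c' -> hp p k r r' ->
  um a a0 -> um b b0 -> sform a b = 0 -> perp a a0 c c' -> perp a a0 r r' ->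
  perp b b0 c c' -> perp b b0 r r' -> null F c b -> null F c' b -> null F r b ->
  E (c + c') a (c + c') b = E (c' - r') a (c + r) b + E (c + r') a (c' + r) b.
Proof.
move=> jk hc hr [? ? ?] [? ? ?] ? [? ? ? ?] [? ? ? ?] [? ? ? ?] [? ? ? ?] nc nc' nr.
frame2 sp hc hr jk; pose v := c + c' + r.
have t1 : ty (c' - r') a by apply: (ty_um (x0 := r) (y0 := a0)); side.
have t2 : ty (c + r') a by apply: (ty_um (x0 := - r) (y0 := a0)); side.
have t3 : ty (c + c') a by apply: (ty_um (x0 := c') (y0 := a0)); side.
have t4 : ty (c + c' + r) b by apply: (ty_um (x0 := c') (y0 := b0)); side.
have e1 : E (c' - r') a (c + c' + r) b = E (c + c' + r) b (c' - r') a.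
  by apply: (sym4 hg pF (x0 := r) (y0 := a0) (z0 := c') (w0 := b0)); side.
have e2 : E (c' - r') a c' b = 0.
  rewrite (sym4 hg pF (x0 := r) (y0 := a0) (z0 := - c - r) (w0 := b0)); try by side.
  by apply: nc'; side.
have e3 : E (c + r') a c b = 0.
  rewrite (sym4 hg pF (x0 := - r) (y0 := a0) (z0 := c' + r) (w0 := b0)); try by side.
  by apply: nc; side.
have e4 : E (c + r') a (c + c' + r) b = E (c + c' + r) b (c + r') a.
  by apply: (sym4 hg pF (x0 := - r) (y0 := a0) (z0 := - c) (w0 := b0)); side.
have e5 : E (c + c' + r) b (c + c') a = E (c + c') a (c + c' + r) b.
  by apply: (sym4 hg pF (x0 := r') (y0 := b0) (z0 := c' - r') (w0 := a0)); side.
have e6 : E (c + c') a r b = 0.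
  rewrite (sym4 hg pF (x0 := c') (y0 := a0) (z0 := r') (w0 := b0)); try by side.
  by apply: nr; side.
have h1 := E_alt (tame_ty hg pF t1); have h2 := E_alt (tame_ty hg pF t2).
have h3 := E_alt (tame_ty hg pF t3); have h4 := E_alt (tame_ty hg pF t4).
have f1 : E (c' - r') a (c + c' + r) b = E (c' - r') a (c + r) b.
  by rewrite !(altDl h1) e2; lmod.
have f2 : E (c + r') a (c + c' + r) b = E (c + r') a (c' + r) b.
  by rewrite !(altDl h2) e3; lmod.
have f3 : E (c + c') a (c + c' + r) b = E (c + c') a (c + c') b.
  by rewrite (altDl h3) e6 addr0.
by rewrite -f3 -e5 -f1 -f2 e1 e4 !(altE h4); lmod.
Qed.

Section Square.
Hypothesis bp : base F p.
Variables (i : 'I_g) (t t' : H g).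
Hypothesis ht : hp p i t t'.

Let D c c' r r' := E (c' - r') t (c + r) t.
Let q c c' := E (c + c') t (c + c') t.

Let ntl j c c' : j != i -> hp p j c c' -> null F c t.
Proof. by move=> ji hc; apply: (base_null bp ji hc ht). Qed.

Section Two.
Variables (j k : 'I_g) (c c' r r' : H g).
Hypotheses (ji : j != i) (ki : k != i) (jk : j != k).
Hypotheses (hc : hp p j c c') (hr : hp p k r r').

Let tyd : ty (c' - r') t.
Proof.
frame2 sp hc hr jk; frame2 sp hc ht ji; hp2 sp hr ht ki.
by apply: (ty_um (x0 := r) (y0 := t')); side.
Qed.

Lemma sq_anti : D r r' c c' = - D c c' r r'.
Proof.
frame2 sp hc hr jk; frame2 sp hc ht ji; hp2 sp hr ht ki.
rewrite /D -(ENl hg pF tyd) ?(addrC r) ?opprB //; side.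
Qed.

Lemma sq_neg : D (- c) (- c') (- r) (- r') = D c c' r r'.
Proof.
frame2 sp hc hr jk; frame2 sp hc ht ji; hp2 sp hr ht ki.
have h := E_alt (tame_ty hg pF tyd).
rewrite /D -opprB opprK addrC (ENl hg pF tyd); last by side.
by rewrite !(altE h); lmod.
Qed.

Lemma sq_rot : D c' (- c) r' (- r) = - D c c' (- r) (- r').
Proof.
frame2 sp hc hr jk; frame2 sp hc ht ji; hp2 sp hr ht ki.
have t2 : ty (c - r) t by apply: (ty_um (x0 := c') (y0 := t')); side.
rewrite /D !opprK; have -> : - c + r = - (c - r) by lmod.
rewrite (ENl hg pF t2); last by side.
congr (- _); apply: (sym4 hg pF (x0 := - r') (y0 := t') (z0 := - c) (w0 := t')); side.
Qed.

Lemma sq_split : q c c' = D c c' r r' + D c c' r' (- r).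
Proof.
frame2 sp hc hr jk; frame2 sp hc ht ji; hp2 sp hr ht ki.
rewrite /q /D opprK (quad_split (a0 := t') (b0 := t') jk hc hr); try by side.
- congr (_ + _).
  by apply: (sym4 hg pF (x0 := - r) (y0 := t') (z0 := - c) (w0 := t')); side.
- exact: ntl hc.
- exact: ntl (hp_rot hc).
- exact: ntl hr.
Qed.

(** The pair (s, t) is null, so s may be added to c + r; the resulting factor is symmetric in the
    three planes. *)
Lemma sq_third m s s' : m != i -> m != j -> m != k -> hp p m s s' ->
  D c c' r r' = E (c + r + s) t (c' - r') t.
Proof.
move=> mi mj mk hs; frame2 sp hc hr jk; frame2 sp hc ht ji; hp2 sp hr ht ki.
frame2 sp hs ht mi; hp2 sp hs hc mj; hp2 sp hs hr mk.
have e0 : E (c' - r') t s t = 0.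
  rewrite (sym4 hg pF (x0 := - c) (y0 := t') (z0 := s') (w0 := t')); try by side.
  by apply: (ntl mi hs); side.
have e1 : E (c' - r') t (c + r + s) t = E (c + r + s) t (c' - r') t.
  by apply: (sym4 hg pF (x0 := - c) (y0 := t') (z0 := s') (w0 := t')); side.
by rewrite -e1 (altDl (E_alt (tame_ty hg pF tyd)) (c + r)) e0 addr0.
Qed.

End Two.
(** By [sq_third] the three terms share the factor c + r + s, and c' - r', r' - s', s' - c' add up
    to 0. *)
Lemma sq_cycle j k m c c' r r' s s' : j != i -> k != i -> m != i ->
  j != k -> m != j -> m != k -> hp p j c c' -> hp p k r r' -> hp p m s s' ->
  D c c' r r' + D r r' s s' + D s s' c c' = 0.
Proof.
move=> ji ki mi jk mj mk hc hr hs.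
have km : k != m by rewrite eq_sym.
have jm : j != m by rewrite eq_sym.
have kj : k != j by rewrite eq_sym.
rewrite (sq_third ji ki jk hc hr mi mj mk hs) (sq_third ki mi km hr hs ji jk jm hc).
rewrite (sq_third mi ji mj hs hc ki km kj hr).
have -> : r + s + c = c + r + s by lmod.
have -> : s + c + r = c + r + s by lmod.
frame2 sp hc hr jk; frame2 sp hc ht ji; frame2 sp hr ht ki; frame2 sp hs ht mi.
hp2 sp hs hc mj; hp2 sp hs hr mk.
have tv : ty (c + r + s) t by apply: (ty_um (x0 := c') (y0 := t')); side.
by rewrite !(altE (E_alt (tame_ty hg pF tv))); lmod.
Qed.

Let del c c' r r' := D c c' r r' - D c c' (- r) (- r').

Let del_anti j k c c' r r' : j != i -> k != i -> j != k -> hp p j c c' ->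
  hp p k r r' -> del r r' c c' = - del c c' r r'.
Proof.
move=> ji ki jk hc hr; have hcN := hp_neg hc; have hrN := hp_neg hr.
rewrite /del (sq_anti ji ki jk hc hr) (sq_anti ji ki jk hcN hr).
by rewrite -(sq_neg ji ki jk hc hrN) !opprK; lmod.
Qed.

(** The cycle relation for c minus the one for -c, combined with [del_anti]. *)
Let del_third j k m c c' r r' s s' : j != i -> k != i -> m != i ->
  j != k -> m != j -> m != k -> hp p j c c' -> hp p k r r' -> hp p m s s' ->
  del c c' r r' = del c c' s s'.
Proof.
move=> ji ki mi jk mj mk hc hr hs; have hcN := hp_neg hc; have hrN := hp_neg hr.
have jm : j != m by rewrite eq_sym.
have c1 := sq_cycle ji ki mi jk mj mk hc hr hs.
have c2 := sq_cycle ji ki mi jk mj mk hcN hr hs.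
rewrite -(sq_neg ji ki jk hcN hr) opprK opprK in c2.
rewrite -[RHS]opprK -(del_anti ji mi jm hc hs) /del.
rewrite -[LHS]addr0 -[RHS]addr0 -[in LHS]c2 -[in RHS]c1.
by lmod.
Qed.

(** [del] is antisymmetric and independent of the plane of its second argument, so going once around
    three planes shows that it equals its own negative. *)
Lemma sq_sign j k c c' r r' : j != i -> k != i -> j != k -> hp p j c c' ->
  hp p k r r' -> D c c' (- r) (- r') = D c c' r r'.
Proof.
move=> ji ki jk hc hr; have [m [mi mj mk]] := fourth_ord hg i j k.
have hs := hp0 p m; set s := (p m).1 in hs; set s' := (p m).2 in hs.
have kj : k != j by rewrite eq_sym.
have km : k != m by rewrite eq_sym.
have jm : j != m by rewrite eq_sym.
have d1 := del_third ji ki mi jk mj mk hc hr hs.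
have d2 := del_anti ji mi jm hc hs.
have d3 := del_third mi ji ki mj km kj hs hc hr.
have d4 := del_anti mi ki mk hs hr.
have d5 := del_third ki mi ji km jk jm hr hs hc.
have d6 := del_anti ji ki jk hc hr.
have e : del c c' r r' + del c c' r r' = 0.
  rewrite {1}d1 -[del c c' s s']opprK -d2 d3 -d4 d5 d6; lmod.
by apply/esym/eqP; rewrite -subr_eq0; apply/eqP; apply: lmod_half.
Qed.

Let rot1 j k c c' r r' : j != i -> k != i -> j != k -> hp p j c c' ->
  hp p k r r' -> D c' (- c) r r' = - D c c' r' (- r).
Proof.
move=> ji ki jk hc hr; have := sq_rot ji ki jk hc (hp_rot hr).
rewrite (sq_sign ji ki jk hc (hp_rot hr)) => <-.
by rewrite (sq_sign ji ki jk (hp_rot hc) hr).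
Qed.

(** Rotating the splitting of q gives q(c', -c) = - q(c, c'), so the single sign granted by [base_N]
    yields q = 0. Splitting q on either plane then gives A + B = 0 and B - A = 0 for the two D
    terms. *)
Lemma square0 j k c c' r r' : j != i -> k != i -> j != k -> hp p j c c' ->
  hp p k r r' -> D c c' r r' = 0 /\ q c c' = 0.
Proof.
move=> ji ki jk hc hr.
have q0 l m x x' y y' : l != i -> m != i -> l != m -> hp p l x x' -> hp p m y y' ->
    q x x' = 0.
  move=> li mi lm hx hy; have hx' := hp_rot hx; have hy' := hp_rot hy.
  have s1 := sq_split li mi lm hx hy; have s2 := sq_split li mi lm hx' hy.
  have e1 := rot1 li mi lm hx hy; have e2 := rot1 li mi lm hx hy'.
  rewrite e1 e2 (sq_sign li mi lm hx hy) -opprD addrC -s1 in s2.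
  have il : i != l by rewrite eq_sym.
  frame2 sp hx ht li.
  have t1 : ty (x + x') t by apply: (ty_um (x0 := x') (y0 := t')); side.
  have t2 : ty (x' - x) t by apply: (ty_um (x0 := - x) (y0 := t')); side.
  have [e|e] := base_N bp il ht hx.
    rewrite /q -e (EC hg pF (z := x + x') (w := t)) //; last by side.
    by rewrite (altC (E_alt (tame_ty hg pF t1)) t) opprK.
  rewrite -[q x x']opprK -s2 /q; apply/eqP; rewrite oppr_eq0; apply/eqP.
  rewrite -e (EC hg pF (z := x - x') (w := t)); last by side.
    have -> : x - x' = - (x' - x) by lmod.
    rewrite (ENl hg pF t2); last by side.
    have h := E_alt (tame_ty hg pF t2); rewrite (altC h t) (altNl h); lmod.
  by apply: (ty_um (x0 := x') (y0 := t')); side.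
split; last exact: q0 jk hc hr.
have kj : k != j by rewrite eq_sym.
have s1 := sq_split ji ki jk hc hr; have s2 := sq_split ki ji kj hr hc.
rewrite (q0 _ _ _ _ _ _ ji ki jk hc hr) in s1.
rewrite (q0 _ _ _ _ _ _ ki ji kj hr hc) in s2.
rewrite (sq_anti ji ki jk hc hr) (sq_anti ji ki jk (hp_rot hc) hr) in s2.
rewrite (rot1 ji ki jk hc hr) opprK in s2.
apply: lmod_half; set A := D c c' r r' in s1 s2 *; set B := D _ _ _ _ in s1 s2.
have -> : A + A = A + B - (- A + B) by lmod.
by rewrite -s1 -s2 subrr.
Qed.

End Square.
End Quad.

(** Replaces the product [sform v r] by an opaque integral coefficient that [sfc] and [intg] can
    use. *)
Ltac name_form v r a :=
  let e := fresh "enf" in let h := fresh "hnf" in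
  (have h : sform v r \is a Num.int by intg);
  let k := fresh "k" in
  assert (k : exists a0, sform v r = a0) by (eexists; reflexivity);
  destruct k as [a e]; rewrite e in h; rewrite ?e.

Lemma int_rat_ind (P : rat -> Prop) : P 0 ->
  (forall m, m \is a Num.int -> P m <-> P (m + 1)) ->
  forall m, m \is a Num.int -> P m.
Proof.
move=> P0 PS m /intrP[k ->]; elim: k => [//|k IH|k IH].
  have -> : (Posz k.+1)%:~R = (Posz k)%:~R + 1 :> rat by rewrite -addn1 PoszD intrD.
  by apply: (proj1 (PS _ _)) => //; apply: intr_int.
have e : (- Posz k)%:~R = (- Posz k.+1)%:~R + 1 :> rat.
  by rewrite -addn1 PoszD opprD intrD -addrA; lra.
by apply: (proj2 (PS _ _)); [apply: intr_int | rewrite -e].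
Qed.

(** * Generators containing a vector of a basis with [base] *)

Section Vee.
Variables (g : nat) (hg : (4 <= g)%N) (M : lmodType rat).
Variable F : H g -> H g -> H g -> H g -> M.
Hypothesis pF : pform F.
Implicit Types (x y z w u v r s t e : H g).
Local Notation E := (E F).
Variable p : 'I_g -> H g * H g.
Hypothesis sp : symp p.
Hypothesis bp : base F p.
Variables (i : 'I_g) (x x' : H g).
Hypothesis hx : hp p i x x'.

(** After exchanging the factors this is a value of [E x e], and distinct planes give null pairs by
    [base_iso]. *)
Lemma shift_basis j k m r r' s s' e e' v : j != i -> k != i -> m != i ->
  j != k -> m != j -> hp p j r r' -> hp p k s s' -> hp p m e e' -> um x v ->
  sform e s = 0 -> E (r + sform v r *: x) (s + sform v s *: x) x e = 0.
Proof.
move=> ji ki mi jk mj hr hs he uv es; have [? ? ?] := uv.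
frame2 sp hr hs jk; frame2 sp hr hx ji; frame2 sp he hx mi; hp2 sp hs hx ki.
hp2 sp he hr mj.
name_form v r a; name_form v r' a'; name_form v s b; name_form v s' b'.
rewrite (sym4 hg pF (x0 := r' + a' *: x) (y0 := s' + b' *: x) (z0 := v) (w0 := e')) //;
  try by side.
by apply: (base_null bp _ hx he); [rewrite eq_sym | side].
Qed.

(* thV v r is orthogonal to x and v when v is a dual of x. *)
Definition thV v r : H g := r + sform v r *: x.
Definition fV r r' s s' (m n : rat) : M :=
  F x (x' - m *: r' - n *: s') (r + m *: x) (s + n *: x).

Section ShiftPair.
Variables (j k : 'I_g) (r r' s s' : H g).
Hypotheses (ji : j != i) (ki : k != i) (jk : j != k).
Hypotheses (hr : hp p j r r') (hs : hp p k s s').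

Local Notation th := thV.

Lemma th_ty v : um x v -> ty (th v r) (th v s) /\ perp x v (th v r) (th v s).
Proof.
move=> uv; have [? ? ?] := uv; rewrite /thV.
frame2 sp hr hs jk; hp2 sp hr hx ji; hp2 sp hs hx ki.
name_form v r a; name_form v r' a'; name_form v s b; name_form v s' b'.
split; last by side.
by apply: (ty_um (x0 := r' + a' *: x) (y0 := s' + b' *: x)); side.
Qed.

(** The difference is [E (th v r) (th v s) x t]. Each basis vector occurring in t is orthogonal to r
    and s, so [shift_basis] applies, with r and s exchanged if the vector lies in the plane of r. *)
Lemma shift v t : um x v -> integral t -> sform x t = 0 -> sform t r = 0 ->
  sform t s = 0 -> F x (v + t) (th v r) (th v s) = F x v (th v r) (th v s).
Proof.
move=> uv it xt tr ts; have [? ? ?] := uv.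
have [tt pe] := th_ty uv; have tm := tame_ty hg pF tt; have h := E_alt tm.
have u2 : um x (v + t) by side.
have pe2 : perp x (v + t) (th v r) (th v s).
  by move: pe; rewrite /thV => -[? ? ? ?]; hp1 sp hx; hp2 sp hr hx ji; hp2 sp hs hx ki; side.
rewrite (EF tm u2 pe2) (EF tm uv pe) (altDr h) -[RHS]addr0; congr (_ + _).
have tx : sform t x = 0 by sfc.
apply: (@hp_expand0 _ _ sp _ (E (th v r) (th v s) x) t (alt_linr h x)) => m e e' he ne.
have [em|mi] := eqVneq m i.
  subst m; have := hp_line sp hx he (hp_coef sp hx he tx ne).
  by case=> ->; rewrite ?(altNr h) (altxx h) ?oppr0.
have es : sform e s = 0.
  have [em|mk] := eqVneq m k; first by subst m; exact: (hp_coef sp hs he ts ne).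
  by hp2 sp he hs mk.
have er : sform e r = 0.
  have [em|mj] := eqVneq m j; first by subst m; exact: (hp_coef sp hr he tr ne).
  by hp2 sp he hr mj.
have [em|mj] := eqVneq m j; last exact: (shift_basis ji ki mi jk mj hr hs he uv es).
have mk : m != k by rewrite em.
have kj : k != j by rewrite eq_sym.
have [tt' _] : ty (th v s) (th v r) /\ True.
  by split=> //; case: tt => [?|?|[zs [ws hi]]]; [constructor 2|constructor 1|constructor 3;
    exists ws, zs; exact: isoC].
rewrite (EC hg pF tt').
  by rewrite (shift_basis ki ji mi kj mk hs hr he uv er) oppr0.
by hp2 sp he hx mi; hp2 sp hr hx ji; hp2 sp hs hx ki; rewrite /thV; side.
Qed.

Lemma th_F v : um x v -> F x v (th v r) (th v s) = fV r r' s s' (sform v r) (sform v s).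
Proof.
move=> uv; have [? ? ?] := uv.
hp1 sp hx; frame2 sp hr hs jk; hp2 sp hr hx ji; hp2 sp hs hx ki.
rewrite /thV /fV; name_form v r a; name_form v s b.
pose t := v - (x' - a *: r' - b *: s').
have -> : v = (x' - a *: r' - b *: s') + t by rewrite /t; lmod.
have u0 : um x (x' - a *: r' - b *: s') by side.
have et : F x (x' - a *: r' - b *: s' + t) (th (x' - a *: r' - b *: s') r) (th (x' - a *: r' - b *: s') s) =
    F x (x' - a *: r' - b *: s') (th (x' - a *: r' - b *: s') r) (th (x' - a *: r' - b *: s') s).
  by apply: shift => //; rewrite /t; side.
have er : sform (x' - a *: r' - b *: s') r = a by sfc.
have es : sform (x' - a *: r' - b *: s') s = b by sfc.
by move: et; rewrite /thV er es.
Qed.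

End ShiftPair.

Lemma fV00 j k r r' s s' : j != i -> k != i -> hp p j r r' -> hp p k s s' ->
  fV r r' s s' 0 0 = 0.
Proof.
move=> ji ki hr hs; rewrite /fV !scale0r !subr0 !addr0.
by apply: (base_um' hg pF sp bp hx); hp2 sp hr hx ji; hp2 sp hs hx ki; side.
Qed.

Lemma fV10 j k r r' s s' : j != i -> k != i -> j != k -> hp p j r r' ->
  hp p k s s' -> fV r r' s s' 1 0 = 0.
Proof.
move=> ji ki jk hr hs; have hr2 := hp_rotV hr.
rewrite /fV !scale0r !scale1r !subr0 !addr0 (addrC x').
have ik : i != k by rewrite eq_sym.
by apply: (centre0 hg pF sp bp ik hx hs ji hr2); hp2 sp hr hs jk; side.
Qed.

Lemma fV_anti j k r r' s s' m n : j != i -> k != i -> j != k -> hp p j r r' ->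
  hp p k s s' -> m \is a Num.int -> n \is a Num.int ->
  fV s s' r r' n m = - fV r r' s s' m n.
Proof.
move=> ji ki jk hr hs im i_n; rewrite /fV addrAC -(altC (F_alt pF _)) //.
by frame2 sp hr hx ji; frame2 sp hs hx ki; side.
Qed.

(** Adding r2' - r1' to the partner v changes (m1, m2) into (m1 + 1, m2 - 1) and keeps r1 + r2 + (m1
    + m2) x. The discrepancy splits into terms killed by [centre_diff0], [square0] and
    [base_iso]. *)
Lemma fV_step j1 j2 k r1 r1' r2 r2' s s' m1 m2 n : j1 != i -> j2 != i -> k != i ->
  j1 != j2 -> j1 != k -> j2 != k -> hp p j1 r1 r1' -> hp p j2 r2 r2' ->
  hp p k s s' -> m1 \is a Num.int -> m2 \is a Num.int -> n \is a Num.int ->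
  fV r1 r1' s s' (m1 + 1) n + fV r2 r2' s s' (m2 - 1) n =
  fV r1 r1' s s' m1 n + fV r2 r2' s s' m2 n.
Proof.
move=> ji1 ji2 ki j12 jk1 jk2 h1 h2 hs i1 i2 i_n.
frame2 sp h1 h2 j12; frame2 sp hs hx ki; hp2 sp h1 hx ji1; hp2 sp h2 hx ji2.
hp2 sp h1 hs jk1; hp2 sp h2 hs jk2.
have [v ev] : exists v, v = x' - m1 *: r1' - m2 *: r2' - n *: s' by eexists.
have uv : um x v by rewrite ev; side.
have [t et] : exists t, t = r2' - r1' by eexists.
have uvt : um x (v + t) by rewrite ev et; side.
have a1 : sform v r1 = m1 by rewrite ev; sfc.
have a2 : sform v r2 = m2 by rewrite ev; sfc.
have a3 : sform v s = n by rewrite ev; sfc.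
have b1 : sform (v + t) r1 = m1 + 1 by rewrite ev et; sfc.
have b2 : sform (v + t) r2 = m2 - 1 by rewrite ev et; sfc.
have b3 : sform (v + t) s = n by rewrite ev et; sfc.
have f1 := th_F ji1 ki jk1 h1 hs uv; rewrite a1 a3 in f1.
have f2 := th_F ji2 ki jk2 h2 hs uv; rewrite a2 a3 in f2.
have f3 := th_F ji1 ki jk1 h1 hs uvt; rewrite b1 b3 in f3.
have f4 := th_F ji2 ki jk2 h2 hs uvt; rewrite b2 b3 in f4.
rewrite -f1 -f2 -f3 -f4 /thV a1 a2 a3 b1 b2 b3.
have hF := F_alt pF uv; have hF' := F_alt pF uvt.
rewrite -(altDl hF) -(altDl hF').
have -> : r1 + (m1 + 1) *: x + (r2 + (m2 - 1) *: x) = r1 + r2 + (m1 + m2) *: x by lmod.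
have -> : r1 + m1 *: x + (r2 + m2 *: x) = r1 + r2 + (m1 + m2) *: x by lmod.
have [? ? ?] := uv; have [_ ? _] := uvt.
have tP : ty (r1 + r2 + (m1 + m2) *: x) (s + n *: x).
  by apply: (ty_um (x0 := r1') (y0 := s')); side.
have tm := tame_ty hg pF tP; have h := E_alt tm.
rewrite (EF tm uvt); last by rewrite ?et; side.
rewrite (EF tm uv); last by side.
rewrite (altDr h) -[RHS]addr0; congr (_ + _).
name_form v r1' a1'; name_form v s' b1'.
have xt : ty x t by apply: (ty_um (x0 := x') (y0 := r1)); rewrite ?et; side.
have tx : ty t x by apply: (ty_um (x0 := r1) (y0 := x')); rewrite ?et; side.
rewrite (sym4 hg pF (x0 := r1' + a1' *: x) (y0 := s' + b1' *: x) (z0 := v) (w0 := r1));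
  try by rewrite ?et; side.
have h' := E_alt (tame_ty hg pF xt); have h2' := E_alt (tame_ty hg pF tx).
have ik : i != k by rewrite eq_sym.
have e1 : E x t (r1 + r2) s = 0.
  rewrite (EC hg pF tx); last by rewrite ?et; side.
  rewrite (altC h2') opprK et (addrC r1).
  have j21 : j2 != j1 by rewrite eq_sym.
  by apply: (centre_diff0 hg pF sp bp ki hs hx jk2 jk1 j21 h2 h1); sfc.
have e2 : E x t (r1 + r2) x = 0.
  rewrite (EC hg pF tx); last by rewrite ?et; side.
  have j21 : j2 != j1 by rewrite eq_sym.
  by have [+ _] := square0 hg pF sp bp hx ji2 ji1 j21 h2 h1; rewrite et (addrC r1) => ->; rewrite oppr0.
have e3 : E x t x s = 0.
  rewrite (EC hg pF tx); last by rewrite ?et; side.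
  rewrite (altC h2') opprK.
  rewrite (sym4 hg pF (x0 := r1) (y0 := x') (z0 := s') (w0 := x')); try by rewrite ?et; side.
  by apply: (base_null bp ki hs hx); rewrite ?et; side.
move: e1 e2; move: (r1 + r2) => P e1 e2.
by rewrite !(altDl h') !(altDr h') !(altZl h') !(altZr h') e1 e2 e3 (altxx h'); lmod.
Qed.

Let i1 : (1 : rat) \is a Num.int. Proof. exact: rpred1. Qed.
Let i0 : (0 : rat) \is a Num.int. Proof. exact: rpred0. Qed.

(** By [fV_step] an increment of m on plane j is matched by the fixed decrement from 1 to 0 on
    another plane, so it does not depend on m. *)
Lemma fV_lin j k r r' s s' m n : j != i -> k != i -> j != k -> hp p j r r' ->
  hp p k s s' -> m \is a Num.int -> n \is a Num.int ->
  fV r r' s s' m n =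
  fV r r' s s' 0 n + m *: (fV r r' s s' 1 n - fV r r' s s' 0 n).
Proof.
move=> ji ki jk hr hs + i_n; have [l [li lj lk]] := fourth_ord hg i j k.
have hl := hp0 p l; set a := (p l).1 in hl; set a' := (p l).2 in hl.
have jl : j != l by rewrite eq_sym.
have st m1 : m1 \is a Num.int -> fV r r' s s' (m1 + 1) n - fV r r' s s' m1 n =
    fV a a' s s' 1 n - fV a a' s s' 0 n.
  move=> im1; have := fV_step ji li ki jl jk lk hr hl hs im1 i1 i_n.
  have -> : 1 - 1 = 0 :> rat by rewrite subrr.
  by move=> /(canRL (addrK _)) ->; lmod.
have s0 := st 0 i0; rewrite add0r in s0.
have {}st m1 : m1 \is a Num.int -> fV r r' s s' (m1 + 1) n =
    fV r r' s s' m1 n + (fV r r' s s' 1 n - fV r r' s s' 0 n).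
  by move=> im1; rewrite s0 -(st m1 im1) [RHS]addrC subrK.
move: m; apply: int_rat_ind => [|m1 im1].
  by rewrite scale0r addr0.
rewrite (st _ im1); move: (_ - _) => K.
split=> [->|e]; first by rewrite scalerDl scale1r addrA.
by apply: (addIr K); rewrite e scalerDl scale1r addrA.
Qed.

(** Affinity in each of m and n leaves only the value at (1, 1). It is antisymmetric and, by
    [fV_step], independent of the planes, so a third plane makes it equal to its own negative. *)
Lemma fV0 j k r r' s s' m n : j != i -> k != i -> j != k -> hp p j r r' ->
  hp p k s s' -> m \is a Num.int -> n \is a Num.int -> fV r r' s s' m n = 0.
Proof.
have m0 j1 k1 r1 r1' s1 s1' m1 : j1 != i -> k1 != i -> j1 != k1 ->
    hp p j1 r1 r1' -> hp p k1 s1 s1' -> m1 \is a Num.int ->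
    fV r1 r1' s1 s1' m1 0 = 0.
  move=> ji ki jk hr hs im; rewrite (fV_lin ji ki jk hr hs im i0).
  by rewrite (fV10 ji ki jk hr hs) (fV00 ji ki hr hs) subrr scaler0 addr0.
have on j1 k1 r1 r1' s1 s1' n1 : j1 != i -> k1 != i -> j1 != k1 ->
    hp p j1 r1 r1' -> hp p k1 s1 s1' -> n1 \is a Num.int ->
    fV r1 r1' s1 s1' 0 n1 = 0.
  move=> ji ki jk hr hs i_n; have kj : k1 != j1 by rewrite eq_sym.
  by rewrite (fV_anti ki ji kj hs hr i_n i0) (m0 _ _ _ _ _ _ _ ki ji kj hs hr i_n) oppr0.
have anti j1 k1 r1 r1' s1 s1' : j1 != i -> k1 != i -> j1 != k1 ->
    hp p j1 r1 r1' -> hp p k1 s1 s1' -> fV s1 s1' r1 r1' 1 1 = - fV r1 r1' s1 s1' 1 1.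
  by move=> ji ki jk hr hs; apply: (fV_anti ji ki jk hr hs); exact: i1.
have swap j1 j2 k1 r1 r1' r2 r2' s1 s1' : j1 != i -> j2 != i -> k1 != i ->
    j1 != j2 -> j1 != k1 -> j2 != k1 -> hp p j1 r1 r1' -> hp p j2 r2 r2' ->
    hp p k1 s1 s1' -> fV r1 r1' s1 s1' 1 1 = fV r2 r2' s1 s1' 1 1.
  move=> ji1 ji2 ki j12 jk1 jk2 h1 h2 hs.
  have := fV_step ji1 ji2 ki j12 jk1 jk2 h1 h2 hs i0 i1 i1.
  rewrite add0r subrr (on _ _ _ _ _ _ _ ji1 ki jk1 h1 hs i1).
  by rewrite (on _ _ _ _ _ _ _ ji2 ki jk2 h2 hs i1) addr0 add0r.
move=> ji ki jk hr hs im i_n; have kj : k != j by rewrite eq_sym.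
rewrite (fV_lin ji ki jk hr hs im i_n) (on _ _ _ _ _ _ _ ji ki jk hr hs i_n).
rewrite (fV_anti ki ji kj hs hr i_n i1) (fV_lin ki ji kj hs hr i_n i1).
rewrite (on _ _ _ _ _ _ _ ki ji kj hs hr i1).
suff -> : fV s s' r r' 1 1 = 0 by rewrite !(addr0, subr0, add0r, oppr0, scaler0).
have [l [li lj lk]] := fourth_ord hg i j k.
have hl := hp0 p l; set a := (p l).1 in hl; set a' := (p l).2 in hl.
have jl : j != l by rewrite eq_sym.
have kl : k != l by rewrite eq_sym.
have d1 := swap _ _ _ _ _ _ _ _ _ ki li ji kl kj lj hs hl hr.
have d2 := anti _ _ _ _ _ _ ji li jl hr hl.
have d3 := swap _ _ _ _ _ _ _ _ _ ji ki li jk jl kl hr hs hl.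
have d4 := anti _ _ _ _ _ _ ki li kl hs hl.
have d5 := swap _ _ _ _ _ _ _ _ _ li ji ki lj lk jk hl hr hs.
have d6 := anti _ _ _ _ _ _ ki ji kj hs hr.
apply: lmod_half; rewrite {1}d1 d2 d3.
by rewrite -d4 d5 d6 addNr.
Qed.

(** The counterpart of [fV] for two vectors of the same plane. *)
Definition gV s s' (m n : rat) : M :=
  F x (x' - m *: s' + n *: s) (s + m *: x) (s' + n *: x).

Lemma gV_F k s s' v : k != i -> hp p k s s' -> um x v ->
  F x v (thV v s) (thV v s') = gV s s' (sform v s) (sform v s').
Proof.
move=> ki hs uv; have [? ? ?] := uv; frame2 sp hs hx ki.
rewrite /gV /thV; name_form v s a; name_form v s' b.
have uw : um x (x' - a *: s' + b *: s) by side.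
have uS : um (s + a *: x) (s' + b *: x) by side.
rewrite (F_sym pF uv uS); last by side.
rewrite (F_sym pF uw uS); last by side.
have hF := F_alt pF uS; apply/eqP; rewrite -subr_eq0 -(altBr hF); apply/eqP.
have [t et] : exists t, t = v - (x' - a *: s' + b *: s) by eexists.
rewrite -et; have tx : sform t x = 0 by rewrite et; sfc.
have ts : sform t s = 0 by rewrite et; sfc.
have ts' : sform t s' = 0 by rewrite et; sfc.
apply: (@hp_expand0 _ _ sp _ (F (s + a *: x) (s' + b *: x) x) t (alt_linr hF x)) => m e e' he ne.
have [em|mi] := eqVneq m i.
  subst m; have := hp_line sp hx he (hp_coef sp hx he tx ne).
  by case=> ->; rewrite ?(altNr hF) (altxx hF) ?oppr0.
have im : i != m by rewrite eq_sym.
have [em|mk] := eqVneq m k.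
  subst m; exfalso; have := hp_coef sp hs he ts ne; have := hp_coef sp (hp_rot hs) he ts' ne.
  by move=> e1 e2; case: (hp_line sp hs he e2) e1 => ->; rewrite ?sformNl; lra.
have xe : ty x e by frame2 sp he hx mi; apply: (ty_um (x0 := x') (y0 := e')); side.
frame2 sp he hx mi; hp2 sp he hs mk.
rewrite (EF (tame_ty hg pF xe) uS); last by side.
by apply: (base_null bp im hx he); side.
Qed.

(** Adding r' - s' to the partner raises m by 1. By [fV0] the vector r may be added to s at no cost,
    and on the symplectic pair (r + s + m x, s' + n x) the change of partner involves only products
    already known to vanish. *)
Lemma gV_step j k r r' s s' m n : j != i -> k != i -> j != k -> hp p j r r' ->
  hp p k s s' -> m \is a Num.int -> n \is a Num.int ->
  gV s s' (m + 1) n = gV s s' m n.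
Proof.
move=> ji ki jk hr hs im i_n; have kj : k != j by rewrite eq_sym.
have hs2 := hp_rot hs; have hr2 := hp_neg hr.
frame2 sp hr hs jk; frame2 sp hs hx ki; hp2 sp hr hx ji.
have [v ev] : exists v, v = x' - m *: s' + n *: s by eexists.
have [t et] : exists t, t = r' - s' by eexists.
have uv : um x v by rewrite ev; side.
have uvt : um x (v + t) by rewrite ev et; side.
have a1 : sform v s = m by rewrite ev; sfc.
have a2 : sform v s' = n by rewrite ev; sfc.
have a3 : sform v r = 0 by rewrite ev; sfc.
have b1 : sform (v + t) s = m + 1 by rewrite ev et; sfc.
have b2 : sform (v + t) s' = n by rewrite ev et; sfc.
have b3 : sform (v + t) r = - 1 by rewrite ev et; sfc.
have f1 := gV_F ki hs uv; have f2 := gV_F ki hs uvt.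
have f3 := th_F ji ki jk hr hs2 uv; have f4 := th_F ji ki jk hr hs2 uvt.
rewrite a3 a2 (fV0 ji ki jk hr hs2) // in f3.
rewrite b3 b2 (fV0 ji ki jk hr hs2) ?rpredN // in f4.
rewrite a1 a2 in f1; rewrite b1 b2 in f2; rewrite -f1 -f2.
have hF := F_alt pF uv; have hF' := F_alt pF uvt.
rewrite -[LHS]add0r -[RHS]add0r -{1}f4 -f3 -(altDl hF) -(altDl hF').
rewrite /thV a1 a2 a3 b1 b2 b3.
have -> : r + -1 *: x + (s + (m + 1) *: x) = r + s + m *: x by lmod.
have -> : r + 0 *: x + (s + m *: x) = r + s + m *: x by lmod.
have uP : um (r + s + m *: x) (s' + n *: x) by side.
have [? ? ?] := uv; have [_ ? _] := uvt.
rewrite (F_sym pF uv uP); last by side.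
rewrite (F_sym pF uvt uP); last by rewrite et; side.
have hP := F_alt pF uP; rewrite (altDr hP) -[RHS]addr0; congr (_ + _).
have tx : ty t x by apply: (ty_um (x0 := - r) (y0 := x')); rewrite ?et; side.
have tt := tame_ty hg pF tx; have hE := E_alt tt.
rewrite (altC hP) (EF tt uP); last by rewrite et; side.
have ik : i != k by rewrite eq_sym.
have u0 : um (r + s) s' by side.
have rx : sform (- r) x = 0 by sfc.
have e1 : E t x (r + s) s' = 0.
  have u1 : um s' (- r - s) by side.
  have := centre0 hg pF sp bp ki hs2 hx jk hr2 rx; rewrite /D0 => e0.
  rewrite -(EF tt u0); last by rewrite et; side.
  rewrite -(F_rot hg pF u0); last by rewrite et; side.
  rewrite opprD; have -> : t = - (- r' + s') by rewrite et; lmod.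
  by rewrite (altNl (F_alt pF u1)) e0 oppr0.
have e2 : E t x (r + s) x = 0 by rewrite et; case: (square0 hg pF sp bp hx ji ki jk hr hs).
have e3 : E t x s' x = 0.
  rewrite (sym4 hg pF (x0 := - r) (y0 := x') (z0 := - s - r) (w0 := x')); try by rewrite ?et; side.
  by apply: (base_null bp ki hs2 hx); rewrite ?et; side.
move: e1 e2; move: (r + s) => P e1 e2.
by rewrite !(altE hE) e1 e2 (altC hE x s') e3; lmod.
Qed.

(** A quarter turn of the plane lets [gV_step] remove n as well as m, and the value at (0, 0)
    belongs to [base_um]. *)
Lemma gV0 k s s' m n : k != i -> hp p k s s' -> m \is a Num.int ->
  n \is a Num.int -> gV s s' m n = 0.
Proof.
move=> ki hs im i_n; have [j [ji jk _]] := fourth_ord hg i k k.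
have hr := hp0 p j.
have e1 : gV s s' m n = gV s s' 0 n.
  move: m im; apply: int_rat_ind => // m im.
  by rewrite (gV_step ji ki jk hr hs im i_n).
have rot a b : a \is a Num.int -> b \is a Num.int ->
    gV s' (- s) a b = gV s s' (- b) a.
  move=> ia ib; have u : um x (x' + b *: s' + a *: s) by frame2 sp hs hx ki; side.
  rewrite /gV; have -> : x' - - b *: s' + a *: s = x' + b *: s' + a *: s by lmod.
  have -> : x' - a *: - s + b *: s' = x' + b *: s' + a *: s by lmod.
  have -> : - s + b *: x = - (s + - b *: x) by lmod.
  by rewrite (altC (F_alt pF u)) (altNl (F_alt pF u)) opprK.
have e2 : gV s s' 0 n = gV s s' 0 0.
  have r0 := rot n 0 i_n i0; rewrite oppr0 in r0.
  have r1 := rot 0 0 i0 i0; rewrite oppr0 in r1; rewrite -r0 -r1.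
  move: n i_n {e1 r0}; apply: int_rat_ind => // n i_n.
  by rewrite (gV_step ji ki jk hr (hp_rot hs) i_n i0).
rewrite e1 e2 /gV !scale0r !subr0 !addr0.
by apply: (base_um' hg pF sp bp hx); frame2 sp hs hx ki; side.
Qed.

(** On vectors orthogonal to v the map [thV v] is the identity, and it kills x. Expanding z and w
    therefore leaves pairs from the other planes, settled by [fV0] and [gV0]. *)
Lemma basis_inV : inV F x.
Proof.
move=> v uv z w [zx zv wx wv]; have [? ? xv] := uv; have hF := F_alt pF uv.
have thx : thV v x = 0.
  by rewrite /thV (sformC x v) xv scaleN1r subrr.
have thl : linear (thV v) by move=> a b c; rewrite /thV !sformE; lmod.
have thN c : thV v (- c) = - thV v c by rewrite /thV !sformE; lmod.
have the c : sform c v = 0 -> c = thV v c.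
  by move=> e; rewrite /thV sformC e oppr0 scale0r addr0.
rewrite (the z zv) (the w wv).
apply: (@hp_expand0 _ _ sp _ (fun c => F x v (thV v c) (thV v w)) z) => [a b c|j r r' hr nr].
  by rewrite thl (alt_linl hF).
have [ej|ji] := eqVneq j i.
  subst j; have := hp_line sp hx hr (hp_coef sp hx hr zx nr).
  by case=> ->; rewrite ?thN thx ?oppr0 (alt0l hF).
apply: (@hp_expand0 _ _ sp _ (fun c => F x v (thV v r) (thV v c)) w) => [a b c|k s s' hs ns].
  by rewrite thl (alt_linr hF).
have [ek|ki] := eqVneq k i.
  subst k; have := hp_line sp hx hs (hp_coef sp hx hs wx ns).
  by case=> ->; rewrite ?thN thx ?oppr0 (alt0r hF).
have [? ?] := hp_int sp hr; have [? ?] := hp_int sp hs.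
have [ejk|jk] := eqVneq j k; last first.
  by rewrite (th_F ji ki jk hr hs uv) (fV0 ji ki jk hr hs) //; apply: sform_int.
subst k.
have e12 : F x v (thV v (p j).1) (thV v (p j).2) = 0.
  have h0 := hp0 p j; have [? ?] := hp_int sp h0.
  by rewrite (gV_F ji h0 uv) (gV0 ji h0) //; apply: sform_int.
have e21 : F x v (thV v (p j).2) (thV v (p j).1) = 0 by rewrite (altC hF) e12 oppr0.
by case: hr => [] [-> _]; case: hs => [] [-> _];
  rewrite ?thN ?(altNl hF) ?(altNr hF) ?e12 ?e21 ?(altxx hF) ?oppr0.
Qed.

End Vee.

(** * The squares [sig] and their twists *)

Section Sums.
Variables (g : nat) (hg : (4 <= g)%N) (M : lmodType rat).
Variable F : H g -> H g -> H g -> H g -> M.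
Hypothesis pF : pform F.
Implicit Types (x y z w u v r s t e : H g).
Local Notation E := (E F).
Local Notation sig := (sig F).

(** For a symplectic pair a, b orthogonal to x and e there is a partner y of x orthogonal to a and
    b. Then e = (y + e) - y is a difference of two partners of x. *)
Lemma inV_null x x0 e : inV F x -> um x x0 -> integral e -> sform x e = 0 ->
  ty x e -> null F x e.
Proof.
move=> Vx [? ? ?] ? xe txe u v pe; have tm := tame_ty hg pF txe.
apply: (span0 hg (E_alt tm) txe) pe => a b uab pe; rewrite -(EF tm uab pe).
have [? ? ab] := uab; have [ax ae bx be] := pe.
name_form x0 b m; name_form x0 a n.
pose y := x0 - m *: a + n *: b.
have uy : um x y by rewrite /y; side.
have uye : um x (y + e) by rewrite /y; side.
have ya : sform y a = 0 by rewrite /y; sfc.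
have yb : sform y b = 0 by rewrite /y; sfc.
have pe1 : perp a b x (y + e) by split; sfc.
have pe2 : perp a b x y by split; sfc.
have hF := F_alt pF uab.
have -> : e = (y + e) - y by lmod.
rewrite (altBr hF) (F_sym pF uab uye pe1) (F_sym pF uab uy pe2).
by rewrite (Vx _ uye) ?(Vx _ uy) ?subrr.
Qed.

Variable p : 'I_g -> H g * H g.
Hypothesis sp : symp p.
Hypothesis Vp : forall i x x', hp p i x x' -> inV F x.

Section Three.
Variables (i j k : 'I_g) (x x' y y' z z' : H g).
Hypotheses (ij : i != j) (ik : i != k) (jk : j != k).
Hypotheses (hx : hp p i x x') (hy : hp p j y y') (hz : hp p k z z').

(* z can be added to x + y because it is killed by inV_drop. *)
Lemma sig_third : E (x + y + z) (x' - y') (x + y + z) (x' - y') = sig x x' y y'.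
Proof.
frame2 sp hx hy ij; frame2 sp hx hz ik; hp2 sp hy hz jk.
have t1 : ty (x + y + z) (x' - y') by apply: (ty_um (x0 := z') (y0 := - x)); side.
have t2 : ty (x + y) (x' - y') by apply: (ty_um (x0 := x' - z') (y0 := - x + z)); side.
have m1 := tame_ty hg pF t1; have m2 := tame_ty hg pF t2.
have e1 : E (x + y + z) (x' - y') z (x' - y') = 0.
  by apply: (inV_drop (x0 := z' - x') m1 (Vp hz)); side.
have e2 : E (x + y) (x' - y') z (x' - y') = 0.
  by apply: (inV_drop (x0 := z') m2 (Vp hz)); side.
rewrite (altDl (E_alt m1)) e1 addr0.
rewrite (sym4 hg pF (x0 := z') (y0 := - x) (z0 := x' - z') (w0 := - x + z)); try by side.
by rewrite (altDl (E_alt m2) (x + y) z) e2 addr0.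
Qed.

End Three.

Lemma ty_sym a b : @ty g a b -> ty b a.
Proof.
by case=> [?|?|[zs [ws hi]]]; [constructor 2|constructor 1|constructor 3; exists ws, zs; exact: isoC].
Qed.

Lemma E_flip a b c d : ty a b -> perp c d a b -> E a b c d = E b a d c.
Proof.
move=> tab pe; rewrite (EC hg pF tab); last by case: pe => *; split.
by rewrite -(altC (E_alt (tame_ty hg pF tab))).
Qed.

Section Three'.
Variables (i j k : 'I_g) (x x' y y' z z' : H g).
Hypotheses (ij : i != j) (ik : i != k) (jk : j != k).
Hypotheses (hx : hp p i x x') (hy : hp p j y y') (hz : hp p k z z').

Lemma mixed_third : E (x + y + z) (x' - y') (x + y + z) (y' - z') =
  - F (y + z) (y' - x') (x + y) (y' - z').
Proof.
frame2 sp hx hy ij; frame2 sp hx hz ik; hp2 sp hy hz jk.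
have t1 : ty (x + y + z) (x' - y') by apply: (ty_um (x0 := z') (y0 := - x)); side.
have m1 := tame_ty hg pF t1.
have e1 : E (x + y + z) (x' - y') z (y' - z') = 0.
  by apply: (inV_drop (x0 := z' - x') m1 (Vp hz)); side.
have u : um (x + y) (y' - z') by side.
have u2 : um (y + z) (y' - x') by side.
rewrite (altDl (E_alt m1)) e1 addr0 -(EF m1 u); last by side.
have e2 : F (x + y) (y' - z') x (x' - y') = 0.
  by apply: (inV_dropF pF (x0 := x' - y') u (Vp hx)); side.
have hF := F_alt pF u.
rewrite -(F_sym pF u u2); last by side.
have -> : x + y + z = x + (y + z) by lmod.
rewrite (altDl hF) e2 add0r -(altNr hF); congr (F _ _ _ _); lmod.
Qed.

(** By [sig_third] the three squares have the common factor Q = x + y + z, and x' - z' = (x' - y') +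
    (y' - z'). The cross term is the one computed by [mixed_third]. *)
Lemma sig_triangle : sig x x' z z' = sig x x' y y' + sig y y' z z' -
  (F (y + z) (y' - x') (x + y) (y' - z') + F (y + z) (y' - x') (x + y) (y' - z')).
Proof.
have kj : k != j by rewrite eq_sym.
have ji : j != i by rewrite eq_sym.
have ki : k != i by rewrite eq_sym.
rewrite -(sig_third ij ik jk hx hy hz) -(sig_third jk ji ki hy hz hx).
rewrite -(sig_third ik ij kj hx hz hy) opprD -!mixed_third.
have -> : x + z + y = x + y + z by lmod.
have -> : y + z + x = x + y + z by lmod.
have -> : x' - z' = (x' - y') + (y' - z') by lmod.
frame2 sp hx hy ij; frame2 sp hx hz ik; hp2 sp hy hz jk.
have [Q eQ] : exists Q, Q = x + y + z by eexists.
have [r1 e1] : exists r1, r1 = x' - y' by eexists.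
have [r2 e2] : exists r2, r2 = y' - z' by eexists.
rewrite -eQ -e1 -e2.
have t1 : ty Q r1 by apply: (ty_um (x0 := z') (y0 := - x)); rewrite ?eQ ?e1; side.
have t2 : ty Q r2 by apply: (ty_um (x0 := x') (y0 := - y)); rewrite ?eQ ?e2; side.
have t3 : ty Q (r1 + r2) by apply: (ty_um (x0 := y') (y0 := - x)); rewrite ?eQ ?e1 ?e2; side.
rewrite (E_flip t1); last by rewrite eQ e1; side.
rewrite (E_flip t2); last by rewrite eQ e2; side.
rewrite (E_flip t3); last by rewrite eQ e1 e2; side.
rewrite (E_flip t1); last by rewrite eQ e1 e2; side.
have s1 : E (r1 + r2) Q r1 Q = E r1 Q (r1 + r2) Q.
  by apply: (sym4 hg pF (x0 := z) (y0 := y') (z0 := y) (w0 := z')); rewrite ?eQ ?e1 ?e2; side.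
have s2 : E (r1 + r2) Q r2 Q = E r2 Q (r1 + r2) Q.
  by apply: (sym4 hg pF (x0 := - x) (y0 := y') (z0 := - y) (w0 := x')); rewrite ?eQ ?e1 ?e2; side.
have s3 : E r2 Q r1 Q = E r1 Q r2 Q.
  by apply: (sym4 hg pF (x0 := z) (y0 := x') (z0 := - x) (w0 := z')); rewrite ?eQ ?e1 ?e2; side.
have h1 := E_alt (tame_ty hg pF (ty_sym t1)); have h2 := E_alt (tame_ty hg pF (ty_sym t2)).
have h3 := E_alt (tame_ty hg pF (ty_sym t3)).
by rewrite (altDl h3) s1 s2 (altDl h1) (altDl h2) s3; lmod.
Qed.

End Three'.

Section Signs.
Variables (i j : 'I_g) (x x' y y' : H g).
Hypotheses (ij : i != j) (hx : hp p i x x') (hy : hp p j y y').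

Lemma sig_ty : ty (x + y) (x' - y').
Proof.
frame2 sp hx hy ij; have [k [ki kj _]] := fourth_ord hg i j j.
have hz := hp0 p k; have [? ?] := hp_int sp hz; have ? := hp_sform sp hz.
hp2 sp hz hx ki; hp2 sp hz hy kj.
by apply: (ty_um (x0 := x' - (p k).2) (y0 := - x + (p k).1)); side.
Qed.

Lemma sig_sym : sig y y' x x' = sig x x' y y'.
Proof.
have t := sig_ty; have h := E_alt (tame_ty hg pF t); frame2 sp hx hy ij.
rewrite /sig; have -> : y' - x' = - (x' - y') by lmod.
rewrite (addrC y) (ENr hg pF t); last by side.
by rewrite (altNr h) opprK.
Qed.

End Signs.

Section Signs'.
Variables (i j : 'I_g) (x x' y y' : H g).
Hypotheses (ij : i != j) (hx : hp p i x x') (hy : hp p j y y').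

Lemma sig_neg : sig (- x) (- x') y y' = sig x x' (- y) (- y').
Proof.
have := sig_ty ij hx (hp_neg hy); rewrite opprK => t.
have h := E_alt (tame_ty hg pF t); have t2 := ty_opp t; frame2 sp hx hy ij.
rewrite /sig opprK.
have -> : - x + y = - (x - y) by lmod.
have -> : - x' - y' = - (x' + y') by lmod.
rewrite (ENr hg pF t2); last by side.
rewrite (ENl hg pF t); last by side.
by rewrite (altNl h) (altNr h) !opprK.
Qed.

Lemma sig_rot : sig x' (- x) y' (- y) = sig x x' (- y) (- y').
Proof.
have := sig_ty ij hx (hp_neg hy); rewrite opprK => t; have t2 := ty_sym t.
have h := E_alt (tame_ty hg pF t2); frame2 sp hx hy ij.
rewrite /sig !opprK; have -> : - x + y = - (x - y) by lmod.
rewrite (ENr hg pF t2); last by side.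
by rewrite (altNr h) opprK (E_flip t2) //; side.
Qed.

Lemma sig_rot1 : sig x' (- x) y y' = sig x x' y' (- y).
Proof.
have := sig_ty ij hx (hp_rot hy); rewrite opprK => t; have t2 := ty_sym t.
have h := E_alt (tame_ty hg pF t2); frame2 sp hx hy ij.
rewrite /sig !opprK; have -> : - x - y' = - (x + y') by lmod.
rewrite (ENr hg pF t2); last by side.
by rewrite (altNr h) opprK (E_flip t2) //; side.
Qed.

End Signs'.

(** The triangles on (x, y', z) and on (z', y, x') have equal right-hand sides, and their left-hand
    sides are the two signs of z. *)
Lemma sig_sign i j k x x' y y' z z' : i != j -> i != k -> j != k ->
  hp p i x x' -> hp p j y y' -> hp p k z z' -> sig x x' z z' = sig x x' (- z) (- z').
Proof.
move=> ij ik jk hx hy hz; have ki : k != i by rewrite eq_sym.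
have kj : k != j by rewrite eq_sym.
have ji : j != i by rewrite eq_sym.
have hx' := hp_rot hx; have hy' := hp_rot hy; have hz' := hp_rot hz.
have e1 := sig_triangle ij ik jk hx hy' hz.
have e2 := sig_triangle kj ki ji hz' hy hx'.
have e0 : F (y' + z) (- y - x') (x + y') (- y - z') = F (y + x') (y' - - z) (z' + y) (y' - - x).
  frame2 sp hx hy ij; frame2 sp hx hz ik; hp2 sp hy hz jk.
  have u : um (y + x') (y' + z) by side.
  rewrite !opprK -(F_rot hg pF u); last by side.
  have u' : um (y' + z) (- (y + x')) by side.
  rewrite (altC (F_alt pF u')) -(altNr (F_alt pF u')).
  congr (F _ _ _ _); lmod.
rewrite e0 in e1.
rewrite (sig_rot1 kj hz hy) (sig_sym jk hy' hz) in e2.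
rewrite (sig_sym ij hx' hy) (sig_rot1 ij hx hy) in e2.
rewrite (sig_sym ik hx' hz') (sig_rot ik hx hz) in e2.
by rewrite e1 e2 [X in X - _]addrC.
Qed.

Hypothesis Qp : forall i j x x' y y', i != j -> hp p i x x' -> hp p j y y' ->
  sig x x' y y' = 0 \/ sig x x' (- y) (- y') = 0.

Lemma sig0 i j x x' y y' : i != j -> hp p i x x' -> hp p j y y' ->
  sig x x' y y' = 0.
Proof.
move=> ij hx hy; have [k [ki kj _]] := fourth_ord hg i j j.
have ik : i != k by rewrite eq_sym.
have e := sig_sign ik ij kj hx (hp0 p k) hy.
by case: (Qp ij hx hy); rewrite e.
Qed.

Lemma mixed0 i j k x x' y y' z z' : i != j -> i != k -> j != k ->
  hp p i x x' -> hp p j y y' -> hp p k z z' ->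
  F (y + z) (y' - x') (x + y) (y' - z') = 0.
Proof.
move=> ij ik jk hx hy hz; have := sig_triangle ij ik jk hx hy hz.
rewrite (sig0 ij hx hy) (sig0 jk hy hz) (sig0 ik hx hz) addr0 sub0r => /esym/eqP.
by rewrite oppr_eq0 => /eqP/lmod_half.
Qed.

Section Twist.
Variables (i j k : 'I_g) (x x' y y' z z' : H g).
Hypotheses (ij : i != j) (ik : i != k) (jk : j != k).
Hypotheses (hx : hp p i x x') (hy : hp p j y y') (hz : hp p k z z').

Let i1 : (1 : rat) \is a Num.int. Proof. exact: rpred1. Qed.

Lemma twist_third (a : rat) : a \is a Num.int ->
  E (x + y) (x' - y' + a *: z') (x + y) (x' - y' + a *: z') = 0.
Proof.
frame2 sp hx hy ij; frame2 sp hx hz ik; hp2 sp hy hz jk.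
move: a; apply: int_rat_ind => [|a ia].
  rewrite scale0r addr0; exact: sig0 ij hx hy.
have t1 : ty (x' - y' + a *: z') (x + y).
  by apply: (ty_um (x0 := - x) (y0 := x')); side.
have t2 : ty (x' - y' + (a + 1) *: z') (x + y).
  by apply: (ty_um (x0 := - x) (y0 := x')); side.
have m1 := tame_ty hg pF t1; have m2 := tame_ty hg pF t2.
suff -> : E (x + y) (x' - y' + (a + 1) *: z') (x + y) (x' - y' + (a + 1) *: z') =
  E (x + y) (x' - y' + a *: z') (x + y) (x' - y' + a *: z') by [].
rewrite (E_flip (ty_sym t1)); last by side.
rewrite (E_flip (ty_sym t2)); last by side.
have e1 : E (x' - y' + (a + 1) *: z') (x + y) z' (x + y) = 0.
  by apply: (inV_drop (x0 := - z + (a + 1) *: x) m2 (Vp (hp_rot hz))); side.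
have e2 : E (x' - y' + a *: z') (x + y) z' (x + y) = 0.
  by apply: (inV_drop (x0 := - z + a *: x) m1 (Vp (hp_rot hz))); side.
have e3 : E (x' - y' + (a + 1) *: z') (x + y) (x' - y' + a *: z') (x + y) =
    E (x' - y' + a *: z') (x + y) (x' - y' + (a + 1) *: z') (x + y).
  by apply: (sym4 hg pF (x0 := a *: x - z) (y0 := x') (z0 := - (a + 1) *: x + z) (w0 := x')); side.
have e0 : x' - y' + (a + 1) *: z' = (x' - y' + a *: z') + z' by lmod.
rewrite {2}e0 (altDl (E_alt m2)) e1 addr0 e3 e0 (altDl (E_alt m1)).
by rewrite e2 addr0.
Qed.

(** A twist by x is traded for a twist by z' of a third plane, treated in [twist_third]. The two
    twisted vectors r and s differ by m (x + z'); the exchanges of factors go through r + z, which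
    has the partners required by [sym4]. *)
Lemma twist_third_z (m : rat) : m \is a Num.int ->
  E (x + y) (x' - y' + m *: x) (x + y) (x' - y' + m *: x) =
  E (x + y) (x' - y' + (- m) *: z') (x + y) (x' - y' + (- m) *: z').
Proof.
move=> im; frame2 sp hx hy ij; frame2 sp hx hz ik; hp2 sp hy hz jk.
have [P eP] : exists P, P = x + y by eexists.
have [r er] : exists r, r = x' - y' + m *: x by eexists.
have [s es] : exists s, s = x' - y' + (- m) *: z' by eexists.
rewrite -er -es -eP.
have tr : ty r P by apply: (ty_um (x0 := - x) (y0 := x' + m *: x)); rewrite ?eP ?er; side.
have ts : ty s P by apply: (ty_um (x0 := - x) (y0 := x')); rewrite ?eP ?es; side.
have tv : ty (r + z) P by apply: (ty_um (x0 := z') (y0 := x' + m *: x)); rewrite ?eP ?er; side.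
rewrite (E_flip (ty_sym tr)); last by rewrite ?eP ?er; side.
rewrite (E_flip (ty_sym ts)); last by rewrite ?eP ?es; side.
have mr := tame_ty hg pF tr; have ms := tame_ty hg pF ts; have mv := tame_ty hg pF tv.
have ta : ty (x + z') P by apply: (ty_um (x0 := - z) (y0 := y')); rewrite ?eP; side.
have tb : ty (m *: x + z + m *: z') P.
  by apply: (ty_um (x0 := z') (y0 := y')); rewrite ?eP; side.
have ma := tame_ty hg pF ta; have mb := tame_ty hg pF tb.
have e1 : E r P z P = 0.
  by apply: (inV_drop (x0 := z') mr (Vp hz)); rewrite ?eP ?er; side.
have e2 : E r P (r + z) P = E (r + z) P r P.
  by apply: (sym4 hg pF (x0 := - x - z') (y0 := x' + m *: x) (z0 := z') (w0 := x' + m *: x));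
    rewrite ?eP ?er; side.
have e3 : E (r + z) P (x + z') P = 0.
  rewrite (sym4 hg pF (x0 := - x) (y0 := x' + m *: x) (z0 := - z) (w0 := y'));
    try by rewrite ?eP ?er; side.
  rewrite (altC (E_alt ma)) {2}eP (altDl (E_alt ma)).
  rewrite (inV_drop (x0 := x' - y' + z) ma (Vp hx)); try by rewrite ?eP ?er; side.
  rewrite (inV_drop (x0 := y' - x' - z) ma (Vp hy)); try by rewrite ?eP ?er; side.
  by rewrite addr0 oppr0.
have e4 : E (r + z) P s P = E s P (r + z) P.
  by apply: (sym4 hg pF (x0 := z') (y0 := x' + m *: x) (z0 := - x - z') (w0 := x'));
    rewrite ?eP ?er ?es; side.
have e5 : E s P (m *: x + z + m *: z') P = 0.
  rewrite (sym4 hg pF (x0 := - x) (y0 := x') (z0 := z') (w0 := y'));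
    try by rewrite ?eP ?es; side.
  rewrite (altC (E_alt mb)) {2}eP (altDl (E_alt mb)).
  rewrite (inV_drop (x0 := x' - y' - m *: z') mb (Vp hx)); try by rewrite ?eP ?es; side.
  rewrite (inV_drop (x0 := y' - x' + m *: z') mb (Vp hy)); try by rewrite ?eP ?es; side.
  by rewrite addr0 oppr0.
have f1 : r = s + m *: (x + z') by rewrite er es; lmod.
have f2 : r + z = s + (m *: x + z + m *: z') by rewrite er es; lmod.
have g1 : E r P r P = E r P (r + z) P by rewrite (altDl (E_alt mr)) e1 addr0.
have g2 : E (r + z) P r P = E (r + z) P s P.
  by rewrite {2}f1 (altDl (E_alt mv)) (altZl (E_alt mv)) e3 scaler0 addr0.
have g3 : E s P (r + z) P = E s P s P.
  by rewrite f2 (altDl (E_alt ms)) e5 addr0.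
by rewrite g1 e2 g2 e4 g3.
Qed.

End Twist.

Lemma twist0 i j x x' y y' (m : rat) : i != j -> hp p i x x' -> hp p j y y' ->
  m \is a Num.int -> E (x + y) (x' - y' + m *: x) (x + y) (x' - y' + m *: x) = 0.
Proof.
move=> ij hx hy im; have [k [ki kj _]] := fourth_ord hg i j j.
have ik : i != k by rewrite eq_sym.
have jk : j != k by rewrite eq_sym.
rewrite (twist_third_z ij ik jk hx hy (hp0 p k) im).
by apply: (twist_third ij ik jk hx hy (hp0 p k)); rewrite rpredN.
Qed.

End Sums.

Lemma hp_trans (g : nat) (q : 'I_g -> H g * H g) k a a' t t' :
  hp q k a a' -> hp q k t t' ->
  [\/ t = a /\ t' = a', t = a' /\ t' = - a, t = - a /\ t' = - a' | t = - a' /\ t' = a].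
Proof.
by case=> [] [-> ->]; case=> [] [-> ->]; rewrite ?opprK;
  [constructor 1|constructor 2|constructor 3|constructor 4
  |constructor 4|constructor 1|constructor 2|constructor 3
  |constructor 3|constructor 4|constructor 1|constructor 2
  |constructor 2|constructor 3|constructor 4|constructor 1].
Qed.

(** * Stability of [base] under [move2] *)

Section Moves.
Variables (g : nat) (hg : (4 <= g)%N) (M : lmodType rat).
Variable F : H g -> H g -> H g -> H g -> M.
Hypothesis pF : pform F.
Implicit Types (x y z w u v r s t e : H g).
Local Notation E := (E F).
Local Notation sig := (sig F).

Lemma nullC a b : ty a b -> null F a b -> null F b a.
Proof.
move=> tab n u v pe; have pe' : perp u v a b by case: pe.
by rewrite (EC hg pF tab pe') n ?oppr0.
Qed.

Lemma nullNr a b : ty a b -> null F a b -> null F a (- b).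
Proof.
move=> tab n u v [e1 e2 e3 e4]; have pe' : perp u v a b.
  by split=> //; [move: e2|move: e4]; rewrite sformNr; lra.
by rewrite (ENr hg pF tab pe') n ?oppr0.
Qed.

Lemma E_NN a b : ty a b -> sform a b = 0 -> E a (- b) a (- b) = E a b a b.
Proof.
move=> tab ab; have h := E_alt (tame_ty hg pF tab).
have pe : perp a b a b by split; sfc.
rewrite (ENr hg pF tab); first by rewrite (altNr h) opprK.
by split; sfc.
Qed.

Lemma E_CC a b : ty a b -> sform a b = 0 -> E b a b a = E a b a b.
Proof.
by move=> tab ab; rewrite (E_flip hg pF (ty_sym tab)) //; split; sfc.
Qed.

Section General.
Variable q : 'I_g -> H g * H g.
Hypothesis sq : symp q.

Lemma hp_ty k l a a' b b' : k != l -> hp q k a a' -> hp q l b b' -> ty a b.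
Proof. by move=> kl ha hb; frame2 sq ha hb kl; apply: (ty_um (x0 := a') (y0 := b')); side. Qed.

Lemma null_basis i j a a' b b' : i != j -> hp q i a a' -> hp q j b b' ->
  (forall k e e', k != i -> k != j -> hp q k e e' -> inV F e) ->
  E a b a b = 0 -> null F a b.
Proof.
move=> ij ha hb Vq e0 u v [ua ub va vb].
have tab := hp_ty ij ha hb; have tm := tame_ty hg pF tab; have h := E_alt tm.
have cases k e e' c : hp q k e e' -> sform c a = 0 -> sform c b = 0 ->
    sform c e' != 0 -> [/\ k != i & k != j] \/ [\/ e = a, e = - a, e = b | e = - b].
  move=> he ca cb ne; have [ek|ki] := eqVneq k i.
    subst k; right; have [->|->] := hp_line sq ha he (hp_coef sq ha he ca ne).
      by constructor 1.
    by constructor 2.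
  have [ek|kj] := eqVneq k j; last by left.
  subst k; right; have [->|->] := hp_line sq hb he (hp_coef sq hb he cb ne).
    by constructor 3.
  by constructor 4.
have dr k e e' r : k != i -> k != j -> hp q k e e' -> integral r ->
    sform r a = 0 -> sform r b = 0 -> E a b e r = 0.
  move=> ki kj he ir ra rb; frame2 sq he ha ki; hp2 sq he hb kj.
  by apply: (inV_drop (x0 := e') tm (Vq _ _ _ ki kj he)); side.
have fin k e e' c : hp q k e e' -> sform c a = 0 -> sform c b = 0 ->
    sform c e' != 0 -> [/\ integral e, sform e a = 0 & sform e b = 0].
  move=> he ca cb ne; have [ie _] := hp_int sq he; split=> //.
    have [ek|ki] := eqVneq k i; last by hp2 sq he ha ki.
    by subst k; exact: (hp_coef sq ha he ca ne).
  have [ek|kj] := eqVneq k j; last by hp2 sq he hb kj.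
  by subst k; exact: (hp_coef sq hb he cb ne).
apply: (@hp_expand0 _ _ sq _ (fun c => E a b c v) u) => [c d d'|k e e' he ne].
  by rewrite (alt_linl h).
apply: (@hp_expand0 _ _ sq _ (E a b e) v) => [|l f f' hf nf].
  exact: alt_linr.
have [ie ea eb] := fin _ _ _ _ he ua ub ne; have [jf fa fb] := fin _ _ _ _ hf va vb nf.
have [[ki kj]|ce] := cases _ _ _ _ he ua ub ne; first exact: dr he _ _ _.
have [[li lj]|cf] := cases _ _ _ _ hf va vb nf.
  by rewrite (altC h) (dr _ _ _ _ li lj hf) ?oppr0.
have e1 : E a b b a = 0 by rewrite (altC h) e0 oppr0.
by case: ce => ->; case: cf => ->; rewrite ?(altNl h) ?(altNr h) ?(altxx h) ?e0 ?e1 ?oppr0.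
Qed.

Lemma F_hp k a a' b b' u v : hp q k a a' -> hp q k b b' -> perp u v a a' ->
  F b b' u v = F a a' u v.
Proof.
move=> ha hb pe; have ua := hp_um sq ha; have [p1 p2 p3 p4] := pe.
have u2 := um_rot ua; have u3 := um_rot u2; have u4 := um_rot u3.
have q2 : perp u v a' (- a) by side.
have q3 : perp u v (- a) (- a') by side.
have e2 := F_rot hg pF ua pe; have e3 := F_rot hg pF u2 q2.
have e4 := F_rot hg pF u3 q3; rewrite opprK in e4.
by case: (hp_trans ha hb) => [] [-> ->] //; rewrite ?e4 ?e3 ?e2.
Qed.

Lemma DD_inV i l t t' w w' : i != l -> hp q i t t' -> hp q l w w' -> inV F t ->
  DD F q i t t' w.
Proof.
move=> il ht hw Vt j c c' ji hc cw; left.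
frame2 sq hc ht ji; frame2 sq ht hw il.
by rewrite /D0; apply: Vt; side.
Qed.

Lemma N_inV i j t t' c c' : i != j -> hp q i t t' -> hp q j c c' -> inV F t ->
  E t (c + c') t (c + c') = 0.
Proof.
move=> ij ht hc Vt; frame2 sq ht hc ij.
have tc : ty t (c + c') by apply: (ty_um (x0 := t') (y0 := c')); side.
apply: (inV_null hg pF Vt (x0 := t') _ _ _ tc); side.
Qed.

Lemma base_um_inV k a a' u v : hp q k a a' -> inV F a ->
  perp u v (q k).1 (q k).2 -> F (q k).1 (q k).2 u v = 0.
Proof.
move=> ha Va pe; have h0 := hp0 q k.
rewrite -(F_hp h0 ha pe); apply: Va; first exact: hp_um ha.
by case: pe => *; case: ha => [] [-> ->]; side.
Qed.

End General.

Section Base.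
Variable p : 'I_g -> H g * H g.
Hypothesis sp : symp p.
Hypothesis bp : base F p.

Let Vp k e e' : hp p k e e' -> inV F e.
Proof. exact: (basis_inV hg pF sp bp). Qed.

Let Qp i j x x' y y' : i != j -> hp p i x x' -> hp p j y y' ->
  sig x x' y y' = 0 \/ sig x x' (- y) (- y') = 0.
Proof. exact: (base_Q bp). Qed.

Section Move2.
Variables (i j : 'I_g) (x x' y y' : H g).
Hypotheses (ij : i != j) (hx : hp p i x x') (hy : hp p j y y').
Let q := move2 p x' y.
Let sq : symp q := move2_symp sp hx hy ij.
Let hX : hp q i (x + y) x' := move2_hp1 sp hx hy ij.
Let hY : hp q j y (y' - x') := move2_hp2 sp hx hy ij.
Let ji : j != i. Proof. by rewrite eq_sym. Qed.

Let q_other k e e' : k != i -> k != j -> hp q k e e' -> hp p k e e'.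
Proof. by move=> ki kj; apply: hp_eq; apply: (move2_other sp hx hy ki kj). Qed.

Let Vother k e e' : k != i -> k != j -> hp q k e e' -> inV F e.
Proof. by move=> ki kj he; apply: Vp (q_other ki kj he). Qed.

Let hX' := hp_rot hx.
Let hY' := hp_rot hy.

Let t_XY : ty (x + y) (y' - x').
Proof. exact: (hp_ty sq ij hX (hp_rot hY)). Qed.

Let XY0 : E (x + y) (y' - x') (x + y) (y' - x') = 0.
Proof.
have -> : y' - x' = - (x' - y') by rewrite opprB.
rewrite E_NN; last by frame2 sp hx hy ij; sfc.
  exact: (sig0 hg pF sp Vp Qp ij hx hy).
have := ty_opp (ty_sym t_XY); rewrite opprB => t; exact: ty_sym t.
Qed.

Let null_XY : null F (x + y) (y' - x').
Proof. by apply: (null_basis sq ij hX (hp_rot hY)) => //; exact: Vother. Qed.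

Lemma move2_iso l w w' : l != i -> hp q l w w' -> null F (x + y) w.
Proof.
move=> li hw; have il : i != l by rewrite eq_sym.
have tw := hp_ty sq il hX hw; have [iX iX'] := hp_int sq hX.
have [iw iw'] := hp_int sq hw; hp2 sq hX hw il.
have inVw : inV F w -> null F (x + y) w.
  move=> Vw; apply: nullC (ty_sym tw) _.
  have [Xw _ _ _] := hp_diff sq hX hw il.
  apply: (inV_null hg pF Vw (hp_um sq hw) iX _ (ty_sym tw)).
  by rewrite sformC Xw oppr0.
have [lj|lj] := eqVneq l j; last by apply: inVw; apply: Vother hw.
subst l; have [[e _]|[e _]|[e _]|[e _]] := hp_trans hY hw; subst w.
- exact/inVw/(Vp hy).
- exact: null_XY.
- exact/inVw/(Vp (hp_neg hy)).
- exact: (nullNr t_XY null_XY).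
Qed.

Lemma move2_N l c c' : l != i -> hp q l c c' ->
  E (x + y) (c + c') (x + y) (c + c') = 0 \/ E (x + y) (c - c') (x + y) (c - c') = 0.
Proof.
move=> li hc; frame2 sp hx hy ij.
have [lj|lj] := eqVneq l j; last first.
  left; have {}hc := q_other li lj hc; frame2 sp hc hx li; hp2 sp hc hy lj.
  have t : ty (x + y) (c + c') by apply: (ty_um (x0 := x') (y0 := c')); side.
  have tm := tame_ty hg pF t; have h := E_alt tm; rewrite (altDl h x).
  rewrite (inV_drop (x0 := x' - y') tm (Vp hx)); try by side.
  by rewrite (inV_drop (x0 := y' - x') tm (Vp hy)) ?addr0; try by side.
have A0 : E (x + y) (y + (y' - x')) (x + y) (y + (y' - x')) = 0.
  (* The new vector y' - x' differs from the one in [sig] by a sign, and adding y to it is the twist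
     m = 1 with the two planes exchanged. *)
  have := twist0 hg pF sp Vp Qp ji hy hx (m := 1) (rpred1 _).
  by rewrite scale1r (addrC (y' - x')) (addrC y x).
have tA : ty (x + y) (y + (y' - x')).
  by apply: (ty_um (x0 := x') (y0 := - y)); side.
have xA : sform (x + y) (y + (y' - x')) = 0 by sfc.
have A1 := E_NN tA xA; rewrite A0 in A1.
subst l; have [[-> ->]|[-> ->]|[-> ->]|[-> ->]] := hp_trans hY hc.
- by left.
- by right; rewrite opprK (addrC (y' - x')).
- by left; rewrite -opprD.
- by right; rewrite (_ : - (y' - x') - y = - (y + (y' - x'))) //; lmod.
Qed.

Lemma move2_Q l c c' : l != i -> hp q l c c' ->
  sig (x + y) x' c c' = 0 \/ sig (x + y) x' (- c) (- c') = 0.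
Proof.
move=> li hc; frame2 sp hx hy ij; have il : i != l by rewrite eq_sym.
have [lj|lj] := eqVneq l j; last first.
  left; have {}hc := q_other li lj hc.
  rewrite /sig addrAC (sig_third hg pF sp Vp il ij lj hx hc hy).
  exact: (sig0 hg pF sp Vp Qp il hx hc).
have B0 : sig (x + y) x' (- y) (- (y' - x')) = 0.
  rewrite /sig opprK; have -> : x + y - y = x by lmod.
  have -> : x' + (y' - x') = y' by lmod.
  have t : ty x y' := hp_ty sp ij hx hY'.
  by apply: (inV_null hg pF (Vp hx) (hp_um sp hx) _ _ t); side.
have i2 : (2 : rat) \is a Num.int by apply: rpred_nat.
(* The factor 2 arises because (x + y + y' - x') /\ (x' + y) is the same bivector as (y' + x + 2 y)
   /\ (y + x'). *)
have tz := twist0 hg pF sp Vp Qp ji hy hX' i2; rewrite opprK in tz.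
have t1 : ty (y + x') (y' + x + 2 *: y).
  by apply: (ty_um (x0 := - x + 2 *: x') (y0 := - y)); side.
have z1 : sform (y + x') (y' + x + 2 *: y) = 0 by sfc.
have C0 : sig (x + y) x' (y' - x') (- y) = 0.
  have cc := E_CC t1 z1; rewrite tz in cc; rewrite /sig opprK -cc (addrC x').
  have e1 : x + y + (y' - x') = (y' + x + 2 *: y) - (y + x') by lmod.
  have t2 := ty_sym t1.
  rewrite (E_biv hg pF t2 (z2 := x + y + (y' - x')) (w2 := y + x') (k := 1)).
  - rewrite scale1r e1 !(altBl (E_alt (tame_ty hg pF t2))).
    by rewrite (altxx (E_alt (tame_ty hg pF t2))) subr0.
  - by move=> a a1 a2; rewrite e1 sformDr sformNr a1 a2 subr0.
  - by move=> a; rewrite e1 !sformDr !sformNr !sformDr => a1 a2; split; lra.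
  - by move=> L hL; rewrite e1 (altBl hL) (altxx hL) subr0 scale1r.
  - by split; sfc.
have ty1 : ty (x + y + (y' - x')) (x' + y).
  by apply: (ty_um (x0 := - y) (y0 := - x - y)); side.
subst l; have [[-> ->]|[-> ->]|[-> ->]|[-> ->]] := hp_trans hY hc.
- by right.
- by left.
- by left.
- by right; rewrite opprK.
Qed.

Lemma move2_D l w w' : l != i -> hp q l w w' ->
  DD F q i (x + y) x' w \/ DD F q l w w' (x + y).
Proof.
move=> li hw; have il : i != l by rewrite eq_sym.
have inVw : inV F w -> DD F q l w w' (x + y) by apply: (DD_inV sq li hw hX).
have [lj|lj] := eqVneq l j; last by right; apply: inVw; apply: Vother hw.
have key c c' m : m != i -> hp q m c c' -> sform c (y' - x') = 0 ->
    D0 F c c' (x + y) x' (y' - x') = 0 \/ D0 F (- c) (- c') (x + y) x' (y' - x') = 0.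
  move=> mi hc cY; frame2 sp hx hy ij.
  have Y0 : D0 F (y' - x') (- y) (x + y) x' (y' - x') = 0.
    rewrite /D0; have -> : y' - x' + x' = y' by rewrite subrK.
    have u : um (x + y) y' by side.
    have pe : perp (- y + (x + y)) (y' - x') (x + y) y' by side.
    rewrite -(F_rot hg pF u pe); apply: (Vp hY'); side.
  have [em|mj] := eqVneq m j.
    subst m; have [[e1 e2]|[e1 e2]|[e1 e2]|[e1 e2]] := hp_trans (hp_rot hY) hc; subst c c'.
    - by left.
    - by exfalso; move: cY; sfc; lra.
    - by right; rewrite !opprK.
    - by exfalso; move: cY; sfc; lra.
  left; have {}hc := q_other mi mj hc; frame2 sp hc hx mi; hp2 sp hc hy mj.
  have jm : j != m by rewrite eq_sym.
  have im : i != m by rewrite eq_sym.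
  (* Once y has been dropped from the third argument, what remains is the mixed product of the three
     planes. *)
  have e0 := mixed0 hg pF sp Vp Qp ji jm im hy hx (hp_rot hc).
  have u : um (x + y) (c + x') by side.
  have u2 : um (x + c') (x' - y') by side.
  have hF := F_alt pF u.
  have e1 : F (x + y) (c + x') y (y' - x') = 0.
    by apply: (inV_dropF pF (x0 := y' - x') u (Vp hy)); side.
  rewrite /D0 addrA (altDl hF) e1 addr0 (addrC c' x).
  have -> : y' - x' = - (x' - y') by lmod.
  rewrite (altNr hF) (F_sym pF u u2); last by side.
  by rewrite (addrC x y) (addrC c) -(opprK c) e0 oppr0.
subst l; have [[e _]|[e _]|[e _]|[e _]] := hp_trans hY hw; subst w.
- by right; apply/inVw/(Vp hy).
- by left=> m c c' mi hc cY; apply: key mi hc cY.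
- by right; apply/inVw/(Vp (hp_neg hy)).
- left=> m c c' mi hc cY; have cY' : sform c (y' - x') = 0.
    by move: cY; rewrite sformNr; lra.
  frame2 sq hc hX mi.
  have u1 : um (x + y) (c + x') by split; [assumption|intg|rewrite sformDr; have := sformC c (x + y); lra].
  have u2 : um (x + y) (- c + x') by split; [assumption|intg|rewrite sformDr sformNr; have := sformC c (x + y); lra].
  rewrite /D0 (altNr (F_alt pF u1)) (altNr (F_alt pF u2)).
  by case: (key c c' m mi hc cY'); rewrite /D0 => ->; [left|right]; rewrite oppr0.
Qed.

End Move2.

Lemma move2_opp x' y : move2 p (- x') (- y) = move2 p x' y.
Proof.
apply/funext => k; rewrite /move2 /mv /eich !sformE.
by congr (_, _); rewrite !scaleNr !scalerN !opprK.
Qed.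

Lemma move2_swap x' y : move2 p (- y) (- x') = move2 p x' y.
Proof.
apply/funext => k; rewrite /move2 /mv /eich !sformE.
by congr (_, _); rewrite !scaleNr !scalerN !opprK addrAC.
Qed.

(** Says that (t, t') is the pair (x + y, x') for some description of q as a [move2]. By [move2_opp]
    and [move2_swap] every new vector is the first member of such a pair, so each property is
    checked for x + y only. *)
Let mixed q k t t' := exists i j x x' y y', [/\ i != j, hp p i x x', hp p j y y',
  q = move2 p x' y & [/\ k = i, t = x + y & t' = x']].

Section Base2.
Variables (i j : 'I_g) (x x' y y' : H g).
Hypotheses (ij : i != j) (hx : hp p i x x') (hy : hp p j y y').
Let q := move2 p x' y.
Let sq : symp q := move2_symp sp hx hy ij.
Let hX : hp q i (x + y) x' := move2_hp1 sp hx hy ij.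
Let hY : hp q j y (y' - x') := move2_hp2 sp hx hy ij.

Let mX : mixed q i (x + y) x'.
Proof. by exists i, j, x, x', y, y'. Qed.
Let mXn : mixed q i (- (x + y)) (- x').
Proof.
exists i, j, (- x), (- x'), (- y), (- y').
by rewrite move2_opp opprD; split=> //; apply: hp_neg.
Qed.
Let mY : mixed q j (y' - x') (- y).
Proof.
exists j, i, y', (- y), (- x'), x; rewrite move2_swap eq_sym; split=> //.
  exact: hp_rot.
exact: hp_rotV.
Qed.
Let mYn : mixed q j (- (y' - x')) y.
Proof.
exists j, i, (- y'), y, x', (- x).
rewrite -[y in move2 p y _]opprK -[x' in move2 p _ x']opprK move2_opp move2_swap.
rewrite eq_sym opprD opprK; split=> //; first exact: hp_rotV.
exact: hp_rot.
Qed.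

Let mixedP k t t' : hp q k t t' -> inV F t \/ mixed q k t t'.
Proof.
move=> ht; have [ki|ki] := eqVneq k i.
  subst k; have [[-> ->]|[-> ->]|[-> ->]|[-> ->]] := hp_trans hX ht.
  - by right.
  - by left; apply: Vp (hp_rot hx).
  - by right.
  - by left; apply: Vp (hp_rotV hx).
have [kj|kj] := eqVneq k j.
  subst k; have [[-> ->]|[-> ->]|[-> ->]|[-> ->]] := hp_trans hY ht.
  - by left; apply: Vp hy.
  - by right.
  - by left; apply: Vp (hp_neg hy).
  - by right.
by left; apply: (@Vp k t t'); move: ht; apply: hp_eq; apply: (move2_other sp hx hy ki kj).
Qed.

Let mixedP2 k t t' : hp q k t t' -> [\/ hp p k t t' /\ (k != i /\ k != j), mixed q k t t' |
  mixed q k t' (- t)].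
Proof.
move=> ht; have [ki|ki] := eqVneq k i.
  subst k; have [[-> ->]|[-> ->]|[-> ->]|[-> ->]] := hp_trans hX ht; rewrite ?opprK.
  - by constructor 2.
  - by constructor 3.
  - by constructor 2.
  - by constructor 3.
have [kj|kj] := eqVneq k j.
  subst k; have [[-> ->]|[-> ->]|[-> ->]|[-> ->]] := hp_trans hY ht.
  - by constructor 3.
  - by constructor 2.
  - by constructor 3; rewrite opprK.
  - by constructor 2.
by constructor 1; split=> //; move: ht; apply: hp_eq; apply: (move2_other sp hx hy ki kj).
Qed.

Lemma base_move2 : base F q.
Proof.
split.
- move=> k l t t' w w' kl ht hw; have tw := hp_ty sq kl ht hw.
  have [] := mixedP ht.
    move=> Vt; frame2 sq ht hw kl.
    by apply: (inV_null hg pF Vt (hp_um sq ht) _ _ tw).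
  case=> [i1 [j1 [x1 [x1' [y1 [y1' [ij1 hx1 hy1 eq [ek -> _]]]]]]]].
  rewrite eq in hw; apply: (move2_iso ij1 hx1 hy1 _ hw).
  by rewrite -ek eq_sym.
- move=> k u v pe; have h0 := hp0 q k.
  have [V1|] := mixedP h0; first exact: (base_um_inV sq h0 V1 pe).
  case=> [i1 [j1 [x1 [x1' [y1 [y1' [ij1 hx1 hy1 eq [ek _ e2]]]]]]]].
  by apply: (base_um_inV sq (hp_rot h0) _ pe); rewrite e2; apply: Vp (hp_rot hx1).
- move=> k l t t' w w' kl ht hw; have [V1|] := mixedP ht.
    by left; apply: (DD_inV sq kl ht hw V1).
  have lk : l != k by rewrite eq_sym.
  have [V1|_] := mixedP hw; first by move=> _; right; apply: (DD_inV sq lk hw ht V1).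
  case=> [i1 [j1 [x1 [x1' [y1 [y1' [ij1 hx1 hy1 eq [ek -> ->]]]]]]]].
  by rewrite ek eq in lk hw *; apply: (move2_D ij1 hx1 hy1 lk hw).
- move=> k l t t' c c' kl ht hc; have [V1|] := mixedP ht.
    by left; apply: (N_inV sq kl ht hc V1).
  have lk : l != k by rewrite eq_sym.
  case=> [i1 [j1 [x1 [x1' [y1 [y1' [ij1 hx1 hy1 eq [ek -> _]]]]]]]].
  by rewrite ek eq in lk hc *; apply: (move2_N ij1 hx1 hy1 lk hc).
have half k l t t' c c' : k != l -> hp q k t t' -> hp q l c c' ->
    mixed q k t t' \/ mixed q k t' (- t) ->
    sig t t' c c' = 0 \/ sig t t' (- c) (- c') = 0.
  move=> kl ht hc; have lk : l != k by rewrite eq_sym.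
  case=> [] [i1 [j1 [x1 [x1' [y1 [y1' [ij1 hx1 hy1 eq [ek et et']]]]]]]].
    by rewrite et et'; rewrite ek eq in lk hc *; apply: (move2_Q ij1 hx1 hy1 lk hc).
  have hc2 := hp_rot hc; have hcN := hp_neg hc.
  have e1 := sig_rot hg pF sq kl ht hc; have e2 := sig_rot hg pF sq kl ht hcN.
  rewrite !opprK in e2; rewrite -e1 -e2 et' et.
  by rewrite ek eq in lk hc2 *; case: (move2_Q ij1 hx1 hy1 lk hc2); rewrite ?opprK; [right|left].
move=> k l t t' c c' kl ht hc.
have lk : l != k by rewrite eq_sym.
have [[ht' _]|m|m] := mixedP2 ht.
- have half2 : mixed q l c c' \/ mixed q l c' (- c) ->
      sig t t' c c' = 0 \/ sig t t' (- c) (- c') = 0.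
    move=> m; have e1 := sig_sym hg pF sq lk hc ht.
    have e2 := sig_sym hg pF sq lk (hp_neg hc) ht.
    rewrite e1 e2 (sig_neg hg pF sq lk hc ht); exact: half lk hc ht m.
  have [[hc' _]|m|m] := mixedP2 hc; last by apply: half2; right.
  - exact: (Qp kl ht' hc').
  - by apply: half2; left.
- by apply: (half _ _ _ _ _ _ kl ht hc); left.
- by apply: (half _ _ _ _ _ _ kl ht hc); right.
Qed.

End Base2.
End Base.
End Moves.

(** * Stability of [base] under [move1] *)

Section Move1.
Variables (g : nat) (hg : (4 <= g)%N) (M : lmodType rat).
Variable F : H g -> H g -> H g -> H g -> M.
Hypothesis pF : pform F.
Implicit Types (x y z w u v r s t e : H g).
Local Notation E := (E F).
Local Notation sig := (sig F).
Variable p : 'I_g -> H g * H g.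
Hypothesis sp : symp p.
Hypothesis bp : base F p.

Let Vp k e e' : hp p k e e' -> inV F e.
Proof. exact: (basis_inV hg pF sp bp). Qed.

Let Qp i j x x' y y' : i != j -> hp p i x x' -> hp p j y y' ->
  sig x x' y y' = 0 \/ sig x x' (- y) (- y') = 0.
Proof. exact: (base_Q bp). Qed.

Section Four.
Variables (i j k l : 'I_g) (x x' u u' y y' z z' : H g).
Hypotheses (ij : i != j) (ki : k != i) (kj : k != j) (li : l != i) (lj : l != j)
  (kl : k != l).
Hypotheses (hx : hp p i x x') (hu : hp p j u u') (hz : hp p k z z') (hy : hp p l y y').

(** This is [centre_diff0] read in the basis [move2 p z' y], which contains z + y and y' - z'; hence
    the other move has to be treated first. *)
Lemma four0 : E (z' - y') (x' - u') (z + y) (x + u) = 0.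
Proof.
frame2 sp hx hu ij; frame2 sp hz hy kl; hp2 sp hz hx ki; hp2 sp hz hu kj.
hp2 sp hy hx li; hp2 sp hy hu lj.
have sq := move2_symp sp hz hy kl; have bq := base_move2 hg pF sp bp kl hz hy.
have hZ := move2_hp1 sp hz hy kl; have hY := hp_rot (move2_hp2 sp hz hy kl).
have ik : i != k by rewrite eq_sym.
have jk : j != k by rewrite eq_sym.
have il : i != l by rewrite eq_sym.
have jl : j != l by rewrite eq_sym.
have hx2 : hp (move2 p z' y) i x x'.
  by apply: hp_eq hx; rewrite (move2_other sp hz hy).
have hu2 : hp (move2 p z' y) j u u'.
  by apply: hp_eq hu; rewrite (move2_other sp hz hy).
have e0 : E (x' - u') (y' - z') (z + y) (x + u) = 0.
  by apply: (centre_diff0 hg pF sq bq kl hZ hY ik jk ij hx2 hu2); sfc.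
have t : ty (y' - z') (x' - u').
  by apply: (ty_um (x0 := - y) (y0 := - x)); side.
have -> : z' - y' = - (y' - z') by lmod.
rewrite (ENl hg pF t); last by side.
by rewrite -(EC hg pF t) //; side.
Qed.
End Four.

Lemma E_NNl a b : ty a b -> sform a b = 0 -> E (- a) b (- a) b = E a b a b.
Proof.
move=> tab ab; have h := E_alt (tame_ty hg pF tab).
have pe : perp (- a) b a b by split; sfc.
by rewrite (ENl hg pF tab pe) (altNl h) opprK.
Qed.

(** [quad_split] on the plane of z and a fourth plane leaves two terms, both instances of [four0] up
    to sign and a quarter turn. *)
Lemma tri0 i j k x x' u u' z z' : i != j -> k != i -> k != j ->
  hp p i x x' -> hp p j u u' -> hp p k z z' ->
  E (x' - u') (z + z') (x + u) (z + z') = 0.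
Proof.
move=> ij ki kj hx hu hz; have [l [li lj lk]] := fourth_ord hg i j k.
have kl : k != l by rewrite eq_sym.
have hy := hp0 p l; move: (p l).1 (p l).2 hy => y y' hy.
have e1 := four0 ij ki kj li lj kl hx hu hz hy.
have e2 := four0 ij ki kj li lj kl hx hu (hp_rot hz) hy.
frame2 sp hx hu ij; frame2 sp hz hy kl; hp2 sp hz hx ki; hp2 sp hz hu kj.
hp2 sp hy hx li; hp2 sp hy hu lj.
have ta : ty (z + y') (x' - u') by apply: (ty_um (x0 := z') (y0 := - x)); side.
have tT : ty (x' - u') (z + z') by apply: (ty_um (x0 := - x) (y0 := z')); side.
rewrite (E_flip hg pF tT); last by side.
have nb e e' m : m != i -> m != j -> hp p m e e' -> null F e (x + u).
  move=> mi mj he; frame2 sp he hx mi; hp2 sp he hu mj.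
  have te : ty e (x + u) by apply: (ty_um (x0 := e') (y0 := x')); side.
  by apply: (inV_null hg pF (Vp he) (hp_um sp he) _ _ te); side.
rewrite (quad_split hg pF sp kl hz hy (a := x' - u') (b := x + u) (a0 := - x) (b0 := u'));
  try by side.
- rewrite e1 add0r; move: e2; have -> : - z - y' = - (z + y') by lmod.
  rewrite (ENl hg pF ta); last by side.
  by move=> /eqP; rewrite oppr_eq0 => /eqP.
- exact: nb hz.
- exact: nb (hp_rot hz).
- exact: nb hy.
Qed.

(** [quad_split] once more, on the plane of x and a third plane; the two terms are instances of
    [tri0]. *)
Lemma move1_N i k x x' z z' : k != i -> hp p i x x' -> hp p k z z' ->
  E (x + x') (z + z') (x + x') (z + z') = 0.
Proof.
move=> ki hx hz; have [j [ji jk _]] := fourth_ord hg i k k.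
have ij : i != j by rewrite eq_sym.
have kj : k != j by rewrite eq_sym.
have hu := hp0 p j; move: (p j).1 (p j).2 hu => u u' hu.
have e1 := tri0 ij ki kj hx hu hz; have e2 := tri0 ij ki kj (hp_rot hx) hu hz.
frame2 sp hx hu ij; frame2 sp hz hx ki; hp2 sp hz hu kj.
have ta : ty (x + u') (z + z') by apply: (ty_um (x0 := x') (y0 := z')); side.
have nb e e' m : m != k -> hp p m e e' -> null F e (z + z').
  move=> mk he; frame2 sp he hz mk.
  have te : ty e (z + z') by apply: (ty_um (x0 := e') (y0 := z')); side.
  by apply: (inV_null hg pF (Vp he) (hp_um sp he) _ _ te); side.
have ik : i != k by rewrite eq_sym.
rewrite (quad_split hg pF sp ij hx hu (a := z + z') (b := z + z') (a0 := z') (b0 := z'));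
  try by side.
- rewrite e1 add0r; move: e2; have -> : - x - u' = - (x + u') by lmod.
  rewrite (ENl hg pF ta); last by side.
  by move=> /eqP; rewrite oppr_eq0 => /eqP.
- exact: nb hx.
- exact: nb (hp_rot hx).
- exact: nb hu.
Qed.

Section Base1.
Variables (i : 'I_g) (x x' : H g).
Hypothesis hx : hp p i x x'.
Let q := move1 p x'.
Let sq : symp q := move1_symp sp hx.
Let hX : hp q i (x + x') x' := move1_hp sp hx.

Let q_other k e e' : k != i -> hp q k e e' -> hp p k e e'.
Proof. by move=> ki; apply: hp_eq; apply: (move1_other sp hx ki). Qed.

Let Q1 l c c' : l != i -> hp q l c c' -> sig (x + x') x' c c' = 0.
Proof.
move=> li hc; have {}hc := q_other li hc; have il : i != l by rewrite eq_sym.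
frame2 sp hx hc il.
have i1 : (- 1 : rat) \is a Num.int by rewrite rpredN rpred1.
(* With the rotated pairs (x', -x) and (-c', c), the twist m = -1 involves x' - c' and -(x + x' +
   c), the two factors of [sig] up to sign. *)
have e0 := twist0 hg pF sp Vp Qp il (hp_rot hx) (hp_rotV hc) i1.
have tP : ty (x' - c') (- x - c + -1 *: x').
  by apply: (ty_um (x0 := c) (y0 := - x')); side.
have z0 : sform (x' - c') (- x - c + -1 *: x') = 0 by sfc.
have t2 := ty_sym (ty_opp (ty_sym tP)).
rewrite /sig; have -> : x + x' + c = - (- x - c + -1 *: x') by lmod.
rewrite (E_CC hg pF t2); last by rewrite sformNr z0 oppr0.
by rewrite (E_NN hg pF tP z0).
Qed.

Lemma base_move1 : base F q.
Proof.
have Vq k e e' : k != i -> hp q k e e' -> inV F e.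
  by move=> ki he; apply: Vp (q_other ki he).
have Vi : inV F x' by apply: Vp (hp_rot hx).
split.
- move=> k l t t' w w' kl ht hw; have tw := hp_ty sq kl ht hw; have lk : l != k by rewrite eq_sym.
  have [it _] := hp_int sq ht; have [iw _] := hp_int sq hw.
  have [e1 _ _ _] := hp_diff sq ht hw kl; have [e2 _ _ _] := hp_diff sq hw ht lk.
  have [ki|ki] := eqVneq k i; last first.
    exact: (inV_null hg pF (Vq _ _ _ ki ht) (hp_um sq ht) iw e1 tw).
  have li : l != i by rewrite -ki.
  apply: (nullC hg pF (ty_sym tw)).
  exact: (inV_null hg pF (Vq _ _ _ li hw) (hp_um sq hw) it e2 (ty_sym tw)).
- move=> k u v pe; have [ki|ki] := eqVneq k i; last first.
    exact: (base_um_inV hg pF sq (hp0 q k) (Vq _ _ _ ki (hp0 q k)) pe).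
  subst k; exact: (base_um_inV hg pF sq (hp_rot hX) Vi pe).
- move=> k l t t' w w' kl ht hw; have lk : l != k by rewrite eq_sym.
  have [ki|ki] := eqVneq k i; last by left; apply: (DD_inV sq kl ht hw (Vq _ _ _ ki ht)).
  have li : l != i by rewrite -ki.
  by right; apply: (DD_inV sq lk hw ht (Vq _ _ _ li hw)).
- move=> k l t t' c c' kl ht hc; left.
  have [ki|ki] := eqVneq k i; last by apply: (N_inV hg pF sq kl ht hc (Vq _ _ _ ki ht)).
  subst k; have li : l != i by rewrite eq_sym.
  have hc' := q_other li hc; have e0 := move1_N li hx hc'.
  frame2 sp hc' hx li.
  have tX : ty (c + c') (x + x') by apply: (ty_um (x0 := c') (y0 := x')); side.
  have zX : sform (c + c') (x + x') = 0 by sfc.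
  have [[-> _]|[-> _]|[-> _]|[-> _]] := hp_trans hX ht => //.
  + have t1 : ty x' (c + c') by apply: (ty_um (x0 := - x) (y0 := c')); side.
    apply: (inV_null hg pF Vi (hp_um sq (hp_rot hX)) _ _ t1); side.
  + have zX' : sform (x + x') (c + c') = 0 by sfc.
    by rewrite (E_NNl (ty_sym tX) zX').
  + have t1 : ty (- x') (c + c') by apply: (ty_um (x0 := x) (y0 := c')); side.
    apply: (inV_null hg pF (Vp (hp_rotV hx)) (hp_um sp (hp_rotV hx)) _ _ t1); side.
- have half k l t t' c c' : k != l -> hp q k t t' -> hp q l c c' -> k = i ->
    sig t t' c c' = 0.
    move=> kl ht hc ki; subst k; have li : l != i by rewrite eq_sym.
    have il : i != l by [].
    have e4 := sig_rot1 hg pF sq il (hp_neg hX) hc; rewrite opprK in e4.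
    have [[-> ->]|[-> ->]|[-> ->]|[-> ->]] := hp_trans hX ht.
    + exact: Q1 li hc.
    + rewrite (sig_rot1 hg pF sq il hX hc); exact: Q1 li (hp_rot hc).
    + rewrite (sig_neg hg pF sq il hX hc); exact: Q1 li (hp_neg hc).
    + rewrite e4 (sig_neg hg pF sq il hX (hp_rot hc)) opprK; exact: Q1 li (hp_rotV hc).
  move=> k l t t' c c' kl ht hc; have [ki|ki] := eqVneq k i.
    by left; apply: half kl ht hc ki.
  have lk : l != k by rewrite eq_sym.
  have [li|li] := eqVneq l i.
    by left; rewrite -(sig_sym hg pF sq kl ht hc); apply: half lk hc ht li.
  exact: (Qp kl (q_other ki ht) (q_other li hc)).
Qed.

End Base1.
End Move1.

Section Vanish.
Variables (g : nat) (hg : (4 <= g)%N) (M : lmodType rat).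
Variable F : H g -> H g -> H g -> H g -> M.
Hypothesis pF : pform F.

Theorem base_vanish p : symp p -> base F p ->
  forall a b z w, um a b -> perp a b z w -> F a b z w = 0.
Proof.
move=> sp bp a b z w uab pe.
have m1 q i x x' : symp q -> base F q -> predT i -> hp q i x x' -> base F (move1 q x').
  by move=> sq bq _ hx; apply: (base_move1 hg pF sq bq hx).
have m2 q i j x x' y y' : symp q -> base F q -> predT i -> predT j -> i != j ->
    hp q i x x' -> hp q j y y' -> base F (move2 q x' y).
  by move=> sq bq _ _ ij hx hy; apply: (base_move2 hg pF sq bq ij hx hy).
have [//|q [i [a' [sq bq _ ha _]]]] := euclid m1 m2 uab sp bp.
by apply: (basis_inV hg pF sq bq ha) => //; apply: perpC.
Qed.

End Vanish.

(** * Extension to a quadrilinear form *)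

Section QForm.
Variables (g : nat) (hg : (4 <= g)%N) (M : lmodType rat).
Implicit Types (x y z w u v : H g) (B : H g -> H g -> H g -> H g -> M).

Definition qform B := (forall z w, alt_bilinear (fun u v => B u v z w)) /\
  (forall u v z w, B u v z w = B z w u v).

Lemma qform_altl B z w : qform B -> alt_bilinear (fun u v => B u v z w).
Proof. by case. Qed.

Lemma qform_altr B u v : qform B -> alt_bilinear (B u v).
Proof.
case=> h s; have -> : B u v = (fun z w => B z w u v) by do 2!apply/funext => ?; rewrite s.
exact: h.
Qed.

Lemma qform_add B B' : qform B -> qform B' -> qform (fun u v z w => B u v z w + B' u v z w).
Proof.
move=> [h s] [h' s']; split=> [z w|u v z w]; last by rewrite s s'.
exact: alt_add.
Qed.

Variable F : H g -> H g -> H g -> H g -> M.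
Hypothesis pF : pform F.

Lemma sub_pform B : qform B -> pform (fun u v z w => F u v z w - B u v z w).
Proof.
move=> qB; split=> [a b uab|a b c d uab ucd pe].
  by apply: alt_sub; [apply: F_alt | apply: qform_altr].
by rewrite (F_sym pF uab ucd pe) (proj2 qB).
Qed.

Lemma E_sub B x y u v : qform B -> ty x y -> perp u v x y ->
  E (fun u v z w => F u v z w - B u v z w) x y u v = E F x y u v - B x y u v.
Proof.
move=> qB txy pe; have tm := tame_ty hg pF txy.
suff c : cl (fun u v z w => F u v z w - B u v z w) x y (fun u v => E F x y u v - B x y u v).
  exact: (E_uniq hg (sub_pform qB) txy c pe).
split.
  by apply: alt_sub; [apply: E_alt | apply: qform_altr].
by move=> a b uab pab; rewrite (EF tm uab pab) (proj2 qB).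
Qed.

(** The boolean distinguishes b_i from a_i in the standard basis, and [ptn] exchanges the two. *)
Definition idx : finType := ('I_g * bool)%type.
Definition ei (i : idx) : H g := if i.2 then Hb i.1 else Ha i.1.
Definition crd x (i : idx) : rat := if i.2 then coordB x i.1 else coordA x i.1.
Definition ptn (i : idx) : idx := (i.1, ~~ i.2).

Lemma ptnK : involutive ptn. Proof. by case=> i s; rewrite /ptn /= negbK. Qed.

Lemma crd_ei i j : crd (ei i) j = (j == i)%:R.
Proof.
case: i j => i [] [j []]; rewrite /crd /ei /= ?coordAa ?coordAb ?coordBa ?coordBb //;
by rewrite -pair_eqE /pair_eq /= ?andbT ?andbF.
Qed.

Lemma crdP a x y i : crd (a *: x + y) i = a * crd x i + crd y i.
Proof. by rewrite /crd /coordA /coordB; case: i.2; rewrite !mxE. Qed.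

Definition quad (m : idx -> idx -> idx -> idx -> M) u v z w : M :=
  \sum_(q : (idx * idx) * (idx * idx))
    (crd u q.1.1 * crd v q.1.2 * (crd z q.2.1 * crd w q.2.2)) *:
      m q.1.1 q.1.2 q.2.1 q.2.2.

Lemma quad_ei m i j k l : quad m (ei i) (ei j) (ei k) (ei l) = m i j k l.
Proof.
rewrite /quad (bigD1 ((i, j), (k, l))) //= !crd_ei !eqxx !mulr1 scale1r.
rewrite big1 ?addr0 // => [[[i1 j1] [k1 l1]]] /= ne; rewrite !crd_ei.
have [ei|/negPf _] := eqVneq i1 i; last by rewrite !mul0r scale0r.
have [ej|/negPf _] := eqVneq j1 j; last by rewrite mulr0 mul0r scale0r.
have [ek|/negPf _] := eqVneq k1 k; last by rewrite mul0r mulr0 scale0r.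
have [el|/negPf _] := eqVneq l1 l; last by rewrite !mulr0 scale0r.
by case/eqP: ne; rewrite ei ej ek el.
Qed.

Lemma quad_qform m : (forall i j k l, m j i k l = - m i j k l) ->
  (forall i j k l, m k l i j = m i j k l) -> qform (quad m).
Proof.
move=> ma ms.
have anti u v z w : quad m v u z w = - quad m u v z w.
  rewrite /quad -sumrN.
  rewrite (reindex_inj (h := fun q : (idx * idx) * (idx * idx) => ((q.1.2, q.1.1), q.2))) /=.
    apply: eq_bigr => [[[i j] [k l]]] _ /=; rewrite ma scalerN; congr (- (_ *: _)); ring.
  by move=> [[a b] c] [[a' b'] c'] [-> -> ->].
have lin a u u' v z w : quad m (a *: u + u') v z w = a *: quad m u v z w + quad m u' v z w.
  rewrite /quad scaler_sumr -big_split; apply: eq_bigr => q _ /=.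
  rewrite crdP; lmod.
split=> [z w|u v z w].
  split=> [u|a u u' v|a u v v']; last 2 first.
  - exact: lin.
  - by rewrite anti lin [quad m v _ _ _]anti [quad m v' _ _ _]anti; lmod.
  by apply: lmod_half; rewrite {1}anti addNr.
rewrite /quad (reindex_inj (h := fun q : (idx * idx) * (idx * idx) => (q.2, q.1))) /=.
  by apply: eq_bigr => [[[i j] [k l]]] _ /=; rewrite ms; congr (_ *: _); ring.
by move=> [a b] [a' b'] [-> ->].
Qed.

End QForm.

Section Idx.
Variable g : nat.
Implicit Types (i j k l : idx g) (u v x : H g).

(** The sign that makes [ei i] and [eps i *: ei (ptn i)] a symplectic pair. *)
Definition eps i : rat := if i.2 then -1 else 1.
Definition ep i : H g := eps i *: ei (ptn i).

Lemma eps2 i : eps i * eps i = 1.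
Proof. by rewrite /eps; case: i.2; ring. Qed.

Lemma hp_ei i : hp (@stdp g) i.1 (ei i) (ep i).
Proof.
case: i => i []; rewrite /hp /ei /ep /eps /ptn /=.
  by constructor 2; rewrite scaleN1r.
by constructor 1; rewrite scale1r.
Qed.

Lemma hp_idx (k : 'I_g) x x' : hp (@stdp g) k x x' ->
  exists2 i, i.1 = k & (x = ei i /\ x' = ep i) \/ (x = - ei i /\ x' = - ep i).
Proof.
case=> [] [-> ->]; rewrite /ep /eps /ei.
- by exists (k, false); rewrite //= scale1r; left.
- by exists (k, true); rewrite //= scaleN1r; left.
- by exists (k, false); rewrite //= scale1r; right.
- by exists (k, true); rewrite //= scaleN1r opprK; right.
Qed.

Lemma sform_crd u i : sform u (ei i) = - eps i * crd u (ptn i).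
Proof.
by case: i => i []; rewrite /ei /eps /crd /= ?sform_a ?sform_b ?opprK ?mul1r ?mulN1r.
Qed.

Lemma ei_perp i j : j != ptn i -> sform (ei i) (ei j) = 0.
Proof.
move=> n; rewrite sform_crd crd_ei; case: eqP => [e|_]; last by rewrite mulr0.
by move: n; rewrite -e ptnK eqxx.
Qed.

Lemma ptn_eq i j : (ptn i == ptn j) = (i == j).
Proof. exact: (inj_eq (can_inj (@ptnK g))). Qed.

Lemma ptn_plane i j : i.1 = j.1 -> i != j -> j = ptn i.
Proof.
case: i j => i s [j t] /= ->; rewrite /ptn /= => ne; congr (_, _).
by case: s t ne => [] [] //; rewrite eqxx.
Qed.

Lemma ne_plane i j : i.1 != j.1 -> ((i == j) = false) * ((i == ptn j) = false) *
  ((ptn i == j) = false) * ((j == i) = false) * ((j == ptn i) = false) * ((ptn j == i) = false).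
Proof.
case: i j => i s [j t] /= /negPf n; have n' : (j == i) = false by rewrite eq_sym.
by do !split; rewrite -pair_eqE /pair_eq /= ?n ?n'.
Qed.

Lemma eqptn i : ((i == ptn i) = false) * ((ptn i == i) = false).
Proof.
case: i => i s; split; rewrite -pair_eqE /pair_eq /= ?eqxx;
by case: s.
Qed.

Lemma ei_decomp u : u = \sum_i crd u i *: ei i.
Proof.
apply/rowP => k; rewrite summxE; case: (split_ordP k) => j ->.
  rewrite (bigD1 (j, false)) //= big1 ?addr0 => [|[i s]].
    by rewrite mxE /ei /= mxE !eqxx mulr1.
  rewrite mxE /ei /crd /=; case: s => /=; rewrite mxE ?eqxx /= ?eq_lrshift ?mulr0 //.
  rewrite (inj_eq (@lshift_inj _ _)) => ne; case: eqP => [e|_]; last by rewrite mulr0.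
  by rewrite e eqxx in ne.
rewrite (bigD1 (j, true)) //= big1 ?addr0 => [|[i s]].
  by rewrite mxE /ei /= mxE !eqxx mulr1.
rewrite mxE /ei /crd /=; case: s => /=; rewrite mxE ?eqxx /= ?eq_rlshift ?mulr0 //.
rewrite (inj_eq (@rshift_inj _ _)) => ne; case: eqP => [e|_]; last by rewrite mulr0.
by rewrite e eqxx in ne.
Qed.

Lemma ei_expand0 (M : lmodType rat) (f : H g -> M) u : linear f ->
  (forall k, crd u k != 0 -> f (ei k) = 0) -> f u = 0.
Proof.
move=> lf f0.
have f00 : f 0 = 0.
  have := lf 1 0 0; rewrite scaler0 addr0 scale1r => e.
  by apply: (addrI (f 0)); rewrite addr0; apply: esym.
have fD x y : f (x + y) = f x + f y by rewrite -[x in LHS]scale1r lf scale1r.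
have fZ a x : f (a *: x) = a *: f x by rewrite -[a *: x]addr0 lf f00 addr0.
rewrite (ei_decomp u) (big_morph f fD f00) big1 // => k _.
have [->|ne] := eqVneq (crd u k) 0; first by rewrite scale0r.
by rewrite fZ f0 ?scaler0.
Qed.

Lemma crd_perp u i k : sform u (ei i) = 0 -> crd u k != 0 -> k != ptn i.
Proof.
move=> e; apply: contra => /eqP ->; move: e; rewrite sform_crd /eps.
by case: i.2; rewrite ?opprK ?mul1r ?mulN1r => /eqP; rewrite ?oppr_eq0.
Qed.

End Idx.

(** * Symmetry of E on the standard basis *)

Section Stages.
Variables (g : nat) (hg : (4 <= g)%N) (M : lmodType rat).
Implicit Types (i j k l c t : idx g) (x y z u v : H g).

Definition iperp i j k l := [&& k != ptn i, l != ptn i, k != ptn j & l != ptn j].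

Lemma iperp_perp i j k l : iperp i j k l -> perp (ei k) (ei l) (ei i) (ei j).
Proof. by case/and4P=> *; split; rewrite sformC ei_perp ?oppr0. Qed.

Lemma iperpC i j k l : iperp k l i j = iperp i j k l.
Proof.
rewrite /iperp; have s a b : (a != ptn b) = (b != @ptn g a).
  by apply/idP/idP; apply: contra => /eqP ->; rewrite ptnK.
by rewrite (s i k) (s j k) (s i l) (s j l); do 4!case: eqP.
Qed.

Lemma ei_ty i j : i != j -> ty (ei i) (ei j).
Proof.
move=> ij; have sp := stdp_symp g; have [e|n] := eqVneq i.1 j.1; last first.
  exact: (hp_ty sp n (hp_ei i) (hp_ei j)).
have -> := ptn_plane e ij; have := hp_um sp (hp_ei i).
rewrite /ep /eps; case: i.2 => [u|]; last by rewrite scale1r; constructor 1.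
by have := um_rot u; rewrite scaleN1r => u'; constructor 2;
   have := um_rot (um_rot u'); rewrite !opprK.
Qed.

Section One.
Variable F : H g -> H g -> H g -> H g -> M.
Hypothesis pF : pform F.
Local Notation E := (E F).

Lemma E_ei_anti i j k l : i != j -> iperp i j k l ->
  E (ei j) (ei i) (ei k) (ei l) = - E (ei i) (ei j) (ei k) (ei l).
Proof. by move=> ij pe; rewrite (EC hg pF (ei_ty ij)) //; apply: iperp_perp. Qed.

Lemma symF2 x y z w : um x y \/ um y x -> ty z w -> perp x y z w -> E x y z w = E z w x y.
Proof.
case=> u tz pe; first exact: symF.
have ty' : ty x y by constructor 2.
have tx : ty y x by constructor 1.
have pz := perpC pe; rewrite (EC hg pF tx); last by case: pz => *; split.
rewrite (symF hg pF u tz); last by case: pe => *; split.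
by rewrite -(altC (E_alt (tame_ty hg pF tz))).
Qed.

(** Excluding these coincidences gives the partners [ep] the orthogonality required by [sym4]. In
    [E_ei_sym] the other cases are reduced to this one by exchanging indices. *)
Let core i j k l : i.1 != j.1 -> k.1 != l.1 -> iperp i j k l ->
  k != i -> l != i -> k != j ->
  E (ei i) (ei j) (ei k) (ei l) = E (ei k) (ei l) (ei i) (ei j).
Proof.
move=> ij kl /and4P[n1 n2 n3 n4] ki li kj; have sp := stdp_symp g.
frame2 sp (hp_ei i) (hp_ei j) ij; frame2 sp (hp_ei k) (hp_ei l) kl.
have a1 : sform (ei i) (ei k) = 0 by apply: ei_perp.
have a2 : sform (ei i) (ei l) = 0 by apply: ei_perp.
have a3 : sform (ei j) (ei k) = 0 by apply: ei_perp.
have a4 : sform (ei j) (ei l) = 0 by apply: ei_perp.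
have b1 : sform (ep i) (ei k) = 0 by rewrite /ep sformZl ei_perp ?mulr0 // ptnK.
have b2 : sform (ep i) (ei l) = 0 by rewrite /ep sformZl ei_perp ?mulr0 // ptnK.
have b3 : sform (ei i) (ep k) = 0 by rewrite /ep sformZr ei_perp ?mulr0 // ptn_eq.
have b4 : sform (ei j) (ep k) = 0 by rewrite /ep sformZr ei_perp ?mulr0 // ptn_eq.
have b5 : sform (ep i) (ep k) = 0.
  rewrite /ep sformZl sformZr ei_perp ?mulr0 // ptnK.
  by apply: contra n1 => /eqP <-; rewrite ptnK.
by apply: (sym4 hg pF (x0 := ep i) (y0 := ep j) (z0 := ep k) (w0 := ep l)) => //;
  apply: (hp_um sp (hp_ei _)).
Qed.

Lemma E_ei_sym i j k l : i != j -> k != l -> iperp i j k l ->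
  E (ei k) (ei l) (ei i) (ei j) = E (ei i) (ei j) (ei k) (ei l).
Proof.
move=> ij kl pe; have pk := iperp_perp pe.
have pe' : iperp k l i j by rewrite iperpC.
have pi := iperp_perp pe'.
have um2 (a b : idx g) : a != b -> a.1 = b.1 -> um (ei a) (ei b) \/ um (ei b) (ei a).
  move=> ab e1; have := hp_um (stdp_symp g) (hp_ei a); rewrite /ep -(ptn_plane e1 ab) /eps.
  case: a.2 => [u|]; last by rewrite scale1r; left.
  by right; have := um_rot (um_rot (um_rot u)); rewrite scaleN1r !opprK.
have [e|pij] := eqVneq i.1 j.1; first by rewrite (symF2 (um2 _ _ ij e) (ei_ty kl)).
have [e|pkl] := eqVneq k.1 l.1; first by rewrite (symF2 (um2 _ _ kl e) (ei_ty ij)).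
have flip (a b c d : idx g) : a != b -> c != d -> iperp a b c d ->
    E (ei a) (ei b) (ei c) (ei d) = E (ei b) (ei a) (ei d) (ei c).
  by move=> ab cd pa; apply: (E_flip hg pF (ei_ty ab)); apply: iperp_perp.
have ji : j != i by rewrite eq_sym.
have lk : l != k by rewrite eq_sym.
have pji : j.1 != i.1 by rewrite eq_sym.
have plk : l.1 != k.1 by rewrite eq_sym.
have p2 : iperp j i k l by move: pe; rewrite /iperp => /and4P[-> -> -> ->].
have p3 : iperp i j l k by move: pe; rewrite /iperp => /and4P[-> -> -> ->].
have p4 : iperp j i l k by move: pe; rewrite /iperp => /and4P[-> -> -> ->].
have al := altC (E_alt (tame_ty hg pF (ei_ty ij))) (ei l) (ei k).
have al' := altC (E_alt (tame_ty hg pF (ei_ty kl))) (ei j) (ei i).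
have s2 : E (ei l) (ei k) (ei i) (ei j) = - E (ei k) (ei l) (ei i) (ei j) by apply: E_ei_anti.
have s3 : E (ei j) (ei i) (ei k) (ei l) = - E (ei i) (ei j) (ei k) (ei l) by apply: E_ei_anti.
have s4 : E (ei j) (ei i) (ei l) (ei k) = E (ei i) (ei j) (ei k) (ei l) by apply: flip; rewrite // 1?eq_sym.
have s5 : E (ei l) (ei k) (ei j) (ei i) = E (ei k) (ei l) (ei i) (ei j).
  by apply: flip; rewrite // iperpC.
have [eik|nik] := eqVneq k i.
  have [ejl|njl] := eqVneq l j; first by rewrite eik ejl.
  subst k; rewrite -s4 -s5; exact: (esym (core pji plk p4 njl ij lk)).
have [eil|nil] := eqVneq l i.
  have [ejk|njk] := eqVneq k j.
    subst l k; exact: (flip _ _ _ _ ji ij p4).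
  subst l; apply: oppr_inj; rewrite -s3 -al'.
  exact: (esym (core pji pkl p2 njk ij nik)).
have [ejk|njk] := eqVneq k j; last exact: (esym (core pij pkl pe nik nil njk)).
subst k; apply: oppr_inj; rewrite -s2 -al.
exact: (esym (core pij plk p3 nil nik lk)).
Qed.

End One.
End Stages.

(** * Construction of B in three stages *)

Section Stages.
Variables (g : nat) (hg : (4 <= g)%N) (M : lmodType rat).
Implicit Types (i j k l c t : idx g) (x y z u v : H g).

Definition nulls (F : H g -> H g -> H g -> H g -> M) :=
  forall i j, i != j -> null F (ei i) (ei j).

Lemma iperp_expand i j (f : H g -> H g -> M) u v : alt_bilinear f ->
  perp u v (ei i) (ei j) -> (forall k l, iperp i j k l -> f (ei k) (ei l) = 0) ->
  f u v = 0.
Proof.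
move=> hf [ui uj vi vj] f0.
apply: (@ei_expand0 _ _ (f^~ v)); first exact: alt_linl.
move=> k nk; apply: (@ei_expand0 _ _ (f (ei k))); first exact: alt_linr.
move=> l nl; apply: f0; apply/and4P; split.
- exact: crd_perp ui nk.
- exact: crd_perp vi nl.
- exact: crd_perp uj nk.
- exact: crd_perp vj nl.
Qed.

Section Stage1.
Variable F : H g -> H g -> H g -> H g -> M.
Hypothesis pF : pform F.
Let m1 i j k l := if [&& i != j, k != l & iperp i j k l] then E F (ei i) (ei j) (ei k) (ei l) else 0.

Lemma stage1 : exists B, qform B /\ nulls (fun u v z w => F u v z w - B u v z w).
Proof.
have q1 : qform (quad m1).
  apply: quad_qform => i j k l; rewrite /m1.
    have -> : iperp j i k l = iperp i j k l.
      by rewrite /iperp; do 4!case: (_ != _).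
    rewrite (eq_sym j i); case: ifP => [/and3P[ij kl pe]|]; last by rewrite oppr0.
    exact: (E_ei_anti hg pF ij pe).
  rewrite iperpC; have -> : [&& k != l, i != j & iperp i j k l] = [&& i != j, k != l & iperp i j k l].
    by case: (k != l); case: (i != j).
  by case: ifP => // /and3P[ij kl pe]; apply: (E_ei_sym hg pF).
exists (quad m1); split=> // i j ij u v pe.
have tm := tame_ty hg pF (ei_ty ij); have hE := E_alt tm.
rewrite (E_sub hg pF q1 (ei_ty ij) pe).
apply: (iperp_expand (f := fun u v => E F (ei i) (ei j) u v - quad m1 (ei i) (ei j) u v) _ pe).
  by apply: alt_sub => //; apply: qform_altr.
move=> k l pk; rewrite quad_ei /m1 ij pk andbT /=.
by case: eqVneq => [->|_]; rewrite ?(altxx hE) subrr.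
Qed.
End Stage1.

(* gf c t w is the coefficient of (c /\ t).(ptn c /\ w). *)
Definition cG (gf : idx g -> idx g -> idx g -> M) i j k l : M :=
  if k == ptn i then gf i j l else 0.
(** [cG] antisymmetrized in i, j and in k, l, as [quad_qform] demands. *)
Definition mG gf i j k l : M := cG gf i j k l - cG gf j i k l - cG gf i j l k + cG gf j i l k.

Lemma mG_qform gf : (forall c t (w : idx g), gf (ptn c) w t = gf c t w) -> qform (quad (mG gf)).
Proof.
move=> hs; have s i j k l : cG gf k l i j = cG gf i j k l.
  rewrite /cG; have -> : (i == ptn k) = (k == ptn i).
    by apply/eqP/eqP => ->; rewrite ptnK.
  by case: eqP => // ->; rewrite hs.
by apply: quad_qform => i j k l; rewrite /mG; [lmod | rewrite !(s k l) !(s l k); lmod].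
Qed.

(** Coefficients with a contraction do not touch the orthogonal quadruples, which is why the later
    stages preserve [nulls]. *)
Lemma mG_perp gf i j k l : iperp i j k l -> mG gf i j k l = 0.
Proof.
by case/and4P => /negPf a /negPf b /negPf c /negPf d; rewrite /mG /cG a b c d; lmod.
Qed.

Lemma nulls_sub F gf : pform F -> (forall c t (w : idx g), gf (ptn c) w t = gf c t w) ->
  nulls F -> nulls (fun u v z w => F u v z w - quad (mG gf) u v z w).
Proof.
move=> pF hs nF i j ij u v pe; have q1 := mG_qform hs.
rewrite (E_sub hg pF q1 (ei_ty ij) pe) (nF _ _ ij) // sub0r.
apply/eqP; rewrite oppr_eq0; apply/eqP.
apply: (iperp_expand (f := quad (mG gf) (ei i) (ei j)) _ pe); first exact: qform_altr.
by move=> k l pk; rewrite quad_ei mG_perp.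
Qed.

(** [condD], [condN] and [condQ] are the cases of [base_D], [base_N] and [base_Q] for the standard
    basis, in one sign or order, so that the coefficients can be solved for. *)
Definition condD F := forall t (w : idx g) c, (t.1 < w.1)%N -> c.1 != t.1 -> w != ptn c ->
  F (ei t) (ei c + ep t) (ep c + ei t) (ei w) = 0 :> M.
Definition condN (F : H g -> H g -> H g -> H g -> M) := forall t c, t.1 != c.1 ->
  E F (ei t) (ei c + ei (ptn c)) (ei t) (ei c + ei (ptn c)) = 0.

Lemma mG_D gf t (w : idx g) c : qform (quad (mG gf)) -> t.1 != w.1 -> c.1 != t.1 -> w != ptn c ->
  quad (mG gf) (ei t) (ei c + ep t) (ep c + ei t) (ei w) =
  - eps c *: gf c t w - eps t *: gf (ptn t) t w.
Proof.
move=> q1 tw ct /negPf wc; have h1 := qform_altl _ _ q1.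
have tc : t.1 != c.1 by rewrite eq_sym.
rewrite /ep.
rewrite (altDr (qform_altl (eps c *: ei (ptn c) + ei t) (ei w) q1)).
rewrite (altZr (qform_altl (eps c *: ei (ptn c) + ei t) (ei w) q1)).
rewrite !(altDl (qform_altr _ _ q1)) !(altZl (qform_altr _ _ q1)) !quad_ei /mG /cG.
rewrite !ptnK !eqxx !ptn_eq !eqptn !(ne_plane tw) !(ne_plane tc) wc.
by lmod.
Qed.

Lemma mG_N gf t c : qform (quad (mG gf)) -> t.1 != c.1 ->
  quad (mG gf) (ei t) (ei c + ei (ptn c)) (ei t) (ei c + ei (ptn c)) =
  gf c t t + gf (ptn c) t t.
Proof.
move=> q1 tc.
rewrite (altDr (qform_altl (ei t) (ei c + ei (ptn c)) q1)).
rewrite !(altDr (qform_altr _ _ q1)) !quad_ei /mG /cG.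
rewrite !ptnK !eqxx !ptn_eq !eqptn !(ne_plane tc).
by lmod.
Qed.

Lemma diag_ty t c : t.1 != c.1 -> ty (ei t) (ei c + ei (ptn c)) /\
  perp (ei t) (ei c + ei (ptn c)) (ei t) (ei c + ei (ptn c)).
Proof.
move=> tc; have sp := stdp_symp g.
have -> : ei (ptn c) = eps c *: ep c by rewrite /ep scalerA eps2 scale1r.
have ie : eps c \is a Num.int by rewrite /eps; case: c.2; rewrite ?rpredN rpred1.
move: (hp_ei t) (hp_ei c) ie; move: (ei t) (ep t) (ei c) (ep c) (eps c) => a a' b b' e ha hb ie.
frame2 sp ha hb tc; split; last by side.
by apply: (ty_um (x0 := a') (y0 := b')); side.
Qed.

Section Stage2.
Variable F : H g -> H g -> H g -> H g -> M.
Hypotheses (pF : pform F) (nF : nulls F).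
(** [mG_N] prescribes only the sum of the coefficients for c and [ptn c]; it is shared equally. *)
Let N5 c t := 2^-1 *: E F (ei t) (ei c + ei (ptn c)) (ei t) (ei c + ei (ptn c)).
(** [mG_D] prescribes only a combination of two coefficients; the one with c in the plane of t is
    normalized to 0. *)
Let g0 c t (w : idx g) := if c.1 == t.1 then 0 else
  - eps c *: F (ei t) (ei c + ep t) (ep c + ei t) (ei w).
(** The case w = [ptn t] has two contractions and is left to the third stage; for t.1 > w.1 the
    value is dictated by the symmetry [hs]. *)
Let gf c t w := if t == w then N5 c t else if w == ptn t then 0 else
  if (t.1 < w.1)%N then g0 c t w else g0 (ptn c) w t.

Lemma stage2 : exists B, [/\ qform B, nulls (fun u v z w => F u v z w - B u v z w),
  condD (fun u v z w => F u v z w - B u v z w) &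
  condN (fun u v z w => F u v z w - B u v z w)].
Proof.
have hs c t w : gf (ptn c) w t = gf c t w.
  rewrite /gf (eq_sym w); case: eqVneq => [->|tw]; first by rewrite /N5 ptnK addrC.
  have -> : (t == ptn w) = (w == ptn t) by apply/eqP/eqP => ->; rewrite ptnK.
  case: eqVneq => // wt; have n1 : t.1 != w.1.
    by apply: contra wt => /eqP e; rewrite (ptn_plane e tw).
  by rewrite ptnK; case: ltngtP n1 => // /val_inj ->; rewrite eqxx.
have q1 := mG_qform hs; exists (quad (mG gf)); split=> //.
- exact: nulls_sub.
- move=> t w c tw ct wc; have tw' : t.1 != w.1 by rewrite -val_eqE neq_ltn tw.
  rewrite (mG_D q1 tw' ct wc) /gf !(ne_plane tw') tw /g0 (negPf ct) eqxx.
  by rewrite scalerA mulrNN eps2 scale1r scaler0 subr0 subrr.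
move=> t c tc; have [t1 pe] := diag_ty tc.
rewrite (E_sub hg pF q1 t1 pe).
rewrite (mG_N q1 tc) /gf eqxx /N5 ptnK (addrC (ei (ptn c))) -scalerDl.
by rewrite (_ : 2^-1 + 2^-1 = 1 :> rat) ?scale1r ?subrr.
Qed.

End Stage2.

Definition condQ F := forall i j, i.2 = false -> (i.1 < j.1)%N ->
  sig F (ei i) (ep i) (ei j) (ep j) = 0 :> M.

Section Stage3.
Variable F : H g -> H g -> H g -> H g -> M.
Hypotheses (pF : pform F) (nF : nulls F) (dF : condD F) (oF : condN F).
(* The last coefficients are those of the products (c /\ t).(ptn c /\ ptn t); the
   condition c.1 < t.1 counts each of them once. *)
Let W0 (a b : 'I_g) s := (2^-1 * eps (b, ~~ s)) *:
  sig F (ei (a, false)) (ep (a, false)) (ei (b, ~~ s)) (ep (b, ~~ s)).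
Let gf c t w := if (w == ptn t) && (c.1 < t.1)%N then W0 c.1 t.1 (c.2 (+) t.2) else 0.

Lemma stage3 : exists B, [/\ qform B, nulls (fun u v z w => F u v z w - B u v z w),
  condD (fun u v z w => F u v z w - B u v z w),
  condN (fun u v z w => F u v z w - B u v z w) &
  condQ (fun u v z w => F u v z w - B u v z w)].
Proof.
have hs c t w : gf (ptn c) w t = gf c t w.
  rewrite /gf; have -> : (t == ptn w) = (w == ptn t) by apply/eqP/eqP => ->; rewrite ptnK.
  by case: eqVneq => //= ->; rewrite addNb addbN negbK.
have q1 := mG_qform hs; exists (quad (mG gf)); split=> //.
- exact: nulls_sub.
- move=> t w c tw ct wc; have tw' : t.1 != w.1 by rewrite -val_eqE neq_ltn tw.
  rewrite (mG_D q1 tw' ct wc) (dF tw ct wc) /gf !(ne_plane tw') /=.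
  by rewrite !scaler0 !subrr.
- move=> t c tc; have [t1 pe] := diag_ty tc.
  rewrite (E_sub hg pF q1 t1 pe) (oF tc) (mG_N q1 tc) /gf !eqptn /=.
  by rewrite addr0 subrr.
move=> i j i0 ij; have ij' : i.1 != j.1 by rewrite -val_eqE neq_ltn ij.
have sp := stdp_symp g; have t1 := sig_ty hg sp ij' (hp_ei i) (hp_ei j).
have pe : perp (ei i + ei j) (ep i - ep j) (ei i + ei j) (ep i - ep j).
  move: (hp_ei i) (hp_ei j); move: (ei i) (ep i) (ei j) (ep j) => a a' b b' ha hb.
  by frame2 sp ha hb ij'; side.
rewrite /sig (E_sub hg pF q1 t1 pe) -/(sig F _ _ _ _).
apply/eqP; rewrite subr_eq0; apply/eqP.
(* The expansion of the square contains this coefficient twice, with sign [eps j] since [eps i] is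
   1; this is the origin of the constant in [W0]. *)
have -> : sig F (ei i) (ep i) (ei j) (ep j) = (2 * eps j) *: W0 i.1 j.1 (~~ j.2).
  rewrite /W0 negbK -!surjective_pairing -i0 -surjective_pairing scalerA.
  have -> : 2 * eps j * (2^-1 * eps j) = eps j * eps j by field.
  by rewrite eps2 scale1r.
have ji : (j.1 < i.1)%N = false by apply/negbTE; rewrite -leqNgt ltnW.
rewrite /ep.
rewrite (altDl (qform_altl (ei i + ei j) (eps i *: ei (ptn i) - eps j *: ei (ptn j)) q1)).
rewrite !(altE (qform_altl (ei i + ei j) (eps i *: ei (ptn i) - eps j *: ei (ptn j)) q1)).
rewrite !(altE (qform_altr _ _ q1)) !quad_ei /mG /cG.
rewrite !ptnK !eqxx !ptn_eq !eqptn !(ne_plane ij').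
rewrite /gf /= ?ptnK ?eqxx ?ptn_eq ?eqptn ?(ne_plane ij') ?ltnn ?ij ?ji /=.
have -> : eps i = 1 by rewrite /eps i0.
by rewrite i0 /=; lmod.
Qed.

End Stage3.

(** * The corrected form satisfies [base] on the standard basis *)

Section BaseStd.
Variable F : H g -> H g -> H g -> H g -> M.
Hypotheses (pF : pform F) (nF : nulls F) (dF : condD F) (oF : condN F) (qF : condQ F).
Let sp := stdp_symp g.

Let null_sign a b : ty a b -> null F a b -> null F (- a) b.
Proof.
move=> t n; apply: (nullC hg pF (ty_sym (ty_opp t))).
by apply: (nullNr hg pF (ty_sym t)); exact: (nullC hg pF t n).
Qed.

Let std_D i j x x' y : (i.1 < j.1)%N ->
  (x = ei i /\ x' = ep i) \/ (x = - ei i /\ x' = - ep i) ->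
  y = ei j \/ y = - ei j -> DD F (@stdp g) i.1 x x' y.
Proof.
move=> ij hx hy k c c' ki /hp_idx [l lk hc] cy; subst k.
have ly : j != ptn l.
  apply/negP => /eqP ejl; have : sform (ei l) (ei j) = 0.
    move: cy; case: hc => [] [-> _]; case: hy => ->; rewrite ?sformNl ?sformNr; lra.
  rewrite sform_crd crd_ei ejl ptnK eqxx mulr1 /eps; case: (ptn l).2; lra.
have e0 := dF ij ki ly.
have F0 : F x (- ei l + x') (- ep l + x) y = 0 \/ F x (ei l + x') (ep l + x) y = 0.
  have u : um (ei i) (ei l + ep i).
    move: (hp_ei i) (hp_ei l); move: (ei i) (ep i) (ei l) (ep l) => a a' b b' ha hb.
    by have il : i.1 != l.1 by [rewrite eq_sym]; frame2 sp ha hb il; side.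
  have u2 := um_rot u; have u3 := um_rot u2.
  have hF := F_alt pF u.
  have e1 : F (ei i) (ei l + ep i) (ep l + ei i) y = 0.
    by case: hy => ->; rewrite ?(altNr hF) ?e0 ?oppr0.
  case: hx => [] [-> ->]; [right => //|left].
  (* For x = - [ei i] the symplectic pair is the half turn of the one with x = [ei i], so two
     applications of [F_rot] reduce to it. *)
  rewrite -!opprD.
  have pe : perp (ep l + ei i) y (ei i) (ei l + ep i).
    have sy : sform y (ei i) = 0 /\ sform y (ei l + ep i) = 0.
      have ji : j.1 != i.1 by rewrite -val_eqE neq_ltn ij orbT.
      have := hp_diff sp (hp_ei j) (hp_ei i) ji => -[a1 a2 _ _].
      have a3 : sform (ei j) (ei l) = 0 by rewrite sformC ei_perp ?oppr0.
      by case: hy => ->; rewrite ?sformNl sformDr ?sformNl a1 a2 a3; split; ring.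
    case: sy => s1 s2; split=> //; move: (hp_ei i) (hp_ei l); move: (ei i) (ep i) (ei l) (ep l) => a a' b b' ha hb;
    by have il : i.1 != l.1 by [rewrite eq_sym]; frame2 sp ha hb il; sfc.
  have [p1 p2 p3 p4] := pe.
  have f1 := F_rot hg pF u pe.
  have pe2 : perp (ep l + ei i) y (ei l + ep i) (- ei i) by split=> //; rewrite sformNr ?p1 ?p3 oppr0.
  have f2 := F_rot hg pF u2 pe2.
  by rewrite (altNl (F_alt pF u3)) f2 f1 e1 oppr0.
by rewrite /D0; case: hc => [] [-> ->]; rewrite ?opprK; case: F0; tauto.
Qed.

Let std_N i j x y y' : i.1 != j.1 -> x = ei i \/ x = - ei i ->
  (y = ei j /\ y' = ep j) \/ (y = - ei j /\ y' = - ep j) ->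
  E F x (y + y') x (y + y') = 0 \/ E F x (y - y') x (y - y') = 0.
Proof.
move=> ij hx hy; have [t1 pe] := diag_ty ij; have e0 := oF ij.
have z0 : sform (ei i) (ei j + ei (ptn j)) = 0 by case: pe.
have t2 : ty x (ei j + ei (ptn j)) by case: hx => -> //; apply: ty_opp.
have z1 : sform x (ei j + ei (ptn j)) = 0 by case: hx => ->; rewrite ?sformNl z0 ?oppr0.
have e1 : E F x (ei j + ei (ptn j)) x (ei j + ei (ptn j)) = 0.
  by case: hx => ->; rewrite ?(E_NNl hg pF t1 z0).
have e2 := E_NN hg pF t2 z1; rewrite e1 in e2.
have cases : (y + y' = ei j + ei (ptn j) \/ y + y' = - (ei j + ei (ptn j))) \/
    (y - y' = ei j + ei (ptn j) \/ y - y' = - (ei j + ei (ptn j))).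
  case: hy => [] [-> ->]; rewrite /ep /eps; case: j.2; rewrite ?scaleN1r ?scale1r ?opprK ?opprD ?opprK;
  tauto.
by case: cases => [] [->|->]; [left|left|right|right].
Qed.

Let std_Q (k l : 'I_g) x x' y y' : (k < l)%N -> hp (@stdp g) k x x' ->
  hp (@stdp g) l y y' -> sig F x x' y y' = 0 \/ sig F x x' (- y) (- y') = 0.
Proof.
move=> kl hx hy; have kl' : k != l by rewrite -val_eqE neq_ltn kl.
have q1 := @qF (k, false) (l, false) erefl kl.
have q2 := @qF (k, false) (l, true) erefl kl.
rewrite /ei /ep /eps /= /ei /= !scale1r in q1.
rewrite /ei /ep /eps /= /ei /= scale1r scaleN1r in q2.
have h0 := hp0 (@stdp g) k.
have A z z' : hp (@stdp g) l z z' -> sig F (Ha k) (Hb k) z z' = 0 \/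
    sig F (Ha k) (Hb k) (- z) (- z') = 0.
  by case=> [] [-> ->]; rewrite ?opprK; [left|left|right|right].
have R z z' : hp (@stdp g) l z z' -> sig F (Hb k) (- Ha k) z z' = 0 \/
    sig F (Hb k) (- Ha k) (- z) (- z') = 0.
  move=> hz; have := A _ _ (hp_rot hz).
  rewrite -(sig_rot1 hg pF sp kl' h0 hz) opprK.
  by have := sig_rot1 hg pF sp kl' h0 (hp_neg hz); rewrite opprK => ->.
have N z z' a a' : hp (@stdp g) k a a' -> hp (@stdp g) l z z' -> (sig F a a' z z' = 0 \/
    sig F a a' (- z) (- z') = 0) -> sig F (- a) (- a') z z' = 0 \/
    sig F (- a) (- a') (- z) (- z') = 0.
  move=> ha hz; rewrite (sig_neg hg pF sp kl' ha hz) (sig_neg hg pF sp kl' ha (hp_neg hz)) !opprK.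
  tauto.
case: hx => [] [-> ->].
- exact: A.
- exact: R.
- exact: (N _ _ _ _ h0 hy (A _ _ hy)).
- by have := N _ _ _ _ (hp_rot h0) hy (R _ _ hy); rewrite opprK.
Qed.

Lemma base_std : base F (@stdp g).
Proof.
split.
- move=> k l x x' y y' kl /hp_idx [i ik hx] /hp_idx [j jl hy]; subst k l.
  have ij : i != j by apply: contra kl => /eqP ->.
  have t := ei_ty ij; have n := nF ij.
  case: hx => [] [-> _]; case: hy => [] [-> _] //.
  + exact: (nullNr hg pF t).
  + exact: null_sign.
  + apply: (nullNr hg pF (ty_opp t)); exact: null_sign.
- move=> k u v pe; have uk : um (ei (k, false)) (ei (k, true)).
    exact: (hp_um sp (hp0 (@stdp g) k)).
  have ne : (k, false) != (k, true) :> idx g by rewrite -pair_eqE /pair_eq /= andbF.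
  by have := nF ne pe; rewrite (E_um pF uk pe).
- move=> k l x x' y y' kl /hp_idx [i ik hx] /hp_idx [j jl hy]; subst k l.
  have wk (a a' : H g) b : (a = ei b /\ a' = ep b) \/ (a = - ei b /\ a' = - ep b) -> a = ei b \/ a = - ei b.
    by tauto.
  case: (ltngtP i.1 j.1) => [lt|gt|e].
  + by left; apply: (std_D lt hx (wk _ _ _ hy)).
  + by right; apply: (std_D gt hy (wk _ _ _ hx)).
  + by case/eqP: kl; apply: val_inj.
- move=> k l t t' c c' kl /hp_idx [i ik hx] /hp_idx [j jl hy]; subst k l.
  by apply: (std_N kl _ hy); tauto.
move=> k l x x' y y' kl hx hy; case: (ltngtP k l) => [lt|gt|e].
- exact: (std_Q lt).
- have lk : l != k by rewrite eq_sym.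
  have := std_Q gt hy hx.
  rewrite -(sig_sym hg pF sp lk hy hx) -(sig_sym hg pF sp lk hy (hp_neg hx)).
  by rewrite (sig_neg hg pF sp kl hx hy).
- by case/eqP: kl; apply: val_inj.
Qed.

End BaseStd.
End Stages.

(** * Existence of B, and vanishing of forms that kill omega *)

Section Forms.
Variables (g : nat) (hg : (4 <= g)%N) (M : lmodType rat).
Implicit Types (x y z w u v t c : H g).

Theorem pform_qform (F : H g -> H g -> H g -> H g -> M) : pform F ->
  exists B, qform B /\ forall a b z w, um a b -> perp a b z w -> F a b z w = B a b z w.
Proof.
move=> pF; have [B1 [q1 n1]] := stage1 hg pF.
have p1 := sub_pform pF q1; have [B2 [q2 n2 d2 o2]] := stage2 hg p1 n1.
have p2 := sub_pform p1 q2; have [B3 [q3 n3 d3 o3 s3]] := stage3 hg p2 n2 d2 o2.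
have p3 := sub_pform p2 q3.
have b3 := base_std hg p3 n3 d3 o3 s3.
exists (fun u v z w => (B1 u v z w + B2 u v z w) + B3 u v z w).
split; first by do !apply: qform_add.
move=> a b z w uab pe; have := base_vanish hg p3 (stdp_symp g) b3 uab pe.
by move=> /eqP; rewrite -!addrA -!opprD subr_eq0 addrA => /eqP.
Qed.

Section Zero.
Variable B : H g -> H g -> H g -> H g -> M.
Hypotheses (qB : qform B)
  (B0 : forall a b z w, um a b -> perp a b z w -> B a b z w = 0)
  (Bom : forall z w, \sum_(k < g) B (Ha k) (Hb k) z w = 0).
Let sp := stdp_symp g.
Let hl z w := qform_altl z w qB.
Let hr u v := qform_altr u v qB.
Let Bs u v z w : B u v z w = B z w u v. Proof. by case: qB. Qed.

Let Bperp z w u v : ty z w -> perp u v z w -> B u v z w = 0.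
Proof.
move=> t pe; apply: (span0 hg (hl z w) t) pe => a b; exact: B0.
Qed.

Let Bhp (k : 'I_g) t t' z w : hp (@stdp g) k t t' -> B (Ha k) (Hb k) z w = B t t' z w.
Proof.
have h := hl z w; case=> [] [-> ->] //=; rewrite ?(altNl h) ?(altNr h) ?opprK //.
exact: (altC h).
exact: (altC h).
Qed.

(** When omega is paired with t /\ w, only the planes of t and of w contribute. *)
Let tau_sym i l t t' w w' : i != l -> hp (@stdp g) i t t' -> hp (@stdp g) l w w' ->
  B t t' t w = B w w' w t.
Proof.
move=> il ht hw; have li : l != i by rewrite eq_sym.
have := Bom t w; rewrite (bigD1 i) //= (bigD1 l) //= big1 => [|k /andP[ki kl]].
  rewrite addr0 (Bhp _ _ ht) (Bhp _ _ hw) (altC (hr w w') t w) => /eqP.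
  by rewrite subr_eq0 => /eqP.
frame2 sp (hp0 (@stdp g) k) ht ki; hp2 sp (hp0 (@stdp g) k) hw kl.
apply: B0; first exact: (hp_um sp (hp0 (@stdp g) k)).
by split.
Qed.

(** Expansion of the generator (t /\ (c + t')).((c' + t) /\ w), in which two of the four terms
    vanish. *)
Let cen i l j t t' w w' c c' : i != l -> j != i -> hp (@stdp g) i t t' ->
  hp (@stdp g) l w w' -> hp (@stdp g) j c c' -> sform c w = 0 ->
  B t c c' w = - B t t' t w.
Proof.
move=> il ji ht hw hc cw; frame2 sp hc ht ji; frame2 sp ht hw il.
have e : B t (c + t') (c' + t) w = 0 by apply: B0; side.
have ttc : ty t c by apply: (ty_um (x0 := t') (y0 := c')); side.
have e1 : B t c t w = 0 by rewrite Bs; apply: (Bperp ttc); side.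
have e2 : B t t' c' w = 0.
  have [lj|lj] := eqVneq j l; last by hp2 sp hc hw lj; apply: B0; side.
  subst l; have [ec|ec] := hp_line sp hc hw (etrans (sformC _ _) (etrans (congr1 _ cw) (oppr0 _)));
  by rewrite ec; apply: B0; side.
move: e; rewrite (altDr (hl _ _)) !(altDl (hr _ _)) e1 e2 addr0 add0r => /eqP.
by rewrite addr_eq0 => /eqP.
Qed.

(** [cen] for a third plane, used once at (t, w) and once at (w, t), gives the same value of B with
    opposite signs, whereas [tau_sym] says that both signs agree. *)
Let tau0 i l t t' w w' : i != l -> hp (@stdp g) i t t' -> hp (@stdp g) l w w' ->
  B t t' t w = 0.
Proof.
move=> il ht hw; have li : l != i by rewrite eq_sym.
have [j [ji jl _]] := fourth_ord hg i l l; have hc := hp0 (@stdp g) j.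
have [cw _ c'w _] := hp_diff sp hc hw jl; have [ct _ c't _] := hp_diff sp hc ht ji.
have e1 := cen il ji ht hw (hp_rot hc) c'w.
have e2 := cen li jl hw ht hc ct.
have s := tau_sym il ht hw.
move: e1 e2; rewrite -s; move: (_.1) (_.2) => c c'.
rewrite (altNl (hr _ _)) (Bs w c) (altC (hl w c) c') (altC (hr t c') w) opprK.
move=> /oppr_inj -> e; apply: lmod_half; rewrite {1}e addNr //.
Qed.

Let rho0 (k : 'I_g) x x' : hp (@stdp g) k x x' -> B x x' x x' = 0.
Proof.
move=> hx; have := Bom x x'; rewrite (bigD1 k) //= big1 => [|m mk].
  by rewrite addr0 (Bhp _ _ hx).
have := hp_diff sp (hp0 (@stdp g) m) hx mk => -[? ? ? ?].
by apply: B0 => //; exact: (hp_um sp (hp0 (@stdp g) m)).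
Qed.

(** For w outside the plane of t this reduces to [tau0]. Otherwise w is t or t' up to sign, and the
    two cases come from the squares of t /\ (c + c') and of an isotropic bivector mixing the two
    planes. *)
Let contr0 i j l t t' w w' c c' : j != i -> hp (@stdp g) i t t' ->
  hp (@stdp g) l w w' -> hp (@stdp g) j c c' -> sform c w = 0 -> B t c c' w = 0.
Proof.
move=> ji ht hw hc cw; have ij : i != j by rewrite eq_sym.
have [il|il] := eqVneq i l; last first.
  by rewrite (cen il ji ht hw hc cw) (tau0 il ht hw) oppr0.
subst l; frame2 sp ht hc ij.
have case1 : B t c c' t = 0.
  have tT : ty t (c + c') by apply: (ty_um (x0 := t') (y0 := c')); side.
  have t1 : ty t c by apply: (ty_um (x0 := t') (y0 := c')); side.
  have t2 : ty t c' by apply: (ty_um (x0 := t') (y0 := - c)); side.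
  have e : B t (c + c') t (c + c') = 0 by apply: (Bperp tT); side.
  have e1 : B t c t c = 0 by apply: (Bperp t1); side.
  have e2 : B t c' t c' = 0 by apply: (Bperp t2); side.
  move: e; rewrite (altDr (hl _ _)) !(altDr (hr _ _)) e1 e2 addr0 add0r (Bs t c').
  by move/lmod_half => e; rewrite (altC (hr t c)) e oppr0.
have case2 : B t c c' t' = 0.
  (* the square of (t + y) /\ (t' - y') with (y, y') = (- c', c) *)
  have tS := sig_ty hg sp ij ht (hp_rotV hc).
  have e : B (t - c') (t' - c) (t - c') (t' - c) = 0 by apply: (Bperp tS); side.
  have t1 : ty t c by apply: (ty_um (x0 := t') (y0 := c')); side.
  have t2 : ty c' t' by apply: (ty_um (x0 := - c) (y0 := - t)); side.
  have r1 := rho0 ht; have r2 := rho0 (hp_rotV hc).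
  have u1 : B t t' c' c = 0 by apply: B0; side.
  have u2 : B t c t c = 0 by apply: (Bperp t1); side.
  have u3 : B c' t' c' t' = 0 by apply: (Bperp t2); side.
  have f4 : B c' c c' c = 0.
    by move: r2; rewrite (altNl (hl _ _)) (altNl (hr _ _)) opprK.
  have u4 := tau0 ij ht hc.
  have u5 := tau0 ij (hp_rot ht) (hp_rot hc).
  have u6 := tau0 ji hc ht.
  have u7 := tau0 ji (hp_rot hc) (hp_rot ht).
  have f5 : B t t' c' t' = 0.
    rewrite (altC (hr t t')) (altC (hl t' c')) opprK.
    by move: u5; rewrite (altNr (hl _ _)) => /eqP; rewrite oppr_eq0 => /eqP.
  have f6 : B t c c' c = 0 by rewrite Bs (altC (hr c' c)) (altC (hl c t)) opprK.
  have f7 : B c' t' c' c = 0.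
    rewrite Bs; move: u7; rewrite (altNr (hl _ _)) => /eqP.
    by rewrite oppr_eq0 => /eqP.
  apply: lmod_half; rewrite -[RHS]e !(altBl (hl _ _)) !(altBr (hl _ _)).
  rewrite !(altBl (hr _ _)) !(altBr (hr _ _)) (Bs c' t' t) (Bs t c t) (Bs c' c t).
  rewrite (Bs c' t' t) (Bs c' c t) (Bs c' c c' t') r1 u2 u3 f4 u1 u4 f5 f6 f7.
  by lmod.
have [[-> _]|[-> _]|[-> _]|[-> _]] := hp_trans ht hw; rewrite ?(altNr (hr _ _)) ?case1 ?case2 ?oppr0 //.
Qed.

Let scal0 (e : rat) (m : M) : e * e = 1 -> e *: m = 0 -> m = 0.
Proof. by move=> e2 e0; rewrite -[m]scale1r -e2 -scalerA e0 scaler0. Qed.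

Let mid0 (i j l : idx g) : B (ei i) (ei j) (ei (ptn j)) (ei l) = 0.
Proof.
have [->|ij] := eqVneq i j; first exact: (altxx (hl _ _)).
have [->|lj] := eqVneq l (ptn j); first exact: (altxx (hr _ _)).
have [e|nij] := eqVneq j.1 i.1; last first.
  have n' : i.1 != j.1 by rewrite eq_sym.
  have := contr0 nij (hp_ei i) (hp_ei l) (hp_ei j) (ei_perp lj).
  by rewrite /ep (altZl (hr _ _)) => /(scal0 (eps2 j)).
have -> : i = ptn j by apply: ptn_plane; rewrite // eq_sym.
have hj := hp_ei (ptn j); rewrite /ep ptnK in hj.
have [el|nl] := eqVneq (ptn j).1 l.1.
  have -> : l = j.
    by apply: contraNeq lj => n; apply/eqP/ptn_plane => //; rewrite eq_sym.
  have := rho0 hj; rewrite (altZr (hl _ _)) (altZr (hr _ _)) scalerA eps2 scale1r //.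
have := tau0 nl hj (hp_ei l).
by rewrite (altZr (hl _ _)) => /(scal0 (eps2 (ptn j))).
Qed.

Theorem qform_zero u v z w : B u v z w = 0.
Proof.
apply: (@ei_expand0 _ _ (fun c => B c v z w)) => [|i _]; first exact: (alt_linl (hl z w)).
apply: (@ei_expand0 _ _ (fun c => B (ei i) c z w)) => [|j _]; first exact: (alt_linr (hl z w)).
apply: (@ei_expand0 _ _ (fun c => B (ei i) (ei j) c w)) => [|k _].
  exact: (alt_linl (hr _ _)).
apply: (@ei_expand0 _ _ (fun c => B (ei i) (ei j) (ei k) c)) => [|l _].
  exact: (alt_linr (hr _ _)).
have [->|ij] := eqVneq i j; first exact: (altxx (hl _ _)).
have [->|kl] := eqVneq k l; first exact: (altxx (hr _ _)).
have [->|n1] := eqVneq k (ptn j); first exact: mid0.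
have [->|n2] := eqVneq l (ptn j); first by rewrite (altC (hr _ _)) mid0 oppr0.
have [->|n3] := eqVneq k (ptn i); first by rewrite (altC (hl _ _)) mid0 oppr0.
have [->|n4] := eqVneq l (ptn i).
  by rewrite (altC (hl _ _)) (altC (hr _ _)) mid0 !oppr0.
rewrite Bs; apply: (Bperp (ei_ty ij)); apply: iperp_perp.
by apply/and4P; split.
Qed.

End Zero.
End Forms.

(** * The inverse of the linearization *)

Lemma wedge_alt (F : fieldType) (V : lmodType F) : alt_bilinear (@wedge F V).
Proof.
split=> [x|a x x' y|a x y y']; rewrite wedge.unlock.
- by apply: vproj0; apply: wedge2_alt.
- by rewrite -linearP; apply/vproj_eq/mem_span/wedge2_linl.
- by rewrite -linearP; apply/vproj_eq/mem_span/wedge2_linr.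
Qed.

Lemma sym2_lift (F : fieldType) (V W : lmodType F) (b : V -> V -> W) :
  (forall x, linear (b x)) -> (forall x y, b x y = b y x) ->
  exists f : {linear sym2 V -> W}, forall x y, f (smul x y) = b x y.
Proof.
move=> bl bs.
have b0 m : sym2_rel m -> fext (fun p : V * V => b p.1 p.2) m = 0.
  case=> [x y|a x x' y].
    by rewrite linearB /= !fextU /= bs subrr.
  by rewrite linearB linearP /= !fextU /= !(bs _ y) bl subrr.
exists (vlift b0) => x y; rewrite smul.unlock.
by apply: etrans (vliftE _ _) (fextU _ _).
Qed.

Section Lifts.
Variables (g : nat) (W : lmodType rat).
Implicit Types (x y z w u v : H g) (k : wedge2Q g).

Section Lift1.
Variable f : H g -> H g -> W.
Hypotheses (hf : alt_bilinear f) (f0 : \sum_(i < g) f (Ha i) (Hb i) = 0).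

Lemma wlift0 (v : wedge2 (H g)) : v = omega g -> wedge2_lift hf v = 0.
Proof.
move=> ->; rewrite /omega linear_sum /=; rewrite -[RHS]f0.
by apply: eq_bigr => i _; exact: wedge2_liftE.
Qed.

Definition wlift : {linear wedge2Q g -> W} := vlift wlift0.

Lemma wliftE x y : wlift (projQ g (wedge x y)) = f x y.
Proof. exact: etrans (vliftE _ _) (wedge2_liftE _ _ _). Qed.
End Lift1.

(** The slots descend to the quotient one after the other; that omega dies in the second slot
    follows from the symmetry of B. *)
Lemma qform_lift (B : H g -> H g -> H g -> H g -> W) : qform B ->
  (forall z w, \sum_(i < g) B (Ha i) (Hb i) z w = 0) ->
  exists b : wedge2Q g -> wedge2Q g -> W, [/\ forall k, linear (b k),
    forall k k', b k k' = b k' k &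
    forall x y z w, b (projQ g (wedge x y)) (projQ g (wedge z w)) = B x y z w].
Proof.
move=> qB B0.
pose be k z w := wlift (qform_altl z w qB) (B0 z w) k.
have beE x y z w : be (projQ g (wedge x y)) z w = B x y z w by apply: wliftE.
have beP a k k' z w : be (a *: k + k') z w = a *: be k z w + be k' z w by apply: linearP.
have be0 z w : be 0 z w = 0 by apply: linear0.
have be_alt k : alt_bilinear (be k).
  elim/wedge2Q_ind: k => [|c x y k IH].
    by split=> [x|a x x' y|a x y y']; rewrite !be0 ?scaler0 ?addr0.
  have h := qform_altr x y qB; split=> [z|a z z' w|a z w w']; rewrite !beP !beE.
  - by rewrite (altxx h) (altxx IH) scaler0 addr0.
  - by rewrite (altDl h) (altZl h) (altDl IH) (altZl IH); lmod.
  - by rewrite (altDr h) (altZr h) (altDr IH) (altZr IH); lmod.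
have be_om k : \sum_(i < g) be k (Ha i) (Hb i) = 0.
  elim/wedge2Q_ind: k => [|c x y k IH]; first by rewrite big1.
  rewrite (eq_bigr (fun i => c *: B (Ha i) (Hb i) x y + be k (Ha i) (Hb i))) => [|i _].
    by rewrite big_split /= IH -scaler_sumr B0 scaler0 addr0.
  by rewrite beP beE (proj2 qB).
pose b k k' := wlift (be_alt k) (be_om k) k'.
have bE k z w : b k (projQ g (wedge z w)) = be k z w by apply: wliftE.
have bP k a k1 k2 : b k (a *: k1 + k2) = a *: b k k1 + b k k2 by apply: linearP.
have b0r k : b k 0 = 0 by apply: linear0.
have bPl k a k1 k2 : b (a *: k1 + k2) k = a *: b k1 k + b k2 k.
  elim/wedge2Q_ind: k => [|c z w k IH]; first by rewrite !b0r scaler0 addr0.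
  by rewrite !bP !bE IH beP; lmod.
have b0l k : b 0 k = 0.
  by have := bPl k 0 0 0; rewrite scale0r addr0 scale0r add0r => e; have := bPl k (-1) 0 0;
    rewrite scaler0 addr0 scaleN1r addNr.
exists b; split=> [k a k1 k2|k k'|x y z w]; first exact: bP.
  elim/wedge2Q_ind: k => [|c x y k IH]; first by rewrite b0l b0r.
  rewrite bPl bP IH; congr (_ *: _ + _).
  elim/wedge2Q_ind: k' {IH} => [|d z w k' IH]; first by rewrite b0l b0r.
  by rewrite bPl bP IH !bE !beE (proj2 qB).
by rewrite bE beE.
Qed.

(* The correction vanishes on orthogonal pairs, and its contraction with omega
   is twice the form th. *)
Lemma qform_normalize (B : H g -> H g -> H g -> H g -> W) : qform B ->
  exists B', [/\ qform B', forall z w, \sum_(i < g) B' (Ha i) (Hb i) z w = 0 &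
    forall a b z w, perp a b z w -> B' a b z w = B a b z w].
Proof.
move=> qB; pose th z w := 2^-1 *: \sum_(i < g) B (Ha i) (Hb i) z w.
have tha : alt_bilinear th.
  split=> [x|a x x' y|a x y y']; rewrite /th.
  - by rewrite big1 ?scaler0 // => i _; rewrite (altxx (qform_altr _ _ qB)).
  - rewrite [X in _ *: X](_ : _ = a *: \sum_(i < g) B (Ha i) (Hb i) x y + \sum_(i < g) B (Ha i) (Hb i) x' y).
      by rewrite scalerDr !scalerA mulrC.
    rewrite scaler_sumr -big_split /=.
    by apply: eq_bigr => i _; rewrite (altDl (qform_altr _ _ qB)) (altZl (qform_altr _ _ qB)).
  - rewrite [X in _ *: X](_ : _ = a *: \sum_(i < g) B (Ha i) (Hb i) x y + \sum_(i < g) B (Ha i) (Hb i) x y').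
      by rewrite scalerDr !scalerA mulrC.
    rewrite scaler_sumr -big_split /=.
    by apply: eq_bigr => i _; rewrite (altDr (qform_altr _ _ qB)) (altZr (qform_altr _ _ qB)).
pose C u v z w := sform u z *: th v w - sform u w *: th v z - sform v z *: th u w
  + sform v w *: th u z.
have qC : qform C.
  split=> [z w|u v z w].
    split=> [x|a x x' y|a x y y']; rewrite /C; first by lmod.
      by rewrite !sformE !(altDl tha) !(altZl tha); lmod.
    by rewrite !sformE !(altDl tha) !(altZl tha); lmod.
  rewrite /C (sformC u z) (sformC u w) (sformC v z) (sformC v w).
  by rewrite (altC tha w v) (altC tha z v) (altC tha w u) (altC tha z u); lmod.
have oC z w : \sum_(i < g) C (Ha i) (Hb i) z w = \sum_(i < g) B (Ha i) (Hb i) z w.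
  have half x y : \sum_(i < g) (sform (Ha i) x *: th (Hb i) y - sform (Hb i) x *: th (Ha i) y) = th x y.
    rewrite [in RHS](symp_expand (stdp_symp g) x) /=.
    have f0 : th 0 y = 0 by rewrite (alt0l tha).
    rewrite (big_morph (th^~ y) (fun a b => altDl tha a b y) f0); apply: eq_bigr => i _.
    by rewrite (altBl tha) !(altZl tha) (sformC x (Ha i)) (sformC x (Hb i)); lmod.
  have -> : \sum_(i < g) C (Ha i) (Hb i) z w = th z w - th w z.
    rewrite -(half z w) -(half w z) -sumrB; apply: eq_bigr => i _.
    by rewrite /C -/(th _ _); lmod.
  rewrite (altC tha w) opprK /th -scalerDl (_ : 2^-1 + 2^-1 = 1 :> rat) ?scale1r //.
exists (fun u v z w => B u v z w - C u v z w); split=> [|z w|a b z w [e1 e2 e3 e4]].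
- split=> [z w|u v z w]; last by rewrite (proj2 qB) (proj2 qC).
  by apply: alt_sub; apply: qform_altl.
- by rewrite sumrB oC subrr.
by rewrite /C e1 e2 e3 e4; lmod.
Qed.

End Lifts.

Lemma vquot_ext0 (F : fieldType) (X : choiceType) (R : {malg F[X]} -> Prop)
  (W : lmodType F) (f : {linear vquot R -> W}) :
  (forall x, f (vproj R << x >>) = 0) -> forall s, f s = 0.
Proof.
move=> f0 s; rewrite -[s]vreprK; set m := vrepr s.
rewrite (monalgE m); elim: (enum_fset (msupp m)) => [|x r IH].
  by rewrite big_nil !linear0.
rewrite big_cons.
have -> : << m@_x *g x >> = m@_x *: << x >>.
  by apply/malgP => k; rewrite mcoeffZ !mcoeffU mulr_natr.
by rewrite linearP linearP IH addr0 f0 scaler0.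
Qed.

Lemma sym2_ext0 (F : fieldType) (V W : lmodType F) (f : {linear sym2 V -> W}) :
  (forall x y, f (smul x y) = 0) -> forall s, f s = 0.
Proof.
move=> f0; apply: (@vquot_ext0 _ _ _ _ f) => -[x y].
by have := f0 x y; rewrite smul.unlock.
Qed.

(** When a, b is a symplectic pair, the projection onto its orthogonal along its span. *)
Definition prj (g : nat) (a b u : H g) : H g := u - sform u b *: a + sform u a *: b.

Lemma alt_split (g : nat) (M : lmodType rat) (L : H g -> H g -> M) a b x y c d e f :
  alt_bilinear L -> L (x + c *: a - d *: b) (y + e *: a - f *: b) =
  L x y + L a (c *: y - e *: x) - L b (d *: y - f *: x) + (d * e - c * f) *: L a b.
Proof. by move=> h; rewrite !(altE h) (altC h x a) (altC h x b) (altC h b a); lmod. Qed.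

Lemma lmod_comb (M : lmodType rat) (w0 t p q a a' b b' m : M) (c r k : rat) :
  t = q + a' - b' + k *: m -> w0 = p + a - b + r *: m ->
  c *: w0 + t = c *: p + q + (c *: a + a') - (c *: b + b') + (c * r + k) *: m.
Proof. by move=> -> ->; lmod. Qed.

Lemma sym_split (g : nat) (M : lmodType rat) (S : H g -> H g -> M) a b x y :
  (forall x, linear (S x)) -> (forall x y, S x y = S y x) ->
  sform a x *: S b y - sform a y *: S b x - sform b x *: S a y + sform b y *: S a x =
  S a (prj a b (sform x b *: y - sform y b *: x)) -
  S b (prj a b (sform x a *: y - sform y a *: x)).
Proof.
move=> Sl SC; have SD u v w : S u (v + w) = S u v + S u w.
  by rewrite -[v in LHS]scale1r Sl scale1r.
have S0 u : S u 0 = 0 by apply: (addrI (S u 0)); rewrite -SD !addr0.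
have SZ u c v : S u (c *: v) = c *: S u v by rewrite -[c *: v]addr0 Sl S0 addr0.
have SN u v : S u (- v) = - S u v by rewrite -[- v]scaleN1r SZ scaleN1r.
rewrite /prj !sformE !(SD, SZ, SN) (SC b a).
by rewrite (sformC x a) (sformC x b) (sformC y a) (sformC y b); lmod.
Qed.

(** * Bivectors sym-orthogonal to a symplectic pair *)

Section K.
Variable g : nat.
Implicit Types (x y z w u v a b : H g) (k s : wedge2Q g).
Local Notation pw x y := (projQ g (wedge x y)).

Lemma Ks_ext0 (W : lmodType rat) (f : {linear Ks g -> W}) :
  (forall k1 k2 (h : is_gen k1 k2), f (Kbr h) = 0) -> forall q, f q = 0.
Proof.
move=> f0; apply: (@vquot_ext0 _ _ _ _ f) => -[[k1 k2] p].
have := f0 k1 k2 (asboolW p).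
by rewrite /Kbr /gen; have -> : asboolT (asboolW p) = p by exact: bool_irrelevance.
Qed.

(** A total version of the generators, with junk value 0, so that linearity can be stated without
    membership proofs. *)
Definition Kb k1 k2 : Ks g :=
  if pselect (is_gen k1 k2) is left h then Kbr h else 0.

Lemma KbE k1 k2 (h : is_gen k1 k2) : Kb k1 k2 = Kbr h.
Proof.
rewrite /Kb; case: (pselect _) => [h'|n]; last by case: (n h).
by rewrite (Prop_irrelevance h' h).
Qed.

Lemma KbC k1 k2 : is_gen k1 k2 -> Kb k2 k1 = Kb k1 k2.
Proof.
move=> h; have h' := is_genC h; rewrite (KbE h) (KbE h').
by apply/vproj_eq/mem_span/K_rel_sym.
Qed.

Lemma KbP s k1 k2 (l : rat) : symplectic_pair s -> sym_orthogonal s k1 ->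
  sym_orthogonal s k2 -> Kb s (l *: k1 + k2) = l *: Kb s k1 + Kb s k2.
Proof.
move=> ps o1 o2; have h1 := is_gen_pair ps o1; have h2 := is_gen_pair ps o2.
have h := is_gen_lin l 1 ps o1 o2.
have : Kb s (l *: k1 + 1 *: k2) = l *: Kb s k1 + 1 *: Kb s k2.
  rewrite (KbE h) (KbE h1) (KbE h2) /Kbr -!linearZ -linearD.
  by apply/vproj_eq/mem_span/K_rel_lin.
by rewrite !scale1r.
Qed.

Lemma um_pair a b : um a b -> symplectic_pair (pw a b).
Proof. by case=> *; exists a, b. Qed.

Lemma perp_orth a b z w : perp a b z w -> sym_orthogonal (pw a b) (pw z w).
Proof.
by case=> e1 e2 e3 e4; rewrite /sym_orthogonal contrE /contr4 e1 e2 e3 e4; lmod.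
Qed.

Section Proj.
Variables a b : H g.
Hypothesis uab : um a b.
Local Notation pr := (prj a b).

Lemma prj_linear : linear pr.
Proof. by move=> c x y; rewrite /prj !sformE; lmod. Qed.

Lemma prj_a u : sform (pr u) a = 0.
Proof. by case: uab => _ _ e; rewrite /prj !sformE (sformC a b) e; ring. Qed.

Lemma prj_b u : sform (pr u) b = 0.
Proof. by case: uab => _ _ e; rewrite /prj !sformE e; ring. Qed.

Lemma prj_perp x y : perp a b (pr x) (pr y).
Proof. by apply: perpC; split; rewrite ?prj_a ?prj_b. Qed.

Lemma prj_id u : sform u a = 0 -> sform u b = 0 -> pr u = u.
Proof. by rewrite /prj => -> ->; lmod. Qed.

Let pi2_alt : alt_bilinear (fun x y => wedge (pr x) (pr y)).
Proof. by apply: alt_comp; [apply: wedge_alt | apply: prj_linear]. Qed.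
Definition pi2 : {linear wedge2 (H g) -> wedge2 (H g)} := wedge2_lift pi2_alt.

Lemma pi2E x y : pi2 (wedge x y) = wedge (pr x) (pr y).
Proof. exact: wedge2_liftE. Qed.

Let cross_alt c : alt_bilinear (fun x y => sform x c *: y - sform y c *: x).
Proof.
by apply: (alt_cross (f := fun x => sform x c) (h := id)) => [e x y|e x y]; rewrite ?sformE.
Qed.
Let cr c : {linear wedge2 (H g) -> H g} := wedge2_lift (cross_alt c).
Let crE c x y : cr c (wedge x y) = sform x c *: y - sform y c *: x.
Proof. exact: wedge2_liftE. Qed.

Let wp : alt_bilinear (@wedge _ (H g)) := @wedge_alt _ _.

Let pr0 : pr 0 = 0. Proof. by rewrite /prj !sform0l; lmod. Qed.

Let pure x y : wedge x y = pi2 (wedge x y) + wedge a (pr (cr b (wedge x y)))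
  - wedge b (pr (cr a (wedge x y)))
  + (sform x a * sform y b - sform x b * sform y a) *: wedge a b.
Proof.
have prB c d u v : pr (c *: u - d *: v) = c *: pr u - d *: pr v.
  by rewrite /prj !sformE; lmod.
rewrite pi2E !crE !prB.
have ex u : u = pr u + sform u b *: a - sform u a *: b by rewrite /prj; lmod.
have e : wedge x y = wedge (pr x + sform x b *: a - sform x a *: b)
  (pr y + sform y b *: a - sform y a *: b) by rewrite -!ex.
rewrite e; have q := @alt_split g _ _ a b (pr x) (pr y) (sform x b) (sform x a) (sform y b) (sform y a) wp.
rewrite q. reflexivity.
Qed.

Let rr_alt : alt_bilinear (fun x y => sform x a * sform y b - sform x b * sform y a : rat^o).
Proof.
split=> [x|c x x' y|c x y y']; rewrite ?sformE /GRing.scale /=; ring.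
Qed.
Let rr : {linear wedge2 (H g) -> rat^o} := wedge2_lift rr_alt.
Let rrE x y : rr (wedge x y) = sform x a * sform y b - sform x b * sform y a.
Proof. exact: wedge2_liftE. Qed.

(** The decomposition of wedge^2 H induced by splitting H into the span of a, b and its
    orthogonal. *)
Let decomp (t : wedge2 (H g)) : t = pi2 t + wedge a (pr (cr b t))
  - wedge b (pr (cr a t)) + (rr t : rat) *: wedge a b.
Proof.
apply: (wedge2_ind (P := fun t => t = pi2 t + wedge a (pr (cr b t))
  - wedge b (pr (cr a t)) + (rr t : rat) *: wedge a b)) t => [|c x y t e].
  by rewrite !linear0 pr0 !(altE wp) scale0r oppr0 !addr0.
have e1 : pi2 (c *: wedge x y + t) = c *: pi2 (wedge x y) + pi2 t by exact: linearP.
have e2 d : pr (cr d (c *: wedge x y + t)) = c *: pr (cr d (wedge x y)) + pr (cr d t).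
  by rewrite linearP prj_linear.
have e3 : rr (c *: wedge x y + t) = c * rr (wedge x y) + rr t by exact: linearP.
have [_ _ lr] := wp; rewrite e1 !e2 e3 !lr rrE.
exact: (lmod_comb c e (pure x y)).
Qed.

Let cr_omega c : cr c (omega g) = c.
Proof.
rewrite /omega linear_sum /= [RHS](symp_expand (stdp_symp g)) /=.
by apply: eq_bigr => i _; rewrite crE (sformC c (Ha i)) (sformC c (Hb i)); lmod.
Qed.

Let rr_omega : rr (omega g) = 1.
Proof.
rewrite /omega linear_sum /=; case: uab => _ _ <-; apply: eq_bigr => i _.
rewrite rrE (sformC a (Ha i)) (sformC a (Hb i)) (sformC b (Ha i)) (sformC b (Hb i)).
by rewrite !sform_a !sform_b; ring.
Qed.

(** Modulo omega, a /\ b is minus the symplectic element of the orthogonal, hence lies in the image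
    of [pi2] too. *)
Let pw_ab : pw a b = - projQ g (pi2 (omega g)).
Proof.
have : projQ g (omega g) = 0 by exact: vproj0.
rewrite {1}(decomp (omega g)) !cr_omega rr_omega scale1r.
have -> : pr a = 0 by rewrite /prj sformxx; case: uab => _ _ ->; lmod.
have -> : pr b = 0 by rewrite /prj sformxx (sformC a b); case: uab => _ _ ->; lmod.
rewrite !(alt0r wp) subr0 addr0 linearD => /eqP.
by rewrite addrC addr_eq0 => /eqP.
Qed.

Let contr_pi (t : wedge2 (H g)) : contr (pw a b) (projQ g t) =
  smul a (pr (cr b t)) - smul b (pr (cr a t)).
Proof.
apply: (wedge2_ind (P := fun t => contr (pw a b) (projQ g t) =
  smul a (pr (cr b t)) - smul b (pr (cr a t)))) t => [|c x y t e].
  by rewrite !linear0 pr0 contr0r !smul0r subr0.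
have e1 : projQ g (c *: wedge x y + t) = c *: pw x y + projQ g t by exact: linearP.
have e2 d : pr (cr d (c *: wedge x y + t)) = c *: pr (cr d (wedge x y)) + pr (cr d t).
  by rewrite linearP prj_linear.
have e3 : contr4 a b x y = smul a (pr (cr b (wedge x y))) - smul b (pr (cr a (wedge x y))).
  by rewrite !crE; apply: (sym_split (S := @smul _ (H g))); [apply: smul_linear | apply: smulC].
rewrite e1 contrPr e contrE !e2 !smulPr e3 scalerBr.
by rewrite opprD !addrA; congr (_ + _); rewrite -!addrA; congr (_ + _); rewrite addrC.
Qed.

Let smul_indep P Q : sform P a = 0 -> sform P b = 0 -> sform Q a = 0 ->
  sform Q b = 0 -> smul a P - smul b Q = 0 -> P = 0 /\ Q = 0.
Proof.
move=> Pa Pb Qa Qb e.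
(* Contracting with b isolates P and contracting with a isolates Q. *)
have ext c : exists f : {linear sym2 (H g) -> H g},
    forall x y, f (smul x y) = sform x c *: y + sform y c *: x.
  apply: sym2_lift => [x d y z|x y]; last by rewrite addrC.
  by rewrite !sformE; lmod.
have [_ _ ab] := uab; split.
  have [f fE] := ext b; move/(congr1 f): e; rewrite linear0 linearB /= !fE.
  by rewrite ab Pb Qb sformxx !scale0r scale1r !addr0 subr0.
have [f fE] := ext a; move/(congr1 f): e; rewrite linear0 linearB /= !fE.
rewrite Pa Qa sformxx (sformC a b) ab !scale0r scaleN1r !addr0 sub0r opprK.
by [].
Qed.

(** The contraction with a /\ b is a.P - b.Q for the mixed components P and Q, so it vanishes only
    if both do. The remaining multiple of a /\ b is absorbed by [pw_ab], which explains the multiple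
    of omega in the witness. *)
Lemma orth_pi2 k : sym_orthogonal (pw a b) k -> exists t, k = projQ g (pi2 t).
Proof.
have kE : projQ g (vrepr k) = k by exact: vreprK.
rewrite -kE /sym_orthogonal contr_pi => o; move: (vrepr k) o => t o.
have [P0 Q0] := smul_indep (prj_a _) (prj_b _) (prj_a _) (prj_b _) o.
exists (t - (rr t : rat) *: omega g).
rewrite {1}(decomp t) P0 Q0 !(alt0r wp) subr0 addr0.
have e1 : projQ g (pi2 t + (rr t : rat) *: wedge a b) = projQ g (pi2 t) + (rr t : rat) *: pw a b.
  by rewrite linearD linearZ.
have e2 : pi2 (t - (rr t : rat) *: omega g) = pi2 t - (rr t : rat) *: pi2 (omega g).
  by rewrite linearB linearZ.
by rewrite e1 e2 pw_ab linearB linearZ scalerN.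
Qed.

Lemma pi2_orth t : sym_orthogonal (pw a b) (projQ g (pi2 t)).
Proof.
apply: (wedge2_ind (P := fun t => sym_orthogonal (pw a b) (projQ g (pi2 t)))) t => [|c x y t IH].
  by rewrite !linear0 /sym_orthogonal contr0r.
have -> : projQ g (pi2 (c *: wedge x y + t)) = c *: projQ g (pi2 (wedge x y)) + projQ g (pi2 t).
  by rewrite !linearP.
by rewrite /sym_orthogonal contrPr IH pi2E (perp_orth (prj_perp x y)) scaler0 addr0.
Qed.

End Proj.
Lemma Kb0 s : symplectic_pair s -> Kb s 0 = 0.
Proof.
move=> ps; have o : sym_orthogonal s 0 by rewrite /sym_orthogonal contr0r.
have := KbP 1 ps o o; rewrite !scale1r addr0 => e.
by apply: (addrI (Kb s 0)); rewrite addr0; apply: esym.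
Qed.

(** The projections make the generator meaningful for all z, w and so linear in each; on vectors
    orthogonal to a and b they do nothing. *)
Definition Kform a b z w : Ks g := Kb (pw a b) (pw (prj a b z) (prj a b w)).

Lemma pw_alt : alt_bilinear (fun x y => pw x y).
Proof.
have [h1 h2 h3] := @wedge_alt _ (H g).
by split=> [x|c x x' y|c x y y']; rewrite ?h1 ?h2 ?h3 ?linear0 ?linearP.
Qed.

Lemma Kform_pform : pform Kform.
Proof.
have [h1 h2 h3] := pw_alt; split=> [a b u|a b c d u u' pe].
  have ps := um_pair u; have o z w := perp_orth (prj_perp u z w).
  split=> [z|q z z' w|q z w w']; rewrite /Kform.
  - by rewrite h1 Kb0.
  - by rewrite prj_linear h2 KbP.
  - by rewrite prj_linear h3 KbP.
have pe' := perpC pe; case: (pe) (pe') => e1 e2 e3 e4 [f1 f2 f3 f4].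
rewrite /Kform !prj_id //; apply/esym/KbC.
by apply: is_gen_pair; [apply: um_pair | apply: perp_orth].
Qed.

End K.

(** * Bijectivity of the linearization *)

Section Main.
Variables (g : nat) (hg : (4 <= g)%N).
Local Notation pw x y := (projQ g (wedge x y)).
Local Notation Phi := (linearization g).

Lemma linearization_retract : exists f : sym2 (wedge2Q g) -> Ks g, cancel Phi f.
Proof.
have [B [qB BE]] := pform_qform hg (Kform_pform g).
have [B' [qB' B'0 B'E]] := qform_normalize qB.
have [b [bl bs bE]] := qform_lift qB' B'0.
have [f fE] := sym2_lift bl bs.
(* By [orth_pi2] it suffices to treat k = z /\ w with z, w orthogonal to a and c, where [B'], [B]
   and [Kform] agree. *)
have bKb a c k : um a c -> sym_orthogonal (pw a c) k -> b (pw a c) k = Kb (pw a c) k.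
  move=> u /(orth_pi2 u) [t ->]; have ps := um_pair u.
  apply: (wedge2_ind (P := fun t => b (pw a c) (projQ g (pi2 a c t)) =
    Kb (pw a c) (projQ g (pi2 a c t)))) t => [|e x y t IH].
    rewrite !linear0 Kb0 //.
    have := bl (pw a c) (-1) 0 0; rewrite scaler0 addr0 => ->.
    by rewrite scaleN1r addNr.
  have -> : projQ g (pi2 a c (e *: wedge x y + t)) =
      e *: projQ g (pi2 a c (wedge x y)) + projQ g (pi2 a c t) by rewrite !linearP.
  have pe := prj_perp u x y.
  rewrite bl IH (KbP _ ps); [|exact: pi2_orth|exact: pi2_orth].
  have id v : prj a c (prj a c v) = prj a c v by rewrite prj_id ?prj_a ?prj_b.
  by rewrite pi2E bE (B'E _ _ _ _ pe) -(BE _ _ _ _ u pe) /Kform !id.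
exists f; move=> q; apply/eqP; rewrite -subr_eq0; apply/eqP.
pose D : {linear Ks g -> Ks g} := (f \o Phi) \- idfun.
rewrite -[LHS]/(D q); apply: Ks_ext0 => k1 k2 h; rewrite /D /= linearizationE fE.
have -> : b k1 k2 = Kb k1 k2; last by rewrite (KbE h) subrr.
have [o [|]] := h.
  by case=> a [c [ia ic e ek]]; subst k1; apply: bKb.
case=> a [c [ia ic e ek]]; subst k2.
rewrite bs bKb // ?(KbC h) //.
by rewrite /sym_orthogonal contrC o oppr0.
Qed.

Let img (s : sym2 (wedge2Q g)) := exists q, s = Phi q.

Lemma linearization_onto s : img s.
Proof.
pose pi : {linear sym2 (wedge2Q g) -> vquot img} := vproj img.
pose B u v z w := pi (smul (pw u v) (pw z w)).
have [h1 h2 h3] := pw_alt g.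
have qB : qform B.
  split=> [z w|u v z w]; last by rewrite /B smulC.
  split=> [x|c x x' y|c x y y']; rewrite /B.
  - by rewrite h1 smulC smul0r linear0.
  - by rewrite h2 smulPl linearP.
  - by rewrite h3 smulPl linearP.
have B0 a b z w : um a b -> perp a b z w -> B a b z w = 0.
  move=> u pe; have h := is_gen_pair (um_pair u) (perp_orth pe).
  by apply: vproj0; exists (Kbr h); rewrite linearizationE.
have Bom z w : \sum_(i < g) B (Ha i) (Hb i) z w = 0.
  rewrite /B -linear_sum /=.
  have -> : \sum_(i < g) smul (pw (Ha i) (Hb i)) (pw z w) = smul (pw z w) (projQ g (omega g)).
    rewrite /omega !linear_sum; apply: eq_bigr => i _; exact: smulC.
  have -> : projQ g (omega g) = 0 by exact: vproj0.
  by rewrite smul0r linear0.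
have pi0 t : pi t = 0.
  apply: sym2_ext0 => k1 k2.
  elim/wedge2Q_ind: k1 => [|c x y k1 IH]; first by rewrite smulC smul0r linear0.
  rewrite smulPl linearP IH addr0.
  elim/wedge2Q_ind: k2 {IH} => [|d z w k2 IH]; first by rewrite smul0r (linear0 pi) scaler0.
  have z0 : pi (smul (pw x y) (pw z w)) = 0 by exact: (qform_zero hg qB B0 Bom).
  by rewrite smulPr linearP scalerDr IH addr0 z0 !scaler0.
have /vproj_eq : vproj img s = vproj img 0 by rewrite -[LHS]/(pi s) -[RHS]/(pi 0) !pi0.
(* The quotient by [img] is zero, so s lies in the span of the image, and by linearity a combination
   of images is an image. *)
rewrite subr0 => /asboolP [n [c [r [/choice [q qE] ->]]]].
exists (\sum_(i < n) c i *: q i); rewrite linear_sum.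
by apply: eq_bigr => i _; rewrite linearZ -qE.
Qed.

End Main.

Theorem theorem7 (g : nat) (hg : (4 <= g)%N) :
  bijective (linearization g : Ks g -> sym2 (wedge2Q g)).
Proof.
have [f fK] := linearization_retract hg; exists f => // s.
by have [q ->] := linearization_onto hg s; rewrite fK.
Qed.
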